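(* The assignment $a\mapsto a(x,D)$, $a\in S^\infty_{1,1}(\mathbb{R}^n\times\mathbb{R}^n)$, given by vanishing frequency modulation is one among the operator assignments $a\mapsto\widetilde{\operatorname{OP}}(a)$, $a\in S^\infty_{1,1}(\mathbb{R}^n\times\mathbb{R}^n)$ (each $\widetilde{\operatorname{OP}}(a)$ being a linear operator from a subspace $D(\widetilde{\operatorname{OP}}(a))\subset\mathcal{S}'(\mathbb{R}^n)$ to $\mathcal{D}'(\mathbb{R}^n)$), with the following two properties: (i) $\widetilde{\operatorname{OP}}$ is compatible with $\operatorname{OP}$ on $S^{-\infty}$; that is, for every $b\in S^{-\infty}(\mathbb{R}^n\times\mathbb{R}^n)$ one has $D(\widetilde{\operatorname{OP}}(b))=\mathcal{S}'(\mathbb{R}^n)$ and $\widetilde{\operatorname{OP}}(b)u=\operatorname{OP}(b)u$ for all $u\in\mathcal{S}'(\mathbb{R}^n)$; (ii) each operator $\widetilde{\operatorname{OP}}(b)$ is stable under vanishing frequency modulation; that is, for every $b\in S^\infty_{1,1}(\mathbb{R}^n\times\mathbb{R}^n)$, every $u\in D(\widetilde{\operatorname{OP}}(b))$ and every $\psi\in C^\infty_0(\mathbb{R}^n)$ with $\psi=1$ in a neighbourhood of the origin, $$\widetilde{\operatorname{OP}}(b)u=\lim_{m\to\infty}\widetilde{\operatorname{OP}}(b^m(1\otimes\psi_m))u\quad\text{in }\mathcal{D}'(\mathbb{R}^n).$$ Moreover, whenever $\widetilde{\operatorname{OP}}$ is an assignment with properties (i) and (ii), then $\widetilde{\operatorname{OP}}(a)\subset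 a(x,D)$ for every $a\in S^\infty_{1,1}(\mathbb{R}^n\times\mathbb{R}^n)$; that is, $D(\widetilde{\operatorname{OP}}(a))\subset D(a(x,D))$ and the two operators coincide on $D(\widetilde{\operatorname{OP}}(a))$.
   Context: Fourier transform: $\mathcal{F}u(\xi)=\hat u(\xi)=\int e^{-i x\cdot\xi}u(x)\,dx$. For $d\in\mathbb{R}$, $S^d_{1,1}(\mathbb{R}^n\times\mathbb{R}^n)$ is the set of $a\in C^\infty(\mathbb{R}^{2n})$ with $|D^\alpha_\eta D^\beta_x a(x,\eta)|\le C_{\alpha,\beta}(1+|\eta|)^{d-|\alpha|+|\beta|}$ for all multiindices $\alpha,\beta$; $S^\infty_{1,1}=\bigcup_d S^d_{1,1}$. $S^{-\infty}(\mathbb{R}^n\times\mathbb{R}^n)$ is the set of $b\in C^\infty(\mathbb{R}^{2n})$ with $|D^\alpha_\eta D^\beta_x b(x,\eta)|\le C_{\alpha,\beta,N}(1+|\eta|)^{-N}$ for all $\alpha,\beta,N$. For $u\in\mathcal{S}(\mathbb{R}^n)$, $\operatorname{OP}(b)u(x)=(2\pi)^{-n}\int e^{i x\cdot\eta}b(x,\eta)\hat u(\eta)\,d\eta$; for $b\in S^{-\infty}$, $\operatorname{OP}(b)$ denotes also the unique continuous linear extension $\mathcal{S}'(\mathbb{R}^n)\to\mathcal{S}'(\mathbb{R}^n)$. Frequency modulation: for $\psi\in C^\infty_0(\mathbb{R}^n)$ with $\psi=1$ near the origin, put $\psi_m(\xi)=\psi(2^{-m}\xi)$ and $b^m(x,\eta)=\psi(2^{-m}D_x)b(x,\eta)=\mathcal{F}^{-1}_{\xi\to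 x}(\psi(2^{-m}\xi)\mathcal{F}_{x\to\xi}b(\xi,\eta))$ for $b\in S^\infty_{1,1}$; $b^m(1\otimes\psi_m)$ denotes the symbol $b^m(x,\eta)\psi_m(\eta)$, which is in $S^{-\infty}$. Definition of $a(x,D)$ by vanishing frequency modulation: for $a\in S^\infty_{1,1}$, the domain $D(a(x,D))$ consists of those $u\in\mathcal{S}'(\mathbb{R}^n)$ for which $\lim_{m\to\infty}\operatorname{OP}(a^m(1\otimes\psi_m))u$ exists in $\mathcal{D}'(\mathbb{R}^n)$ for every $\psi\in C^\infty_0(\mathbb{R}^n)$ equal to $1$ in a neighbourhood of the origin and is independent of such $\psi$; then $a(x,D)u$ is this limit. *)

(* Defs.v *)
From HB Require Import structures.
From mathcomp Require Import all_boot all_order all_algebra.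
From mathcomp Require Import all_classical all_reals all_analysis.
From mathcomp Require Import complex.

Set Implicit Arguments.
Unset Strict Implicit.
Unset Printing Implicit Defensive.

Import Order.TTheory GRing.Theory Num.Theory.
Import numFieldNormedType.Exports.
Import complex.ComplexField.Normc.

Local Open Scope classical_set_scope.
Local Open Scope complex_scope.
Local Open Scope ring_scope.

(* R^n is 'rV[R]_n.  Complex scalars are taken in R[i]^o, which carries the
   topology of C and is a module over R[i].  In the library the norm `|z| of
   z : R[i] lies in R[i]; the real-valued modulus is normc z : R. *)

Section TupleMeasure.
Context {R : realType} {d : measure_display} {T : measurableType d}.
Variable lam : {sigma_finite_measure set T -> \bar R}.

Section Step.
Context {n : nat} (mu : {sigma_finite_measure set (n.-tuple T) -> \bar R}).

Definition tuple_cons (xt : T * n.-tuple T) : n.+1.-tuple T :=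
  [tuple of xt.1 :: xt.2].

Definition tuple_step : set (n.+1.-tuple T) -> \bar R :=
  pushforward (lam \x mu)%E tuple_cons.

Lemma measurable_tuple_cons : measurable_fun [set: T * n.-tuple T] tuple_cons.
Proof. exact: measurable_cons. Qed.

Lemma tuple_step0 : tuple_step set0 = 0%E.
Proof. by rewrite /tuple_step /pushforward preimage_set0 measure0. Qed.

Lemma tuple_step_ge0 A : (0 <= tuple_step A)%E.
Proof. by rewrite /tuple_step /pushforward; exact: measure_ge0. Qed.

Lemma tuple_step_sigma_additive : semi_sigma_additive tuple_step.
Proof.
move=> F mF tF mUF; rewrite /tuple_step /pushforward preimage_bigcup.
apply: measure_semi_sigma_additive.
- by move=> k; rewrite -[X in measurable X]setTI; exact: measurable_tuple_cons.
- apply/trivIsetP => /= i j _ _ ij; rewrite -preimage_setI.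
  by move/trivIsetP : tF => /(_ _ _ _ _ ij) ->//; rewrite preimage_set0.
- rewrite -preimage_bigcup -[X in measurable X]setTI.
  exact: measurable_tuple_cons.
Qed.

HB.instance Definition _ := isMeasure.Build _ _ _ tuple_step
  tuple_step0 tuple_step_ge0 tuple_step_sigma_additive.

Lemma tuple_step_sigma_finite : sigma_finite setT tuple_step.
Proof.
have /sigma_finiteP[F [TF ndF Foo]] := sigma_finiteT lam.
have /sigma_finiteP[G [TG ndG Goo]] := sigma_finiteT mu.
pose split_tuple (t : n.+1.-tuple T) : T * n.-tuple T :=
  (tnth t ord0, [tuple of behead t]).
have msplit : measurable_fun setT split_tuple.
  apply: measurable_fun_pair; first exact: measurable_tnth.
  exact: measurable_behead.
have splitK (xt : T * n.-tuple T) : split_tuple (tuple_cons xt) = xt.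
  by case: xt => x t; congr pair; exact/val_inj.
exists (fun i => split_tuple @^-1` (F i `*` G i)).
  rewrite -preimage_bigcup -[LHS](preimage_setT split_tuple); congr preimage.
  rewrite -setXTT TF TG predeqE => -[x y]; split.
    move=> [/= [i _ Fix] [k _ Gky]]; exists (maxn i k) => //; split.
    - by move: x Fix; exact/subsetPset/ndF/leq_maxl.
    - by move: y Gky; exact/subsetPset/ndG/leq_maxr.
  by move=> [i _ []/= ? ?]; split; exists i.
move=> i; have [mFi Fi] := Foo i; have [mGi Gi] := Goo i; split.
  by rewrite -[X in measurable X]setTI; apply: msplit => //; exact: measurableX.
rewrite /tuple_step /pushforward (_ : _ @^-1` _ = F i `*` G i).
  by rewrite product_measure1E// lte_mul_pinfty// ge0_fin_numE.
by apply/seteqP; split => xt; rewrite /preimage /mkset splitK.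
Qed.

HB.instance Definition _ :=
  Measure_isSigmaFinite.Build _ _ _ tuple_step tuple_step_sigma_finite.

End Step.

(* The n-fold product of lam; for lam the Lebesgue measure of R, this is the
   Lebesgue measure of R^n. *)
Fixpoint tuple_measure (n : nat) :
    {sigma_finite_measure set (n.-tuple T) -> \bar R} :=
  match n with
  | 0 => \d_([tuple] : 0.-tuple T)
  | n'.+1 => tuple_step (tuple_measure n')
  end.

End TupleMeasure.

Section Euclidean.
Context {R : realType}.

Definition dotp n (x xi : 'rV[R]_n) : R := \sum_(i < n) x 0 i * xi 0 i.

(* The library norm on 'rV[R]_n is the sup norm. *)
Definition eucl_norm n (x : 'rV[R]_n) : R := Num.sqrt (dotp x x).

Definition expi (t : R) : R[i]^o := cos t +i* sin t.

Definition cintegral n (f : 'rV[R]_n -> R[i]^o) : R[i]^o :=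
  (\int[tuple_measure lebesgue_measure n]_t complex.Re (f (\row_i tnth t i)))
  +i* (\int[tuple_measure lebesgue_measure n]_t complex.Im (f (\row_i tnth t i))).

Definition partial n (j : 'I_n) (f : 'rV[R]_n -> R[i]^o) : 'rV[R]_n -> R[i]^o :=
  fun x => ('D_(delta_mx 0 j) (fun y => complex.Re (f y)) x)
           +i* ('D_(delta_mx 0 j) (fun y => complex.Im (f y)) x).

Definition partial_derivable n (j : 'I_n) (f : 'rV[R]_n -> R[i]^o) : Prop :=
  forall x, derivable (fun y => complex.Re (f y)) x (delta_mx 0 j) /\
            derivable (fun y => complex.Im (f y)) x (delta_mx 0 j).

Fixpoint Ck n (k : nat) (f : 'rV[R]_n -> R[i]^o) : Prop :=
  continuous f /\
  match k with
  | 0 => True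
  | k'.+1 => forall j, partial_derivable j f /\ Ck k' (partial j f)
  end.

Definition smooth n (f : 'rV[R]_n -> R[i]^o) : Prop := forall k, Ck k f.

Definition multiindex n := {ffun 'I_n -> nat}.

Definition mabs n (al : multiindex n) : nat := (\sum_(i < n) al i)%N.

Definition mpow n (x : 'rV[R]_n) (al : multiindex n) : R :=
  \prod_(i < n) x 0 i ^+ al i.

(* The partial derivatives are not multiplied by the powers of -i that D^alpha
   carries; only their moduli are used. *)
Definition mderiv n (al : multiindex n) (f : 'rV[R]_n -> R[i]^o) :
    'rV[R]_n -> R[i]^o :=
  foldr (fun i g => iter (al i) (partial i) g) f (enum 'I_n).

End Euclidean.

Section DerivativeTheory.
Context {R : realType} {n : nat}.
Implicit Types (f g : 'rV[R]_n -> R[i]^o) (c : R[i]).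

Lemma ReD_scale c (z w : R[i]^o) : complex.Re (c *: z + w) =
  complex.Re c * complex.Re z - complex.Im c * complex.Im z + complex.Re w.
Proof. by case: c z w => [a b] [z1 z2] [w1 w2]. Qed.

Lemma ImD_scale c (z w : R[i]^o) : complex.Im (c *: z + w) =
  complex.Re c * complex.Im z + complex.Im c * complex.Re z + complex.Im w.
Proof. by case: c z w => [a b] [z1 z2] [w1 w2]. Qed.

Lemma is_derive_ReD c f g j x : partial_derivable j f -> partial_derivable j g ->
  is_derive x (delta_mx 0 j) (fun y => complex.Re ((c *: f + g) y))
    (complex.Re (c *: partial j f x + partial j g x)).
Proof.
move=> /(_ x)[fr fi] /(_ x)[gr gi]; rewrite ReD_scale /=.
have /= := is_deriveD (is_deriveB
    (is_deriveZ (complex.Re c) (derivableP fr))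
    (is_deriveZ (complex.Im c) (derivableP fi))) (derivableP gr).
by congr (is_derive _ _ _ _); apply/funext => y; rewrite ReD_scale.
Qed.

Lemma is_derive_ImD c f g j x : partial_derivable j f -> partial_derivable j g ->
  is_derive x (delta_mx 0 j) (fun y => complex.Im ((c *: f + g) y))
    (complex.Im (c *: partial j f x + partial j g x)).
Proof.
move=> /(_ x)[fr fi] /(_ x)[gr gi]; rewrite ImD_scale /=.
have /= := is_deriveD (is_deriveD
    (is_deriveZ (complex.Re c) (derivableP fi))
    (is_deriveZ (complex.Im c) (derivableP fr))) (derivableP gi).
by congr (is_derive _ _ _ _); apply/funext => y; rewrite ImD_scale.
Qed.

Lemma partial_derivableD c f g j : partial_derivable j f ->
  partial_derivable j g -> partial_derivable j (c *: f + g).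
Proof.
by move=> pf pg x; split;
  [have [] := is_derive_ReD c x pf pg | have [] := is_derive_ImD c x pf pg].
Qed.

Lemma partialD c f g j : partial_derivable j f -> partial_derivable j g ->
  partial j (c *: f + g) = c *: partial j f + partial j g.
Proof.
move=> pf pg; apply/funext => x; rewrite /partial.
have [_ ->] := is_derive_ReD c x pf pg; have [_ ->] := is_derive_ImD c x pf pg.
by rewrite [RHS]/GRing.add /=; case: (_ + _).
Qed.

Lemma continuous_lin c f g :
  continuous f -> continuous g -> continuous (c *: f + g).
Proof.
move=> cf cg x.
exact: continuousD (@continuousZl_tmp _ _ _ f c x (cf x)) (cg x).
Qed.

Lemma Ck_lin k c f g : Ck k f -> Ck k g -> Ck k (c *: f + g).
Proof.
elim: k f g => [|k IH] f g [cf hf] [cg hg].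
  by split; first exact: continuous_lin.
split=> [|j]; first exact: continuous_lin.
have [pf Cf] := hf j; have [pg Cg] := hg j; split.
  exact: partial_derivableD.
by rewrite partialD//; exact: IH.
Qed.

Lemma Ck0 k : Ck k (0 : 'rV[R]_n -> R[i]^o).
Proof.
have d0 (j : 'I_n) : partial_derivable j (0 : 'rV[R]_n -> R[i]^o).
  by move=> x; split; exact: derivable_cst.
have p0 (j : 'I_n) : partial j (0 : 'rV[R]_n -> R[i]^o) = 0.
  by apply/funext => x; rewrite /partial/= !derive_cst.
elim: k => [|k IH] /=; (split; first exact: cst_continuous) => // j.
by split => //; rewrite p0.
Qed.

Lemma smooth_partial j f : smooth f -> smooth (partial j f).
Proof. by move=> sf k; have [_ /(_ j)[]] := sf k.+1. Qed.

Lemma smooth_derivable j f : smooth f -> partial_derivable j f.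
Proof. by move=> sf; have [_ /(_ j)[]] := sf 1%N. Qed.

Lemma smooth_lin c f g : smooth f -> smooth g -> smooth (c *: f + g).
Proof. by move=> sf sg k; exact: Ck_lin. Qed.

Lemma smooth_iter j m f : smooth f -> smooth (iter m (partial j) f).
Proof. by move=> sf; elim: m => //= m; exact: smooth_partial. Qed.

Lemma iter_partialD c m f g j : smooth f -> smooth g ->
  iter m (partial j) (c *: f + g) =
  c *: iter m (partial j) f + iter m (partial j) g.
Proof.
move=> sf sg; elim: m => //= m ->.
by rewrite partialD//; apply: smooth_derivable; exact: smooth_iter.
Qed.

Lemma mderivD c al f g : smooth f -> smooth g ->
  mderiv al (c *: f + g) = c *: mderiv al f + mderiv al g.
Proof.
move=> sf sg; rewrite /mderiv; set F := foldr _.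
have sF h : smooth h -> forall s, smooth (F h s).
  by move=> sh; elim=> //= i s; exact: smooth_iter.
elim: (enum _) => //= i s ->.
by rewrite iter_partialD//; exact: sF.
Qed.

End DerivativeTheory.

Section FunctionSpaces.
Context {R : realType} {n : nat}.
Implicit Types f g : 'rV[R]_n -> R[i]^o.

Definition schwartz_pred : {pred ('rV[R]_n -> R[i]^o)} := [pred f |
  `[< smooth f /\ forall al be : multiindex n, exists M : R, forall x,
      `|mpow x al| * normc (mderiv be f x) <= M >]].

Definition testfun_pred : {pred ('rV[R]_n -> R[i]^o)} := [pred f |
  `[< smooth f /\ compact (closure [set x | f x != 0]) >]].

Lemma mderiv0 be : mderiv be (0 : 'rV[R]_n -> R[i]^o) = 0.
Proof.
have s0 : smooth (0 : 'rV[R]_n -> R[i]^o) by move=> k; exact: Ck0.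
have := mderivD (-1) be s0 s0.
by rewrite !scaleN1r !addNr.
Qed.

Lemma normc_ge0 (z : R[i]) : 0 <= normc z.
Proof. by case: z => a b; exact: sqrtr_ge0. Qed.

Lemma le_normc_lin (c : R[i]) (z w : R[i]^o) :
  normc (c *: z + w) <= normc c * normc z + normc w.
Proof. by rewrite -normcM; exact: le_normcD. Qed.

Fact schwartz_submod : submod_closed schwartz_pred.
Proof.
split; rewrite /schwartz_pred.
  apply/asboolP; split=> [k|al be]; first exact: Ck0.
  by exists 0 => x; rewrite mderiv0 normc0 mulr0.
move=> c f g /asboolP[sf bf] /asboolP[sg bg]; apply/asboolP.
split=> [|al be]; first exact: smooth_lin.
have [M fM] := bf al be; have [N gN] := bg al be.
exists (normc c * M + N) => x; rewrite mderivD//.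
apply: (@le_trans _ _ (normc c * (`|mpow x al| * normc (mderiv be f x)) +
    `|mpow x al| * normc (mderiv be g x))).
  rewrite mulrCA -mulrDr; apply: ler_wpM2l => //; exact: le_normc_lin.
by apply: lerD; [apply: ler_wpM2l => //; exact: normc_ge0|exact: gN].
Qed.

HB.instance Definition _ :=
  GRing.isSubmodClosed.Build R[i] ('rV[R]_n -> R[i]^o) schwartz_pred
    schwartz_submod.

Fact testfun_submod : submod_closed testfun_pred.
Proof.
split; rewrite /testfun_pred.
  apply/asboolP; split=> [k|]; first exact: Ck0.
  rewrite (_ : [set _ | _] = set0) ?closure0; first exact: compact0.
  by apply/seteqP; split => x //=; rewrite eqxx.
move=> c f g /asboolP[sf kf] /asboolP[sg kg]; apply/asboolP.
split; first exact: smooth_lin.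
apply: (@subclosed_compact _ _ (closure [set x | f x != 0] `|`
    closure [set x | g x != 0])); [exact: closed_closure|exact: compactU|].
rewrite -closureU; apply: closure_subset => x /=.
have [fx0|fx0] := eqVneq (f x) 0; last by left.
have [gx0|gx0] := eqVneq (g x) 0; last by right.
by rewrite (_ : _ x = c *: f x + g x)// fx0 gx0 scaler0 addr0 eqxx.
Qed.

HB.instance Definition _ :=
  GRing.isSubmodClosed.Build R[i] ('rV[R]_n -> R[i]^o) testfun_pred
    testfun_submod.

End FunctionSpaces.

Record schwartz (R : realType) (n : nat) := Schwartz {
  schwartz_fun :> 'rV[R]_n -> R[i]^o;
  _ : schwartz_fun \in schwartz_pred }.

HB.instance Definition _ (R : realType) (n : nat) :=
  [isSub for @schwartz_fun R n].
HB.instance Definition _ (R : realType) (n : nat) :=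
  [Choice of schwartz R n by <:].
HB.instance Definition _ (R : realType) (n : nat) :=
  [SubChoice_isSubLmodule of schwartz R n by <:].

Record testfun (R : realType) (n : nat) := Testfun {
  testfun_fun :> 'rV[R]_n -> R[i]^o;
  _ : testfun_fun \in testfun_pred }.

HB.instance Definition _ (R : realType) (n : nat) :=
  [isSub for @testfun_fun R n].
HB.instance Definition _ (R : realType) (n : nat) :=
  [Choice of testfun R n by <:].
HB.instance Definition _ (R : realType) (n : nat) :=
  [SubChoice_isSubLmodule of testfun R n by <:].

Section ContinuousBounds.
Context {R : realType} {n : nat}.
Implicit Types f : 'rV[R]_n -> R[i]^o.

Lemma smooth_mderiv al f : smooth f -> smooth (mderiv al f).
Proof.
by move=> sf; rewrite /mderiv; elim: (enum _) => //= i s; exact: smooth_iter.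
Qed.

Lemma normc_norm (z : R[i]) : (normc z)%:C = `|z|.
Proof. by rewrite normc_def; case: z. Qed.

Lemma continuous_normc : continuous (@normc R : R[i]^o -> R).
Proof.
move=> z; apply/(@cvgrPdist_lt _ _ _ (nbhs (z : R[i]^o))) => e e0.
apply/nbhs_ballP.
exists e%:C; first by rewrite /= ltcR.
move=> w; rewrite -ball_normE /= -normc_norm ltcR; apply: le_lt_trans.
rewrite ler_norml; apply/andP; split.
  rewrite lerNl opprB lerBlDr -(normcN (z - w)) opprB.
  by rewrite (le_trans _ (le_normcD _ _))// subrK.
by rewrite lerBlDr (le_trans _ (le_normcD _ _))// subrK.
Qed.

Lemma continuous_compact_bounded f (K : set 'rV[R]_n) : continuous f ->
  compact K -> exists M, forall x, K x -> normc (f x) <= M.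
Proof.
move=> cf cK.
have /compact_bounded [M [_ HM]] : compact ((fun x => normc (f x)) @` K).
  apply: continuous_compact => //; apply: continuous_subspaceT => x.
  by apply: continuous_comp; [exact: cf|exact: continuous_normc].
exists (M + 1) => x Kx; apply: le_trans (ler_norm _) _.
by apply: (HM (M + 1)); [rewrite ltrDl|exists x].
Qed.

End ContinuousBounds.

Section Seminorms.
Context {R : realType} {n : nat}.

Definition schwartz_values (N : nat) (phi : 'rV[R]_n -> R[i]^o) : set R :=
  [set y | exists al be : multiindex n, (mabs al + mabs be <= N)%N /\
     exists x, y = `|mpow x al| * normc (mderiv be phi x)].

Definition schwartz_norm (N : nat) (phi : schwartz R n) : R :=
  sup (schwartz_values N phi).

Definition test_values (K : set 'rV[R]_n) (N : nat)
    (phi : 'rV[R]_n -> R[i]^o) : set R :=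
  [set y | exists al : multiindex n, (mabs al <= N)%N /\
     exists2 x, K x & y = normc (mderiv al phi x)].

Definition test_norm (K : set 'rV[R]_n) (N : nat) (phi : testfun R n) : R :=
  sup (test_values K N phi).

Lemma multiindex_bound (N : nat) (F : multiindex n -> R) :
  exists M, forall al, (mabs al <= N)%N -> F al <= M.
Proof.
exists (\sum_(g : {ffun 'I_n -> 'I_N.+1}) `|F [ffun i => g i : nat]|) => al alN.
have alE : al = [ffun i => (inord (al i) : 'I_N.+1) : nat].
  apply/ffunP => i; rewrite ffunE inordK// ltnS (leq_trans _ alN)//.
  by rewrite /mabs (bigD1 i)//= leq_addr.
rewrite (bigD1 [ffun i => inord (al i) : 'I_N.+1])//=.
apply: (le_trans (ler_norm _)); rewrite ler_wpDr ?sumr_ge0//.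
rewrite le_eqVlt; apply/orP; left; apply/eqP; congr (`|F _|).
by rewrite {1}alE; apply/ffunP => i; rewrite !ffunE.
Qed.

Lemma schwartz_values_ub N (phi : schwartz R n) :
  has_ubound (schwartz_values N phi).
Proof.
have /asboolP[_ H] := valP phi.
pose M0 al be := projT1 (cid (H al be)).
have HM0 al be x : `|mpow x al| * normc (mderiv be phi x) <= M0 al be.
  exact: (projT2 (cid (H al be))).
pose M1 al := projT1 (cid (multiindex_bound N (M0 al))).
have [M HM] := multiindex_bound N M1.
exists M => _ [al [be [albe [x ->]]]].
apply: (le_trans (HM0 al be x)); apply: le_trans (HM al _).
  apply: (projT2 (cid (multiindex_bound N (M0 al)))).
  exact: leq_trans (leq_addl _ _) albe.
exact: leq_trans (leq_addr _ _) albe.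
Qed.

Lemma schwartz_norm_mono N N' (phi : schwartz R n) : (N <= N')%N ->
  schwartz_norm N phi <= schwartz_norm N' phi.
Proof.
move=> NN'.
have [A0|/set0P A0] := eqVneq (schwartz_values N phi) set0; last first.
  apply: sup_le; [|exact: A0|].
  - move=> y [al [be [albe yE]]]; apply/downP; exists y => //.
    by exists al, be; split => //; exact: leq_trans NN'.
  - split; last exact: schwartz_values_ub.
    case: A0 => y [al [be [albe yE]]]; exists y.
    by exists al, be; split => //; exact: leq_trans NN'.
pose z : multiindex n := [ffun=> 0%N].
have z0 : mabs z = 0%N by rewrite /mabs big1// => i _; rewrite ffunE.
suff : schwartz_values N phi (`|mpow 0 z| * normc (mderiv z phi 0)).
  by rewrite A0.
by exists z, z; rewrite z0; split => //; exists 0.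
Qed.

Lemma schwartz_norm_ge0 N (phi : schwartz R n) : 0 <= schwartz_norm N phi.
Proof.
rewrite /schwartz_norm.
have [->|/set0P[y Ay]] := eqVneq (schwartz_values N phi) set0.
  by rewrite sup0.
have : 0 <= y.
  by case: Ay => al [be [_ [x ->]]]; rewrite mulr_ge0// normc_ge0.
move=> /le_trans; apply; apply: ub_le_sup => //; exact: schwartz_values_ub.
Qed.

Lemma test_values_ub K N (phi : testfun R n) : compact K ->
  has_ubound (test_values K N phi).
Proof.
move=> cK; have /asboolP[sphi _] := valP phi.
have H al : exists M, forall x, K x -> normc (mderiv al phi x) <= M.
  apply: continuous_compact_bounded => //.
  by have [] := smooth_mderiv al sphi 0%N.
pose M0 al := projT1 (cid (H al)).
have [M HM] := multiindex_bound N M0.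
exists M => _ [al [alN [x Kx ->]]].
by apply: le_trans (HM al alN); exact: (projT2 (cid (H al))).
Qed.

Lemma test_norm_mono K N N' (phi : testfun R n) : compact K -> (N <= N')%N ->
  test_norm K N phi <= test_norm K N' phi.
Proof.
move=> cK NN'; rewrite /test_norm.
have [A0|/set0P A0] := eqVneq (test_values K N phi) set0; last first.
  have sub : test_values K N phi `<=` test_values K N' phi.
    by move=> y [al [alN yE]]; exists al; split => //; exact: leq_trans NN'.
  apply: sup_le; [|exact: A0|].
  - by move=> y /sub Ay; apply/downP; exists y.
  - split; last exact: test_values_ub.
    by case: A0 => y /sub Ay; exists y.
rewrite A0 sup0; have [->|/set0P[y Ay]] := eqVneq (test_values K N' phi) set0.
  by rewrite sup0.
have : 0 <= y by case: Ay => al [_ [x _ ->]]; exact: normc_ge0.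
move=> /le_trans; apply; apply: ub_le_sup => //; exact: test_values_ub.
Qed.

Lemma test_norm_ge0 K N (phi : testfun R n) : compact K -> 0 <= test_norm K N phi.
Proof.
move=> cK; rewrite /test_norm.
have [->|/set0P[y Ay]] := eqVneq (test_values K N phi) set0.
  by rewrite sup0.
have : 0 <= y by case: Ay => al [_ [x _ ->]]; exact: normc_ge0.
move=> /le_trans; apply; apply: ub_le_sup => //; exact: test_values_ub.
Qed.

Definition tdist_pred : {pred (schwartz R n -> R[i]^o)} := [pred u |
  `[< linear u /\ exists (C : R) (N : nat), forall phi,
        normc (u phi) <= C * schwartz_norm N phi >]].

Definition distr_pred : {pred (testfun R n -> R[i]^o)} := [pred u |
  `[< linear u /\ forall K : set 'rV[R]_n, compact K ->
        exists (C : R) (N : nat), forall phi : testfun R n,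
          closure [set x | phi x != 0] `<=` K ->
          normc (u phi) <= C * test_norm K N phi >]].

Fact linear_lin (V : lmodType R[i]) (c : R[i]) (u v : V -> R[i]^o) :
  linear u -> linear v -> linear (c *: u + v).
Proof.
move=> lu lv a x y.
rewrite -[LHS]/(c *: u (a *: x + y) + v (a *: x + y)).
rewrite -[RHS]/(a *: (c *: u x + v x) + (c *: u y + v y)) lu lv.
by rewrite !scalerDr !scalerA (mulrC c a) addrACA.
Qed.

Fact linear_cst0 (V : lmodType R[i]) : linear (0 : V -> R[i]^o).
Proof. by move=> a x y; rewrite -[LHS]/0 -[RHS]/(a *: 0 + 0) scaler0 addr0. Qed.

Fact bound_lin (c : R[i]) (z w : R[i]^o) (C C' p p' q : R) :
  normc z <= C * p -> normc w <= C' * p' -> p <= q -> p' <= q ->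
  0 <= p -> 0 <= p' ->
  normc (c *: z + w) <= (normc c * `|C| + `|C'|) * q.
Proof.
move=> zp wp pq p'q p0 p'0; rewrite (le_trans (le_normc_lin _ _ _))// mulrDl.
apply: lerD.
  rewrite -mulrA ler_wpM2l ?normc_ge0// (le_trans zp)//.
  by rewrite (le_trans (ler_wpM2r p0 (ler_norm C)))// ler_wpM2l.
by rewrite (le_trans wp)// (le_trans (ler_wpM2r p'0 (ler_norm C')))// ler_wpM2l.
Qed.

Fact tdist_submod : submod_closed tdist_pred.
Proof.
split; rewrite /tdist_pred.
  apply/asboolP; split; first exact: linear_cst0.
  exists 0, 0%N => phi; rewrite mul0r.
  by rewrite -[X in normc X]/(0 : R[i]) normc0.
move=> c u v /asboolP[lu [C [N uC]]] /asboolP[lv [C' [N' vC]]].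
apply/asboolP; split; first exact: linear_lin.
exists (normc c * `|C| + `|C'|), (maxn N N') => phi.
apply: (@bound_lin c _ _ C C' (schwartz_norm N phi) (schwartz_norm N' phi)).
- exact: uC.
- exact: vC.
- exact/schwartz_norm_mono/leq_maxl.
- exact/schwartz_norm_mono/leq_maxr.
- exact: schwartz_norm_ge0.
- exact: schwartz_norm_ge0.
Qed.

HB.instance Definition _ :=
  GRing.isSubmodClosed.Build R[i] (schwartz R n -> R[i]^o) tdist_pred
    tdist_submod.

Fact distr_submod : submod_closed distr_pred.
Proof.
split; rewrite /distr_pred.
  apply/asboolP; split; first exact: linear_cst0.
  move=> K _; exists 0, 0%N => phi _; rewrite mul0r.
  by rewrite -[X in normc X]/(0 : R[i]) normc0.
move=> c u v /asboolP[lu uC] /asboolP[lv vC].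
apply/asboolP; split; first exact: linear_lin.
move=> K cK; have [C [N {}uC]] := uC K cK; have [C' [N' {}vC]] := vC K cK.
exists (normc c * `|C| + `|C'|), (maxn N N') => phi Kphi.
apply: (@bound_lin c _ _ C C' (test_norm K N phi) (test_norm K N' phi)).
- exact: uC.
- exact: vC.
- by apply: test_norm_mono => //; exact: leq_maxl.
- by apply: test_norm_mono => //; exact: leq_maxr.
- exact: test_norm_ge0.
- exact: test_norm_ge0.
Qed.

HB.instance Definition _ :=
  GRing.isSubmodClosed.Build R[i] (testfun R n -> R[i]^o) distr_pred
    distr_submod.

End Seminorms.

Record tdist (R : realType) (n : nat) := Tdist {
  tdist_fun :> schwartz R n -> R[i]^o;
  _ : tdist_fun \in tdist_pred }.

HB.instance Definition _ (R : realType) (n : nat) :=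
  [isSub for @tdist_fun R n].
HB.instance Definition _ (R : realType) (n : nat) :=
  [Choice of tdist R n by <:].
HB.instance Definition _ (R : realType) (n : nat) :=
  [SubChoice_isSubLmodule of tdist R n by <:].

Record distr (R : realType) (n : nat) := Distr {
  distr_fun :> testfun R n -> R[i]^o;
  _ : distr_fun \in distr_pred }.

HB.instance Definition _ (R : realType) (n : nat) :=
  [isSub for @distr_fun R n].
HB.instance Definition _ (R : realType) (n : nat) :=
  [Choice of distr R n by <:].
HB.instance Definition _ (R : realType) (n : nat) :=
  [SubChoice_isSubLmodule of distr R n by <:].

(* S'(R^n) and D'(R^n) carry their weak-* topologies. *)
HB.instance Definition _ (R : realType) (n : nat) :=
  Topological.copy (tdist R n) (initial_topology
    (fun u : tdist R n => (u : {ptws schwartz R n -> R[i]^o}))).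
HB.instance Definition _ (R : realType) (n : nat) :=
  Topological.copy (distr R n) (initial_topology
    (fun u : distr R n => (u : {ptws testfun R n -> R[i]^o}))).

Section Operations.
Context {R : realType} {n : nat}.

(* The maps to_schwartz, to_tdist and to_distr take values in subtypes; the
   default value 0 of insubd is used only for arguments outside S(R^n), S'(R^n)
   or D'(R^n). *)
Definition to_schwartz (f : 'rV[R]_n -> R[i]^o) : schwartz R n := insubd 0 f.

Definition to_tdist (u : schwartz R n -> R[i]^o) : tdist R n := insubd 0 u.

Definition to_distr (u : testfun R n -> R[i]^o) : distr R n := insubd 0 u.

(* The inclusion of S'(R^n) in D'(R^n). *)
Definition tdist_distr (u : tdist R n) : distr R n :=
  to_distr (fun phi => u (to_schwartz phi)).

Definition tdist_of_fun (f : 'rV[R]_n -> R[i]^o) : tdist R n :=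
  to_tdist (fun phi => cintegral (fun x => f x * phi x)).

Definition fourier (f : 'rV[R]_n -> R[i]^o) : 'rV[R]_n -> R[i]^o :=
  fun xi => cintegral (fun x => expi (- dotp x xi) * f x).

Definition inv_fourier (f : 'rV[R]_n -> R[i]^o) : 'rV[R]_n -> R[i]^o :=
  fun x => ((2 * pi) ^- n)%:C * cintegral (fun xi => expi (dotp x xi) * f xi).

Definition fourier_tdist (u : tdist R n) : tdist R n :=
  to_tdist (fun phi => u (to_schwartz (fourier phi))).

Definition inv_fourier_tdist (u : tdist R n) : tdist R n :=
  to_tdist (fun phi => u (to_schwartz (inv_fourier phi))).

Definition mul_tdist (chi : 'rV[R]_n -> R[i]^o) (u : tdist R n) : tdist R n :=
  to_tdist (fun phi => u (to_schwartz (fun x => chi x * phi x))).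

(* chi(D) u *)
Definition fourier_multiplier (chi : 'rV[R]_n -> R[i]^o) (u : tdist R n) :
    tdist R n :=
  inv_fourier_tdist (mul_tdist chi (fourier_tdist u)).

End Operations.

Section Symbols.
Context {R : realType} {n : nat}.

(* A function of (x, eta) in R^n x R^n is a function on 'rV[R]_(n + n), taken
   at row_mx x eta. *)
Definition symbol := 'rV[R]_(n + n) -> R[i]^o.

Implicit Types (a b : symbol) (psi : testfun R n).

(* The derivative of order al in eta and be in x. *)
Definition symbol_deriv (al be : multiindex n) (a : symbol) : symbol :=
  mderiv [ffun k => match fintype.split k with inl i => be i | inr j => al j end] a.

Definition S11 (d : R) (a : symbol) : Prop :=
  smooth a /\ forall al be : multiindex n, exists C : R,
    forall x eta : 'rV[R]_n,
      normc (symbol_deriv al be a (row_mx x eta)) <=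
      C * (1 + eucl_norm eta) `^ (d - (mabs al)%:R + (mabs be)%:R).

Definition S11_infty (a : symbol) : Prop := exists d : R, S11 d a.

Definition S_minus_infty (b : symbol) : Prop :=
  smooth b /\ forall (al be : multiindex n) (N : nat), exists C : R,
    forall x eta : 'rV[R]_n,
      normc (symbol_deriv al be b (row_mx x eta)) <=
      C * (1 + eucl_norm eta) ^- N.

Definition OP_schwartz (b : symbol) (u : schwartz R n) : 'rV[R]_n -> R[i]^o :=
  fun x => ((2 * pi) ^- n)%:C *
    cintegral (fun eta => expi (dotp x eta) * b (row_mx x eta) * fourier u eta).

Definition is_OP_extension (b : symbol) (T : tdist R n -> tdist R n) : Prop :=
  [/\ linear T, continuous T &
      forall u : schwartz R n, T (tdist_of_fun u) = tdist_of_fun (OP_schwartz b u)].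

(* The continuous linear extension S' -> S' of OP(b); for b in S^{-oo} it exists
   and is unique. *)
Definition OP (b : symbol) : tdist R n -> tdist R n :=
  xget (fun=> 0) [set T | is_OP_extension b T].

Definition is_cutoff psi : Prop := \forall xi \near (0 : 'rV[R]_n), psi xi = 1.

Definition dilate psi (m : nat) : 'rV[R]_n -> R[i]^o :=
  fun xi => psi ((2 ^- m : R) *: xi).

(* psi(2^{-m} D_x) acts on b(., eta) in S'(R^n) for each fixed eta. *)
Definition is_modulation psi (m : nat) b (c : symbol) : Prop :=
  S11_infty c /\ forall eta : 'rV[R]_n,
    tdist_of_fun (fun x => c (row_mx x eta)) =
    fourier_multiplier (dilate psi m) (tdist_of_fun (fun x => b (row_mx x eta))).

(* For b in S^oo_{1,1} the modulated symbol exists and is unique, as symbols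
   are continuous and of moderate growth. *)
Definition modulation psi (m : nat) (b : symbol) : symbol :=
  xget (fun=> 0) [set c | is_modulation psi m b c].

(* b^m (1 (x) psi_m) *)
Definition modulated_symbol psi (m : nat) (b : symbol) : symbol :=
  fun z => modulation psi m b z * dilate psi m (rsubmx z).

(* A partially defined map from S'(R^n) to D'(R^n); the values of op_fun outside
   op_dom are irrelevant. *)
Record operator := Operator {
  op_dom : set (tdist R n);
  op_fun :> tdist R n -> distr R n }.

Definition linear_operator (A : operator) : Prop :=
  op_dom A 0 /\ forall (c : R[i]) (u v : tdist R n), op_dom A u -> op_dom A v ->
    op_dom A (c *: u + v) /\ A (c *: u + v) = c *: A u + A v.

Definition operator_sub (A B : operator) : Prop :=
  op_dom A `<=` op_dom B /\ forall u, op_dom A u -> A u = B u.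

Definition vfm_limit (a : symbol) (u : tdist R n) (v : distr R n) : Prop :=
  forall psi, is_cutoff psi ->
    (fun m => tdist_distr (OP (modulated_symbol psi m a) u)) @ \oo --> v.

(* a(x,D) *)
Definition vfm_operator (a : symbol) : operator := {|
  op_dom := [set u | exists v, vfm_limit a u v];
  op_fun := fun u => xget 0 [set v | vfm_limit a u v] |}.

Definition OP_compatible (OPt : symbol -> operator) : Prop :=
  forall b, S_minus_infty b ->
    op_dom (OPt b) = setT /\ forall u, OPt b u = tdist_distr (OP b u).

Definition vfm_stable (OPt : symbol -> operator) : Prop :=
  forall b, S11_infty b -> forall u, op_dom (OPt b) u ->
  forall psi, is_cutoff psi ->
    (fun m => OPt (modulated_symbol psi m b) u) @ \oo --> OPt b u.

(* Only the values of OPt on S^oo_{1,1} matter. *)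
Definition admissible_assignment (OPt : symbol -> operator) : Prop :=
  [/\ forall a, S11_infty a -> linear_operator (OPt a),
      OP_compatible OPt & vfm_stable OPt].

End Symbols.

Arguments symbol : clear implicits.
Arguments operator : clear implicits.

(* Main.v *)
Require Import Defs.
From HB Require Import structures.
From mathcomp Require Import all_boot all_order all_algebra.
From mathcomp Require Import all_classical all_reals all_analysis.
From mathcomp Require Import measurable_realfun complex ring lra.

(** The theorem rests on one analytic fact, [modulated_cvg]: for b in S^{-oo},
    a cutoff psi and u in S', the operators OP(b^m (1 (x) psi_m)) applied to u
    converge in D' to OP(b) u.  It says that the definition by vanishing
    frequency modulation is compatible with OP on S^{-oo}.  The other claims
    are formal.  Every b^m (1 (x) psi_m) belongs to S^{-oo}, so for a compatible
    assignment stability reads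
      OPt(a) u = lim OPt(a^m (1 (x) psi_m)) u = lim OP(a^m (1 (x) psi_m)) u,
    and the right-hand side is the limit that defines a(x,D) u; the same
    computation shows that a(x,D) is stable.  Linearity of
    a(x,D) holds because limits in D' are unique and because some cutoff exists,
    without which the limit would not be determined by its definition.

    For the analytic fact, OP(b) is written as the transpose of the operator
      P_b phi (y) = (2 pi)^{-n} \int\int e^{i (x - y).eta} b(x,eta) phi(x) dx deta.
    This is (2 pi)^{-n} times the value at frequency (0, y) of the Fourier
    transform in R^{2n} of e^{i x.eta} b(x,eta) phi(x).  When b is in S^{-oo} this density is
    rapidly decreasing in all 2n variables, and each of its seminorms is bounded
    by a product of one seminorm of b and one of phi.  Hence P_b maps S to S
    with the same kind of bound [pairing_sbound]; u |-> u o P_b is weak-*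
    continuous and agrees with OP(b) on S by Fubini [pairing_OP_extension].  As S
    is weak-* dense in S' [tdist_interpolate], this is the only continuous
    extension [OP_rapid].  It is then enough to show that b^m (1 (x) psi_m)
    tends to b in the seminorms of S^{-oo} [modulated_close].

    The modulated symbol is an average of translates in x,
      b^m(x,eta) = \int b(x - 2^{-m} y, eta) k(y) dy,   k = F^{-1} psi,
    by Fubini and uniqueness of b^m [modulationE].  The kernel k has integral
    psi(0) = 1, which is Fourier inversion at the origin [inversion0], so the
    mean value theorem gives b^m - b = O(2^{-m}) with all derivatives.  In the
    same way psi_m - 1 = O(2^{-m} (1 + |eta|^2)^n), a growth which the decay of
    b absorbs.

    Decay is measured throughout by the weight prod_i (1 + x_i^2) in place of a
    power of 1 + |x|.  The inverse of the weight is integrable, with integral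
    pi^n, and the weight of (x, y) is the product of the weights of x and y, so
    a bound by it passes through Fubini without loss. *)

Set Implicit Arguments.
Unset Strict Implicit.
Unset Printing Implicit Defensive.
Import Order.TTheory GRing.Theory Num.Theory.
Import numFieldNormedType.Exports.
Import complex.ComplexField.Normc.
Local Open Scope classical_set_scope.
Local Open Scope complex_scope.
Local Open Scope ring_scope.

(** * Product Lebesgue measure: Tonelli and affine substitution *)

Section Measurability.
Context {R : realType}.

Lemma measurable_continuous_row n d (T : measurableType d)
    (v : T -> 'rV[R]_n) (f : 'rV[R]_n -> R) :
  (forall i, measurable_fun setT (fun t => v t 0 i)) -> continuous f ->
  measurable_fun setT (fun t => f (v t)).
Proof.
move=> mv cf.
have mball (q : 'rV[R]_n) (r : R) : 0 < r -> measurable (v @^-1` ball q r).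
  move=> r0.
  have -> : v @^-1` ball q r =
      \big[setI/setT]_(i < n) ((fun t => v t 0 i) @^-1` ball (q 0 i) r).
    rewrite -bigcap_seq; apply/seteqP; split => t /=.
      by move=> bt i /= _; exact: (bt.2 0 i).
    move=> bt; split=> // i j; rewrite !ord1.
    by apply: (bt j); rewrite /= mem_index_enum.
  apply: bigsetI_measurable => i _; rewrite -[X in measurable X]setTI.
  by apply: mv => //; exact: measurable_ball.
move=> _; apply: (measurability _ (RGenOInfty.measurableE R)) => //.
move=> _ [_ [a ->] <-].
rewrite setTI.
pose U := f @^-1` `]a, +oo[%classic.
have oU : open U.
  by apply: open_comp => [x _|]; [exact: cf|exact: interval_open].
pose F (p : 'rV[rat]_n * rat) : set T :=
  if `[< 0 < p.2 /\ ball (map_mx (@ratr R) p.1) (ratr p.2) `<=` U >]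
  then v @^-1` ball (map_mx (@ratr R) p.1) (ratr p.2) else set0.
have -> : (fun t => f (v t)) @^-1` `]a, +oo[%classic = \bigcup_p F p.
  apply/seteqP; split=> t; last first.
    by move=> [p _]; rewrite /F; case: asboolP => // -[_ pU] /pU.
  move=> tU; have /(@nbhs_ballP R _ (v t))[e /= e0 eU] : nbhs (v t) U.
    exact: open_nbhs_nbhs.
  have [r [r0 re]] : exists r : rat, 0 < ratr r :> R /\ ratr r < e / 2.
    have [r] := rat_in_itvoo (divr_gt0 e0 (ltr0Sn R 1)).
    by rewrite in_itv/= => /andP[]; exists r.
  have H i : exists q : rat, `|ratr q - v t 0 i| < ratr r.
    have [|q] := @rat_in_itvoo R (v t 0 i - ratr r) (v t 0 i + ratr r).
      by lra.
    rewrite in_itv/= => /andP[? ?]; exists q.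
    by rewrite ltr_norml; apply/andP; split; lra.
  pose q : 'rV[rat]_n := \row_i projT1 (cid (H i)).
  have vq : ball (map_mx (@ratr R) q) (ratr r) (v t).
    split=> // i j; rewrite !ord1 !mxE.
    by have := projT2 (cid (H j)).
  exists (q, r) => //; rewrite /F asboolT//=; split.
    by move: r0; rewrite ltr0q.
  move=> z qz; apply: eU; apply: (@ball_splitr _ _ (map_mx (@ratr R) q)).
    by apply: le_ball vq; exact: ltW.
  by apply: le_ball qz; exact: ltW.
apply: countable_bigcupT_measurable => // p; rewrite /F.
by case: asboolP => [[p0 _]|_]; [apply: mball; rewrite ltr0q|exact: measurable0].
Qed.
End Measurability.

Section TupleTonelli.
Context {R : realType}.
Local Notation lam := (@lebesgue_measure R).
Local Notation mu := (tuple_measure (@lebesgue_measure R)).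
Local Notation T := (measurableTypeR R).
Local Open Scope ereal_scope.

Lemma tuple_tonelliS n (F : n.+1.-tuple T -> \bar R) :
  measurable_fun setT F -> (forall t, 0 <= F t) ->
  \int[mu n.+1]_t F t = \int[lam]_x \int[mu n]_t F (tuple_cons (x, t)).
Proof.
move=> mF F0; rewrite /= /tuple_step.
rewrite ge0_integral_pushforward//; first last.
  exact: measurable_tuple_cons.
rewrite preimage_setT fubini_tonelli1// => [|x]; last exact: F0.
apply: (measurableT_comp mF); exact: measurable_tuple_cons.
Qed.

Definition tuple_cat n m (st : n.-tuple T * m.-tuple T) : (n + m).-tuple T :=
  [tuple of st.1 ++ st.2].

Lemma measurable_tuple_cat n m : measurable_fun setT (@tuple_cat n m).
Proof.
apply/measurable_fun_tnthP => i; case: (split_ordP i) => j ->.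
  rewrite [X in measurable_fun _ X](_ : _ = (tnth (T:=T))^~ j \o fst).
    by apply: measurableT_comp => //; exact: measurable_tnth.
  by apply/funext => -[s t] /=; rewrite tnth_lshift.
rewrite [X in measurable_fun _ X](_ : _ = (tnth (T:=T))^~ j \o snd).
  by apply: measurableT_comp => //; exact: measurable_tnth.
by apply/funext => -[s t] /=; rewrite tnth_rshift.
Qed.

(** Concatenation of tuples identifies the product of two iterated measures
    with the iterated measure of the sum of the dimensions; the proof peels off
    one coordinate at a time. *)
Lemma tuple_tonelli_cat n m (F : (n + m).-tuple T -> \bar R) :
  measurable_fun setT F -> (forall t, 0 <= F t) ->
  \int[mu (n + m)]_t F t = \int[mu n]_s \int[mu m]_t F (tuple_cat (s, t)).
Proof.
elim: n F => [|n IH] F mF F0.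
  rewrite [RHS]integral_dirac//; last first.
    apply: (@measurable_fun_fubini_tonelli_F _ _ _ _ _ _
      (fun st => F (@tuple_cat 0 m st))) => //.
    exact: (measurableT_comp mF (@measurable_tuple_cat 0 m)).
  rewrite diracT mul1e; apply: eq_integral => t _; congr F.
  exact/val_inj.
have mFc : measurable_fun setT
    (fun st => F (@tuple_cat n.+1 m st)).
  exact: (measurableT_comp mF (@measurable_tuple_cat n.+1 m)).
rewrite (tuple_tonelliS (n := n + m))// tuple_tonelliS//; first last.
- by move=> s; exact: integral_ge0.
- exact: (@measurable_fun_fubini_tonelli_F _ _ _ _ _ _
      (fun st => F (tuple_cat st))).
apply: eq_integral => x _; rewrite IH; first last.
- by move=> t; exact: F0.
- apply: (measurableT_comp mF).
  apply: (measurableT_comp (measurable_tuple_cons (n := n + m))).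
  exact: measurable_pair1.
apply: eq_integral => s _; apply: eq_integral => t _; congr F.
exact/val_inj.
Qed.

Lemma tuple_measure_cat n m A : measurable A ->
  mu (n + m)%N A = pushforward (mu n \x mu m) (@tuple_cat n m) A.
Proof.
move=> mA; have mI : measurable_fun setT (fun t => (\1_A t)%:E : \bar R).
  by apply/measurable_EFinP; exact: measurable_indic.
rewrite -[A in LHS]setTI setIC -integral_indic// tuple_tonelli_cat//.
have mC := @measurable_tuple_cat n m.
rewrite /pushforward -[X in _ = _ X]setIT -integral_indic//; last first.
  by rewrite -[X in measurable X]setTI; exact: mC.
rewrite fubini_tonelli1//.
by apply/measurable_EFinP/measurable_indic; rewrite -[X in measurable X]setTI; exact: mC.
Qed.

Lemma measurable_affine (a b : R) :
  measurable_fun setT (fun x : T => (a * x + b)%R : T).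
Proof. by apply: measurable_funD => //; exact: measurable_funM. Qed.

(** Lebesgue measure is determined by its values on half-open intervals, and
    both sides give such an interval its length. *)
Lemma lebesgue_measure_affine (a b : R) A : a != 0%R -> measurable A ->
  lam A = `|a|%:E * lam ((fun x : T => a * x + b : T)%R @^-1` A).
Proof.
move=> ane0 mA; wlog a0 : a b ane0 / (0 < a)%R => [H|].
  have [a0|a0|a0] := ltgtP a 0%R; [|exact: H|by rewrite a0 eqxx in ane0].
  rewrite (H (- a)%R b)// ?oppr_gt0 ?oppr_eq0// normrN; congr (_ * _).
  rewrite -lebesgue_measureN//; last first.
    by rewrite -[X in measurable X]setTI; exact: measurable_affine.
  congr lam; apply/seteqP; split => x; by rewrite /= mulNr mulrN opprK.
have mf := measurable_affine a b.

pose k := NngNum (normr_ge0 a).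
pose nu : {measure set T -> \bar R} :=
  mscale k (pushforward lam (fun x : T => a * x + b : T)%R).
rewrite (@lebesgue_measure_unique R (nu mf))// => _ [[p q]] _ <-.
rewrite lebesgue_measure_itv /= /nu /mscale /pushforward /=.
rewrite {1}/pushforward (_ : _ @^-1` _ = [set` `](((p - b) / a)%R), (((q - b) / a)%R)]]); last first.
  apply/seteqP; split => x /=; rewrite !in_itv/= ltr_pdivrMr// ler_pdivlMr//;
  by rewrite ltrBlDr lerBrDr mulrC.
rewrite lebesgue_measure_itv /= !lte_fin ltr_pM2r ?invr_gt0// ltrD2r.
case: ifPn => pq; last by rewrite mule0.
rewrite -!EFinD -EFinM.
by rewrite gtr0_norm// -mulrBl mulrCA divff// mulr1; congr EFin; ring.
Qed.

Lemma ge0_integral_affine (a b : R) (F : T -> \bar R) : a != 0%R ->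
  measurable_fun setT F -> (forall t, 0 <= F t) ->
  \int[lam]_x F x = `|a|%:E * \int[lam]_x F (a * x + b)%R.
Proof.
move=> a0 mF F0; have mf := measurable_affine a b.
pose k := NngNum (normr_ge0 a).
pose nu : {measure set T -> \bar R} :=
  mscale k (pushforward lam (fun x : T => a * x + b : T)%R).
rewrite (eq_measure_integral (nu mf)) => [|A mA _]; last first.
  exact: lebesgue_measure_affine.
rewrite ge0_integral_mscale//; congr (_ * _).
by rewrite ge0_integral_pushforward.
Qed.

Definition tuple_affine n (a : R) (v : 'rV[R]_n) (t : n.-tuple T) : n.-tuple T :=
  [tuple (a * tnth t i + v 0%R i)%R | i < n].

Lemma measurable_tuple_affine n a (v : 'rV[R]_n) :
  measurable_fun setT (tuple_affine a v).
Proof.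
apply/measurable_fun_tnthP => i.
rewrite [X in measurable_fun _ X](_ : _ =
    (fun x : T => (a * x + v 0%R i)%R : T) \o (tnth (T:=T))^~ i).
  apply: measurableT_comp; last exact: measurable_tnth.
  exact: measurable_affine.
by apply/funext => t /=; rewrite tnth_mktuple.
Qed.

Lemma ge0_integral_tuple_affine n (a : R) (v : 'rV[R]_n)
    (F : n.-tuple T -> \bar R) : a != 0%R ->
  measurable_fun setT F -> (forall t, 0 <= F t) ->
  \int[mu n]_t F t = (`|a| ^+ n)%:E * \int[mu n]_t F (tuple_affine a v t).
Proof.
move=> a0; elim: n v F => [|n IH] v F mF F0.
  rewrite expr0 mul1e; apply: eq_integral => t _; congr F.
  by rewrite [LHS]tuple0 [RHS]tuple0.
have mFa : measurable_fun setT (F \o tuple_affine a v).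
  exact: (measurableT_comp mF (measurable_tuple_affine a v)).
rewrite tuple_tonelliS// tuple_tonelliS//.
have mG : measurable_fun setT
    (fun x => \int[mu n]_t F (@tuple_cons _ T n (x, t))).
  apply: (@measurable_fun_fubini_tonelli_F _ _ _ _ _ _
    (fun st => F (tuple_cons st))) => //.
  exact: (measurableT_comp mF (measurable_tuple_cons (n := n))).
rewrite (ge0_integral_affine (v 0%R ord0) a0 mG); last first.
  by move=> x; apply: integral_ge0 => t _; exact: F0.
rewrite exprS EFinM -muleA; congr (_ * _).
rewrite -ge0_integralZl_EFin//; first last.
- apply: (@measurable_fun_fubini_tonelli_F _ _ _ _ _ _
    (fun st => F (tuple_affine a v (@tuple_cons _ T n st)))) => //.
  exact: (measurableT_comp mFa (measurable_tuple_cons (n := n))).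
- by move=> x _; apply: integral_ge0 => t _; exact: F0.
apply: eq_integral => x _.
rewrite (IH (\row_i v 0%R (lift ord0 i))); first last.
- by move=> t; exact: F0.
- apply: (measurableT_comp mF).
  apply: (measurableT_comp (measurable_tuple_cons (n := n))).
  exact: measurable_pair1.
congr (_ * _); apply: eq_integral => t _; congr F.
apply: eq_from_tnth => i; rewrite tnth_mktuple.
case: (unliftP ord0 i) => [j ->|->]; last by rewrite !tnth0.
by rewrite /tuple_cons !tnthS tnth_mktuple mxE.
Qed.

Lemma integral_tuple_affine n (a : R) (v : 'rV[R]_n)
    (g : n.-tuple T -> \bar R) : a != 0%R -> measurable_fun setT g ->
  (mu n).-integrable setT (g \o tuple_affine a v) ->
  \int[mu n]_t g t = (`|a| ^+ n)%:E * \int[mu n]_t (g \o tuple_affine a v) t.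
Proof.
move=> a0 mg Ig.
have posE := ge0_integral_tuple_affine v a0 (measurable_funepos mg)
  (fun t => funepos_ge0 g t).
have negE := ge0_integral_tuple_affine v a0 (measurable_funeneg mg)
  (fun t => funeneg_ge0 g t).
rewrite integralE posE negE [X in _ = _ * X]integralE.
rewrite (funepos_comp g (tuple_affine a v)) (funeneg_comp g (tuple_affine a v)).
rewrite [RHS]muleBr//; apply: fin_num_adde_defr.
rewrite -(funepos_comp g (tuple_affine a v)); apply: integrable_fin_num => //.
exact: integrable_funepos.
Qed.

End TupleTonelli.

(** * Continuity of complex-valued functions *)

Section ComplexContinuity.
Context {R : realType}.
Implicit Types (z w : R[i]^o).

Lemma ltcR0 (e : R[i]) : 0 < e -> exists2 r : R, 0 < r & e = r%:C.
Proof.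
case: e => a b; rewrite ltcE /= => /andP[/eqP -> a0].
by exists a.
Qed.

Lemma normcB z w : normc (z - w) = normc (w - z).
Proof. by rewrite -normcN opprB. Qed.

Lemma cvg_normcP {T} {F : set_system T} {FF : Filter F} (f : T -> R[i]^o) (l : R[i]^o) :
  f @ F --> l <-> forall e : R, 0 < e -> \forall x \near F, normc (l - f x) < e.
Proof.
split=> [/cvgrPdist_lt fl e e0|H].
  have /fl : 0 < e%:C by rewrite ltcR.
  by apply: filterS => x; rewrite -normc_norm ltcR.
apply/cvgrPdist_lt => e /ltcR0[r r0 ->].
by apply: filterS (H r r0) => x; rewrite -normc_norm ltcR.
Qed.

Lemma le_Re_normc z : `|complex.Re z| <= normc z.
Proof.
case: z => a b /=; rewrite -sqrtr_sqr ler_wsqrtr// lerDl sqr_ge0//.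
Qed.

Lemma le_Im_normc z : `|complex.Im z| <= normc z.
Proof.
case: z => a b /=; rewrite -sqrtr_sqr ler_wsqrtr// lerDr sqr_ge0//.
Qed.

Lemma normc_le_ReIm z : normc z <= `|complex.Re z| + `|complex.Im z|.
Proof.
case: z => a b /=; rewrite -(@ler_pXn2r _ 2)// ?nnegrE ?sqrtr_ge0 ?addr_ge0//.
rewrite sqr_sqrtr ?addr_ge0 ?sqr_ge0// sqrrD !real_normK ?num_real//.
by rewrite lerD2r lerDl mulrn_wge0 ?mulr_ge0.
Qed.

Lemma cvg_complexP {T} {F : set_system T} {FF : Filter F} (f : T -> R[i]^o) (l : R[i]^o) :
  f @ F --> l <-> (fun x => complex.Re (f x)) @ F --> complex.Re l /\
                  (fun x => complex.Im (f x)) @ F --> complex.Im l.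
Proof.
split=> [/cvg_normcP H|[/cvgrPdist_lt Hr /cvgrPdist_lt Hi]].
  split; apply/cvgrPdist_lt => e e0; apply: filterS (H e e0) => x; apply: le_lt_trans.
    by rewrite -raddfB; exact: le_Re_normc.
  by rewrite -raddfB; exact: le_Im_normc.
apply/cvg_normcP => e e0; have e2 : 0 < e / 2 by rewrite divr_gt0.
near=> x; apply: (le_lt_trans (normc_le_ReIm _)).
rewrite !raddfB (splitr e) ltrD//; near: x; [exact: Hr|exact: Hi].
Unshelve. all: end_near. Qed.

(** Reduces complex continuity to the two real components, to which the
    calculus of real functions applies. *)
Lemma continuous_complexP {T : topologicalType} (f : T -> R[i]^o) :
  continuous f <-> continuous (fun x => complex.Re (f x)) /\
                   continuous (fun x => complex.Im (f x)).
Proof.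
split=> [cf|[cr ci] x]; first by split => x; have /cvg_complexP[] := cf x.
by apply/cvg_complexP; split; [exact: cr|exact: ci].
Qed.

Lemma continuousM_complex {T : topologicalType} (f g : T -> R[i]^o) :
  continuous f -> continuous g -> continuous (fun x => f x * g x : R[i]^o).
Proof.
by move=> cf cg x; apply: cvgM; [exact: cf|exact: cg].
Qed.

End ComplexContinuity.

Lemma continuous_compose {S T U : topologicalType} (g : S -> T) (f : T -> U) :
  continuous g -> continuous f -> continuous (fun x => f (g x)).
Proof. by move=> cg cf x; apply: continuous_comp; [exact: cg|exact: cf]. Qed.

Section ContinuousReal.
Context {R : realType} {T : topologicalType}.
Implicit Types f g : T -> R.

Lemma continuous_add f g : continuous f -> continuous g ->
  continuous (fun x => f x + g x).
Proof. by move=> cf cg x; apply: cvgD; [exact: cf|exact: cg]. Qed.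

Lemma continuous_mul f g : continuous f -> continuous g ->
  continuous (fun x => f x * g x).
Proof. by move=> cf cg x; apply: cvgM; [exact: cf|exact: cg]. Qed.

Lemma continuous_cst (c : R) : continuous (fun _ : T => c).
Proof. by move=> x; exact: cvg_cst. Qed.

Lemma continuous_opp f : continuous f -> continuous (fun x => - f x).
Proof. by move=> cf x; apply: cvgN; exact: cf. Qed.

Lemma continuous_inv f : (forall x, f x != 0) -> continuous f ->
  continuous (fun x => (f x)^-1).
Proof. by move=> f0 cf x; apply: cvgV; [exact: f0|exact: cf]. Qed.

Lemma continuous_after (h : R -> R) f : continuous h -> continuous f ->
  continuous (fun x => h (f x)).
Proof. by move=> ch cf x; apply: (cvg_comp _ _ (cf x)); exact: ch. Qed.

Lemma continuous_into_row n (g : T -> 'rV[R]_n) :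
  (forall i, continuous (fun t => g t 0 i)) -> continuous g.
Proof.
move=> cg x; apply/cvg_ballP => e e0.
have : \forall t \near x, forall i, ball (g x 0 i) e (g t 0 i).
  by apply: filter_forall => i; have /cvg_ballP := cg i x; exact.
by apply: filterS => t H; split=> // i j; rewrite ord1.
Qed.

Lemma continuous_sum_seq I (r : seq I) (F : I -> T -> R) :
  (forall i, continuous (F i)) -> continuous (fun x => \sum_(i <- r) F i x).
Proof.
move=> cF; elim: r => [|i r IH].
  rewrite (_ : (fun _ => _) = fun=> 0); first exact: continuous_cst.
  by apply/funext => y; rewrite big_nil.
rewrite (_ : (fun _ => _) = fun y => F i y + \sum_(j <- r) F j y).
  exact: continuous_add.
by apply/funext => y; rewrite big_cons.
Qed.

Lemma continuous_prod_seq I (r : seq I) (F : I -> T -> R) :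
  (forall i, continuous (F i)) -> continuous (fun x => \prod_(i <- r) F i x).
Proof.
move=> cF; elim: r => [|i r IH].
  rewrite (_ : (fun _ => _) = fun=> 1); first exact: continuous_cst.
  by apply/funext => y; rewrite big_nil.
rewrite (_ : (fun _ => _) = fun y => F i y * \prod_(j <- r) F j y).
  exact: continuous_mul.
by apply/funext => y; rewrite big_cons.
Qed.

End ContinuousReal.

(** * The integrable weight and the integrals that it dominates *)

Section Weight.
Context {R : realType}.

Definition weight n (x : 'rV[R]_n) : R := \prod_(i < n) (1 + x 0 i ^+ 2).

Lemma weight_ge1 n (x : 'rV[R]_n) : 1 <= weight x.
Proof.
rewrite /weight; elim/big_ind: _ => // [a b a1 b1|i _].
  by rewrite -[1]mulr1 ler_pM.
by rewrite lerDl sqr_ge0.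
Qed.

Lemma weight_gt0 n (x : 'rV[R]_n) : 0 < weight x.
Proof. exact: lt_le_trans (weight_ge1 x). Qed.

Lemma weight_ge0 n (x : 'rV[R]_n) : 0 <= weight x.
Proof. exact/ltW/weight_gt0. Qed.

Hint Resolve weight_ge1 weight_gt0 weight_ge0 : core.

Lemma weight_coord n (x : 'rV[R]_n) i : 1 + x 0 i ^+ 2 <= weight x.
Proof.
rewrite /weight (bigD1 i)//= ler_peMr ?addr_ge0 ?sqr_ge0//.
elim/big_ind: _ => // [a b a1 b1|j _]; first by rewrite -[1]mulr1 ler_pM.
by rewrite lerDl sqr_ge0.
Qed.

Lemma weight_row_mx n m (x : 'rV[R]_n) (y : 'rV[R]_m) :
  weight (row_mx x y) = weight x * weight y.
Proof.
rewrite /weight big_split_ord; congr (_ * _); apply: eq_bigr => i _.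
  by rewrite row_mxEl.
by rewrite row_mxEr.
Qed.

Lemma continuous_coord n (i : 'I_n) : continuous (fun x : 'rV[R]_n => x 0 i).
Proof. exact: coord_continuous. Qed.

Lemma continuous_weight n : continuous (@weight n).
Proof.
apply: continuous_prod_seq => i; apply: continuous_add.
  exact: continuous_cst.
apply: (@continuous_after _ _ (fun t => t ^+ 2)); last exact: continuous_coord.
exact: exprn_continuous.
Qed.

Lemma continuous_weightV n : continuous (fun x : 'rV[R]_n => (weight x)^-1).
Proof.
apply: continuous_inv => [x|]; last exact: continuous_weight.
by rewrite gt_eqF.
Qed.

End Weight.
#[global] Hint Extern 0 (is_true (0 < weight _)) => solve[apply: weight_gt0] : core.
#[global] Hint Extern 0 (is_true (0 <= weight _)) => solve[apply: weight_ge0] : core.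
#[global] Hint Extern 0 (is_true (1 <= weight _)) => solve[apply: weight_ge1] : core.

Section Integral.
Context {R : realType}.
Local Notation lam := (@lebesgue_measure R).
Local Notation mu := (tuple_measure (@lebesgue_measure R)).
Local Notation T := (measurableTypeR R).
Local Notation row t := (\row_i tnth t i).

Lemma integral_arctan_density : (\int[lam]_x ((1 + x ^+ 2)^-1)%:E = pi%:E)%E.
Proof.
have c : continuous (fun x : R => (1 + x ^+ 2)^-1) := continuous_oneDsqrV.
rewrite ge0_symfun_integralT//=; first last.
- by move=> x /=; rewrite sqrrN.
- by move=> x; rewrite invr_ge0 addr_ge0 ?sqr_ge0.
rewrite (_ : [set x | _] = `[0, +oo[%classic); last first.
  by apply/seteqP; split=> x /=; rewrite in_itv/= andbT.
have := integral0y_oneDsqr R; rewrite /oneDsqr => ->.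
by rewrite -EFinM; congr EFin; rewrite mulrC divfK.
Qed.

Lemma measurable_row_tnth n (f : 'rV[R]_n -> R) : continuous f ->
  measurable_fun setT (fun t : n.-tuple T => f (row t)).
Proof.
move=> cf; apply: measurable_continuous_row cf => i.
by under eq_fun do rewrite mxE; exact: measurable_tnth.
Qed.

Lemma measurable_row_tnth_EFin n (f : 'rV[R]_n -> R) : continuous f ->
  measurable_fun setT (fun t : n.-tuple T => (f (row t))%:E).
Proof. by move=> cf; apply/measurable_EFinP; exact: measurable_row_tnth. Qed.

(** One coordinate at a time this is the integral of the arctangent density. *)
Lemma integral_weightV n : (\int[mu n]_t ((weight (row t))^-1)%:E = (pi ^+ n)%:E)%E.
Proof.
have ce m := measurable_row_tnth_EFin (@continuous_weightV R m).
elim: n => [|n IH].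
  rewrite integral_dirac//; last exact: (ce _).
  by rewrite diracT mul1e /weight big_ord0 invr1 expr0.
rewrite tuple_tonelliS; first last.
- by move=> t; rewrite lee_fin invr_ge0; exact: weight_ge0.
- exact: (ce _).
rewrite exprS EFinM -integral_arctan_density -ge0_integralZr//; first last.
- by rewrite lee_fin exprn_ge0// pi_ge0.
- by move=> x _; rewrite lee_fin invr_ge0 addr_ge0 ?sqr_ge0.
- apply/measurable_EFinP; apply: continuous_measurable_fun.
  exact: continuous_oneDsqrV.
apply: eq_integral => x _; rewrite -IH -ge0_integralZl_EFin//; first last.
- by rewrite invr_ge0 addr_ge0 ?sqr_ge0.
- exact: (ce _).
- by move=> t _; rewrite lee_fin invr_ge0; exact: weight_ge0.
apply: eq_integral => t _; rewrite -EFinM -invfM; congr (_%:E).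
rewrite /weight big_ord_recl; congr (_ * _)^-1.
  by rewrite mxE tnth0.
by apply: eq_bigr => i _; rewrite !mxE tnthS.
Qed.

Definition dominated n (C : R) (f : 'rV[R]_n -> R) : Prop :=
  continuous f /\ forall x, `|f x| <= C / weight x.

Lemma integrable_weightV n C :
  (mu n).-integrable setT (fun t => (C / weight (row t))%:E).
Proof.
under eq_fun do rewrite EFinM.
apply: integrableZl => //; apply/integrableP; split.
  exact: (measurable_row_tnth_EFin (@continuous_weightV R n)).
under eq_integral do rewrite gee0_abs ?lee_fin ?invr_ge0 ?weight_ge0//.
by rewrite integral_weightV ltry.
Qed.

Lemma dominated_integrable n C f : dominated C f ->
  (mu n).-integrable setT (fun t => (f (row t))%:E).
Proof.
move=> [cf fC]; apply: le_integrable (@integrable_weightV n C) => //.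
  exact: measurable_row_tnth_EFin.
by move=> t _; rewrite lee_fin (le_trans (fC _))// ler_norm.
Qed.

Definition rint n (f : 'rV[R]_n -> R) : R := \int[mu n]_t f (row t).

Lemma rintE n C f : dominated C f ->
  ((rint f)%:E = \int[mu n]_t (f (row t))%:E)%E.
Proof.
by move=> df; rewrite /rint fineK//; apply: integrable_fin_num => //; exact: dominated_integrable df.
Qed.

Lemma rint_weightV n C : rint (fun x : 'rV[R]_n => C / weight x) = C * pi ^+ n.
Proof.
rewrite /rint RintegralZl//; last first.
  by have := @integrable_weightV n 1; under eq_fun do rewrite mul1r.
by rewrite /Rintegral integral_weightV.
Qed.

Lemma rint_lin n C D (c : R) f g : dominated C f -> dominated D g ->
  rint (fun x : 'rV[R]_n => c * f x + g x) = c * rint f + rint g.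
Proof.
move=> /dominated_integrable If /dominated_integrable Ig.
rewrite /rint RintegralD// ?RintegralZl//; exact: (integrableZl _ c If).
Qed.

Lemma rint_bound n C f : dominated C f -> `|@rint n f| <= C * pi ^+ n.
Proof.
move=> df; have If := dominated_integrable df; have [cf fC] := df.
apply: (le_trans (le_normr_Rintegral _ _)) => //.
rewrite -rint_weightV; apply: le_Rintegral => //.
- exact: integrable_norm If.
- exact: integrable_weightV.
Qed.

Lemma rint0 n : rint (fun _ : 'rV[R]_n => 0) = 0.
Proof.
have dz : dominated 0 (fun _ : 'rV[R]_n => 0 : R).
  by split=> [|x]; [exact: cst_continuous|rewrite normr0 mul0r].
by apply/eqP; rewrite -normr_le0 (le_trans (rint_bound dz))// mul0r.
Qed.

Lemma rintZ n C (c : R) f : dominated C f ->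
  rint (fun x : 'rV[R]_n => c * f x) = c * rint f.
Proof.
move=> df; have dz : dominated 0 (fun _ : 'rV[R]_n => 0 : R).
  by split=> [|x]; [exact: cst_continuous|rewrite normr0 mul0r].
have := rint_lin c df dz; rewrite rint0 addr0 => <-.
by congr rint; apply/funext => x; rewrite addr0.
Qed.

Lemma row_tuple_cat n m (st : n.-tuple T * m.-tuple T) :
  row (tuple_cat st) = row_mx (row st.1) (row st.2) :> 'rV[R]_(n + m).
Proof.
apply/rowP => i; rewrite mxE; case: (split_ordP i) => j ->.
  by rewrite tnth_lshift row_mxEl mxE.
by rewrite tnth_rshift row_mxEr mxE.
Qed.

Lemma dominated_rowl n m C (f : 'rV[R]_(n + m) -> R) (x : 'rV_n) :
  dominated C f -> dominated (C / weight x) (fun y : 'rV_m => f (row_mx x y)).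
Proof.
move=> [cf fC]; split=> [y|y].
  apply: (@continuous_comp _ _ _ (fun y => row_mx x y) f); last exact: cf.
  move: y; apply: continuous_into_row => i; case: (split_ordP i) => j ->.
    by under eq_fun do rewrite row_mxEl; exact: cst_continuous.
  by under eq_fun do rewrite row_mxEr; exact: coord_continuous.
by rewrite -mulrA -invfM -weight_row_mx.
Qed.

Lemma dominated_rowr n m C (f : 'rV[R]_(n + m) -> R) (y : 'rV_m) :
  dominated C f -> dominated (C / weight y) (fun x : 'rV_n => f (row_mx x y)).
Proof.
move=> [cf fC]; split=> [x|x].
  apply: (@continuous_comp _ _ _ (fun x => row_mx x y) f); last exact: cf.
  move: x; apply: continuous_into_row => i; case: (split_ordP i) => j ->.
    by under eq_fun do rewrite row_mxEl; exact: coord_continuous.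
  by under eq_fun do rewrite row_mxEr; exact: cst_continuous.
by rewrite -mulrA -invfM [weight y * _]mulrC -weight_row_mx.
Qed.

Section Fubini.
Variables (n m : nat) (C : R) (f : 'rV[R]_(n + m) -> R).
Hypothesis df : dominated C f.
Let F (st : n.-tuple T * m.-tuple T) : \bar R := (f (row (tuple_cat st)))%:E.

Let mF : measurable_fun setT F.
Proof.
have mf := measurable_row_tnth_EFin df.1.
exact: (measurableT_comp mf (@measurable_tuple_cat _ n m)).
Qed.

Let iF : (mu n \x mu m)%E.-integrable setT F.
Proof.
apply/integrable12ltyP => //.
have /integrableP[_] := dominated_integrable df.
rewrite tuple_tonelli_cat//.
apply/measurableT_comp => //; exact: (measurable_row_tnth_EFin df.1).
Qed.

Let rint_prod : ((rint f)%:E = \int[mu n \x mu m]_st F st)%E.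
Proof.
have mf := measurable_row_tnth_EFin df.1.
have mC := @measurable_tuple_cat R n m.
pose nu : {measure set ((n + m).-tuple T) -> \bar R} :=
  pushforward (mu n \x mu m)%E (@tuple_cat R n m).
rewrite (rintE df) (eq_measure_integral (nu mC)).
  by rewrite integral_pushforward.
by move=> A mA _; exact: tuple_measure_cat.
Qed.

(** Domination by the inverse weight provides the integrability that Fubini's
    theorem asks for, and every section of a dominated function is dominated. *)
Lemma rint_row_mx :
  rint f = rint (fun x : 'rV_n => rint (fun y : 'rV_m => f (row_mx x y))).
Proof.
apply: (congr1 fine (_ : (rint f)%:E = _)).
rewrite rint_prod -integral12_prod_meas1//; apply: eq_integral => s _.
rewrite (rintE (dominated_rowl _ df)); apply: eq_integral => t _.
by rewrite /F row_tuple_cat.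
Qed.

Lemma rint_row_mxC :
  rint f = rint (fun y : 'rV_m => rint (fun x : 'rV_n => f (row_mx x y))).
Proof.
apply: (congr1 fine (_ : (rint f)%:E = _)).
rewrite rint_prod -integral21_prod_meas1//; apply: eq_integral => t _.
rewrite (rintE (dominated_rowr _ df)); apply: eq_integral => s _.
by rewrite /F row_tuple_cat.
Qed.

End Fubini.

(** Coordinatewise 1 + x^2 <= (1 + 2/a^2) (1 + v^2) (1 + (a x + v)^2): an affine
    change of variables costs a constant factor, so it preserves domination by
    the inverse weight. *)
Lemma weight_affine n (a : R) (v : 'rV[R]_n) : a != 0 ->
  forall x, weight x <= (1 + 2 / a ^+ 2) ^+ n * weight v * weight (a *: x + v).
Proof.
move=> a0 x.
have -> : (1 + 2 / a ^+ 2) ^+ n = \prod_(i < n) (1 + 2 / a ^+ 2).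
  by rewrite prodr_const card_ord.
rewrite /weight -!big_split /=; apply: ler_prod => i _.
rewrite addr_ge0 ?sqr_ge0//= !mxE.
set u := a * x 0 i + v 0 i.
have -> : x 0 i = (u - v 0 i) / a by rewrite /u addrK mulrAC mulfV ?mul1r.
move: (v 0 i) u => w u; rewrite expr_div_n.
have : 0 <= (a ^+ 2)^-1 by rewrite invr_ge0 sqr_ge0.
move: ((a ^+ 2)^-1) => c c0.
have h1 : (u - w) ^+ 2 * c <= 2 * c * (u ^+ 2 + w ^+ 2).
  rewrite -mulrA [c * _]mulrC mulrA ler_wpM2r//.
  by have := sqr_ge0 (u + w); nra.
have h2 : 0 <= u ^+ 2 * w ^+ 2 by rewrite mulr_ge0// sqr_ge0.
have h3 : 0 <= c * (u ^+ 2 * w ^+ 2) by rewrite mulr_ge0.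
have := sqr_ge0 u; have := sqr_ge0 w; move: h1 h2 h3; nra.
Qed.

Lemma dominated_affine n C (a : R) (v : 'rV[R]_n) f : a != 0 -> dominated C f ->
  exists D, dominated D (fun x => f (a *: x + v)).
Proof.
move=> a0 [cf fC]; have HK := weight_affine v a0.
pose K := (1 + 2 / a ^+ 2) ^+ n * weight v.
exists (C * K); split=> [|x].
  apply: (@continuous_compose _ _ _ (fun x : 'rV[R]_n => a *: x + v) f) => //.
  apply: continuous_into_row => i.
  under eq_fun do rewrite !mxE.
  apply: continuous_add; last exact: continuous_cst.
  by apply: continuous_mul; [exact: continuous_cst|exact: coord_continuous].
have C0 : 0 <= C.
  have := le_trans (normr_ge0 _) (fC 0).
  by rewrite pmulr_lge0 ?invr_gt0 ?weight_gt0.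
apply: (le_trans (fC _)); rewrite -mulrA ler_wpM2l//.
by rewrite ler_pdivlMr// mulrC ler_pdivrMr.
Qed.

Lemma rint_affine n C (a : R) (v : 'rV[R]_n) f : a != 0 -> dominated C f ->
  rint f = `|a| ^+ n * rint (fun x => f (a *: x + v)).
Proof.
move=> a0 df; have mf := measurable_row_tnth_EFin df.1.
pose g := fun t : n.-tuple T => (f (row t))%:E.
have ga : (fun t : n.-tuple T => (f (a *: row t + v))%:E) = g \o tuple_affine a v.
  apply/funext => t; rewrite /g /=; congr (f _)%:E.
  by apply/rowP => i; rewrite !mxE tnth_mktuple.
have [D da] := dominated_affine v a0 df.
have Iga := dominated_integrable da.
apply: (congr1 fine (_ : (rint f)%:E = (_ * _)%:E)).
rewrite EFinM (rintE df) (rintE da) ga; apply: integral_tuple_affine => //.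
by rewrite -ga.
Qed.

Lemma rint_dct n C (f_ : nat -> 'rV[R]_n -> R) f :
  (forall k, dominated C (f_ k)) -> continuous f ->
  (forall x, f_ ^~ x @ \oo --> f x) ->
  (fun k => rint (f_ k)) @ \oo --> rint f.
Proof.
move=> df cf f_f.
have [] := @dominated_convergence _ _ _ (mu n) setT measurableT
  (fun k t => (f_ k (row t))%:E) (fun t => (f (row t))%:E)
  (fun t => (C / weight (row t))%:E).
- by move=> k; exact: measurable_row_tnth_EFin (df k).1.
- exact: measurable_row_tnth_EFin.
- by apply: aeW => t _; apply: cvg_EFin; [near=> k|exact: f_f].
- exact: integrable_weightV.
- by apply: aeW => t k _; rewrite lee_fin; exact: (df k).2.
move=> If _ H; apply: fine_cvg.
rewrite (_ : (rint f)%:E = \int[mu n]_t (f (row t))%:E)%E//.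
by rewrite /rint fineK//; exact: integrable_fin_num.
Unshelve. all: end_near. Qed.

End Integral.

(** * Complex-valued integrals *)

Section ComplexIntegral.
Context {R : realType}.
Implicit Types n m : nat.

Definition cdominated n (C : R) (f : 'rV[R]_n -> R[i]^o) : Prop :=
  continuous f /\ forall x, normc (f x) <= C / weight x.

Lemma cdominatedP n C (f : 'rV[R]_n -> R[i]^o) : cdominated C f ->
  dominated C (fun x => complex.Re (f x)) /\
  dominated C (fun x => complex.Im (f x)).
Proof.
move=> [/continuous_complexP[cr ci] fC]; split; split=> // x.
  exact: le_trans (le_Re_normc _) (fC x).
exact: le_trans (le_Im_normc _) (fC x).
Qed.

Lemma cintegralE n (f : 'rV[R]_n -> R[i]^o) : cintegral f =
  rint (fun x => complex.Re (f x)) +i* rint (fun x => complex.Im (f x)).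
Proof. by []. Qed.

Lemma eq_cintegral n (f g : 'rV[R]_n -> R[i]^o) : f =1 g ->
  cintegral f = cintegral g.
Proof. by move=> /funext ->. Qed.

Lemma cintegral_lin n C D (c : R[i]^o) (f g : 'rV[R]_n -> R[i]^o) :
  cdominated C f -> cdominated D g ->
  cintegral (fun x => c * f x + g x) = c * cintegral f + cintegral g.
Proof.
move=> /cdominatedP[fr fi] /cdominatedP[gr gi].
have dom_lin E F (a b : R) u v : dominated E u -> dominated F v ->
    dominated (`|a| * E + F) (fun x : 'rV[R]_n => a * u x + v x).
  move=> [cu uE] [cv vF]; split=> [|x].
    by apply: continuous_add => //; apply: continuous_mul => //; exact: continuous_cst.
  rewrite (le_trans (ler_normD _ _))// mulrDl lerD// normrM -mulrA.
  by rewrite ler_wpM2l.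
rewrite !cintegralE.
have -> : (fun x => complex.Re (c * f x + g x)) = (fun x => complex.Re c *
    complex.Re (f x) + (- complex.Im c * complex.Im (f x) + complex.Re (g x))).
  apply/funext => x; rewrite -[LHS]/(complex.Re (c *: f x + g x)) ReD_scale.
  by rewrite mulNr addrA.
have -> : (fun x => complex.Im (c * f x + g x)) = (fun x => complex.Re c *
    complex.Im (f x) + (complex.Im c * complex.Re (f x) + complex.Im (g x))).
  apply/funext => x; rewrite -[LHS]/(complex.Im (c *: f x + g x)) ImD_scale.
  by rewrite addrA.
rewrite (rint_lin _ fr (dom_lin _ _ _ 0 _ _ fi gr)) (rint_lin _ fi gr).
rewrite (rint_lin _ fi (dom_lin _ _ _ 0 _ _ fr gi)) (rint_lin _ fr gi).
by case: c => a b /=; congr (_ +i* _); ring.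
Qed.

Lemma cintegral_bound n C (f : 'rV[R]_n -> R[i]^o) : cdominated C f ->
  normc (cintegral f) <= 2 * C * pi ^+ n.
Proof.
move=> /cdominatedP[fr fi]; rewrite cintegralE (le_trans (normc_le_ReIm _))//=.
by rewrite -mulrA mulr2n mulrDl mul1r lerD// rint_bound.
Qed.

Lemma cintegralZ n C (c : R[i]^o) (f : 'rV[R]_n -> R[i]^o) : cdominated C f ->
  cintegral (fun x => c * f x) = c * cintegral f.
Proof.
move=> dC.
have dz : cdominated 0 (fun _ : 'rV[R]_n => 0 : R[i]^o).
  by split=> [|x]; [exact: cst_continuous|rewrite normc0 mul0r].
have z0 : cintegral (fun _ : 'rV[R]_n => 0 : R[i]^o) = 0.
  have := cintegral_bound dz; rewrite mulr0 mul0r => h.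
  by apply/eq0_normc/le_anti; rewrite h normc_ge0.
rewrite -[RHS]addr0 -[X in _ + X]z0 -(cintegral_lin _ dC dz).
by apply: eq_cintegral => x; rewrite addr0.
Qed.

Lemma cdominated_ge0 n C (f : 'rV[R]_n -> R[i]^o) : cdominated C f -> 0 <= C.
Proof.
by move=> [_ /(_ 0)] /(le_trans (normc_ge0 _)); rewrite pmulr_lge0 ?invr_gt0.
Qed.

Lemma cdominated_le n C (f : 'rV[R]_n -> R[i]^o) x : cdominated C f -> normc (f x) <= C.
Proof.
move=> df; apply: le_trans (df.2 x) _.
by rewrite ler_pdivrMr// ler_peMr// (cdominated_ge0 df).
Qed.

Lemma cintegral_row_mx n m C (f : 'rV[R]_(n + m) -> R[i]^o) : cdominated C f ->
  cintegral f =
  cintegral (fun x : 'rV_n => cintegral (fun y : 'rV_m => f (row_mx x y))).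
Proof.
move=> /cdominatedP[fr fi].
by rewrite cintegralE (rint_row_mx fr) (rint_row_mx fi).
Qed.

Lemma cintegral_row_mxC n m C (f : 'rV[R]_(n + m) -> R[i]^o) : cdominated C f ->
  cintegral f =
  cintegral (fun y : 'rV_m => cintegral (fun x : 'rV_n => f (row_mx x y))).
Proof.
move=> /cdominatedP[fr fi].
by rewrite cintegralE (rint_row_mxC fr) (rint_row_mxC fi).
Qed.

Lemma cintegral_affine n C (a : R) (v : 'rV[R]_n) (f : 'rV[R]_n -> R[i]^o) :
  a != 0 -> cdominated C f ->
  cintegral f = (`|a| ^+ n)%:C * cintegral (fun x => f (a *: x + v)).
Proof.
move=> a0 /cdominatedP[fr fi].
rewrite cintegralE (rint_affine v a0 fr) (rint_affine v a0 fi) cintegralE.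
by congr (_ +i* _); rewrite mul0r ?subr0 ?addr0.
Qed.

Lemma cintegral_dct n C (f_ : nat -> 'rV[R]_n -> R[i]^o) f :
  (forall k, cdominated C (f_ k)) -> continuous f ->
  (forall x, f_ ^~ x @ \oo --> f x) ->
  (fun k => cintegral (f_ k)) @ \oo --> cintegral f.
Proof.
move=> df /continuous_complexP[cr ci] f_f; apply/cvg_complexP; split.
  apply: (@rint_dct R n C (fun k x => complex.Re (f_ k x))
      (fun x => complex.Re (f x)) _ cr) => [k|x].
    by have [] := cdominatedP (df k).
  by have /cvg_complexP[] := f_f x.
apply: (@rint_dct R n C (fun k x => complex.Im (f_ k x))
    (fun x => complex.Im (f x)) _ ci) => [k|x].
  by have [] := cdominatedP (df k).
by have /cvg_complexP[] := f_f x.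
Qed.

End ComplexIntegral.

(** * Partial derivatives: mean values, Leibniz rule, symmetry *)

Section Lines.
Context {R : realType}.
Implicit Types n : nat.

(** Derivatives in a direction are derivatives of a function of one real
    variable; this is the bridge to one-dimensional calculus. *)
Lemma is_derive_line n (f : 'rV[R]_n -> R) (x v : 'rV[R]_n) (t l : R) :
  is_derive (x + t *: v) v f l <-> is_derive t 1 (fun s : R => f (x + s *: v)) l.
Proof.
have E : (fun h : R => h^-1 *: (f (h *: v + (x + t *: v)) - f (x + t *: v))) =
  (fun h : R => h^-1 *: (f (x + (h *: (1 : R^o) + t) *: v) - f (x + t *: v))).
  apply/funext => h; congr (_ *: (f _ - _)).
  by rewrite addrCA -scalerDl [h *: _]mulr1.
by split=> -[]; rewrite /derivable /derive => d dl; split;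
  move: d dl; rewrite /derivable /derive /= ?E.
Qed.

Lemma line_mvt n (f : 'rV[R]_n -> R) (v x : 'rV[R]_n) (h : R) :
  (forall y, derivable f y v) ->
  exists2 c : R, `|c| <= `|h| & f (x + h *: v) - f x = h * 'D_v f (x + c *: v).
Proof.
move=> df; pose g (s : R) := f (x + s *: v).
have dg (s : R) : is_derive s 1 g ('D_v f (x + s *: v)).
  by apply/is_derive_line; exact: derivableP.
have cg : continuous g.
  by move=> s; apply/differentiable_continuous/derivable1_diffP; case: (dg s).
have [h0|h0] := leP 0 h.
  have [|c] := @MVT_segment R g (fun s => 'D_v f (x + s *: v)) 0 h h0.
    exact: continuous_subspaceT.
  rewrite in_itv /= /g scale0r addr0 subr0 mulrC => /andP[c0 ch] E.
  by exists c => //; rewrite !ger0_norm.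
have [|c] := @MVT_segment R g (fun s => 'D_v f (x + s *: v)) h 0 (ltW h0).
  exact: continuous_subspaceT.
rewrite in_itv /= /g scale0r addr0 sub0r mulrN mulrC => /andP[c0 ch] E.
exists c; first by rewrite !ler0_norm ?lerN2 // ltW.
by rewrite -opprB E opprK.
Qed.

Lemma derivable_shift n (f : 'rV[R]_n -> R) (w y v : 'rV[R]_n) l :
  is_derive (y + w) v f l -> is_derive y v (fun z => f (z + w)) l.
Proof.
have E : (fun h : R => h^-1 *: (f (h *: v + (y + w)) - f (y + w))) =
  (fun h : R => h^-1 *: (f (h *: v + y + w) - f (y + w))).
  by apply/funext => h; rewrite addrA.
by move=> -[]; rewrite /derivable /derive => d dl; split;
  move: d dl; rewrite /derivable /derive /= ?E.
Qed.

End Lines.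

Section Partial.
Context {R : realType} {n : nat}.
Implicit Types (f g : 'rV[R]_n -> R[i]^o) (j : 'I_n).
Local Notation e j := (delta_mx 0 j : 'rV[R]_n).

(** The factor 2 comes from applying the mean value theorem to the real and
    imaginary parts separately, at different intermediate points. *)
Lemma partial_bound_mvt f j M x (h : R) : partial_derivable j f ->
  (forall c, `|c| <= `|h| -> normc (partial j f (x + c *: e j)) <= M) ->
  normc (f (x + h *: e j) - f x) <= 2 * M * `|h|.
Proof.
move=> df HM; apply: (le_trans (normc_le_ReIm _)); rewrite !raddfB.
have [c cr ->] := line_mvt x h (fun y => (df y).1).
have [d dr ->] := line_mvt x h (fun y => (df y).2).
rewrite !normrM -mulrDr mulrC ler_wpM2r// mulr2n mulrDl mul1r lerD//.
  by apply: le_trans (HM c cr); apply: le_trans (le_Re_normc _).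
by apply: le_trans (HM d dr); apply: le_trans (le_Im_normc _).
Qed.

Lemma is_derive_partial f j x : partial_derivable j f ->
  is_derive x (e j) (fun y => complex.Re (f y)) (complex.Re (partial j f x)) /\
  is_derive x (e j) (fun y => complex.Im (f y)) (complex.Im (partial j f x)).
Proof.
move=> /(_ x)[dr di].
split; [exact: (DeriveDef dr erefl)|exact: (DeriveDef di erefl)].
Qed.

Lemma partialP f j (l : 'rV[R]_n -> R[i]^o) :
  (forall x, is_derive x (e j) (fun y => complex.Re (f y)) (complex.Re (l x)) /\
     is_derive x (e j) (fun y => complex.Im (f y)) (complex.Im (l x))) ->
  partial_derivable j f /\ partial j f = l.
Proof.
move=> H; split.
  move=> x; split; [exact: (@ex_derive _ _ _ _ _ _ _ (H x).1)|exact: (@ex_derive _ _ _ _ _ _ _ (H x).2)].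
apply/funext => x; have [[_ Er] [_ Ei]] := H x.
by rewrite /partial Er Ei; case: (l x).
Qed.

Lemma partial_mul j f g : partial_derivable j f -> partial_derivable j g ->
  partial_derivable j (fun x => f x * g x : R[i]^o) /\
  partial j (fun x => f x * g x : R[i]^o) =
    (fun x => partial j f x * g x + f x * partial j g x).
Proof.
move=> df dg; apply: partialP => x.
have [fr fi] := is_derive_partial x df; have [gr gi] := is_derive_partial x dg.
have RM (a b : R[i]) : complex.Re (a * b) =
    complex.Re a * complex.Re b - complex.Im a * complex.Im b.
  by case: a b => ? ? [].
have IM (a b : R[i]) : complex.Im (a * b) =
    complex.Re a * complex.Im b + complex.Im a * complex.Re b.
  by case: a b => ? ? [].
split.
  under eq_fun do rewrite RM.
  apply: (is_derive_eq (is_deriveB (is_deriveM fr gr) (is_deriveM fi gi))).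
  move: (f x) (g x) (partial j f x) (partial j g x) => [a a'] [b b'] [c c'] [d d'].
  by rewrite /GRing.scale/=; ring.
under eq_fun do rewrite IM.
apply: (is_derive_eq (is_deriveD (is_deriveM fr gi) (is_deriveM fi gr))).
move: (f x) (g x) (partial j f x) (partial j g x) => [a a'] [b b'] [c c'] [d d'].
by rewrite /GRing.scale/=; ring.
Qed.

Lemma Ck_continuous k f : Ck k f -> continuous f.
Proof. by case: k => [|k] []. Qed.

Lemma Ck_leS k f : Ck k.+1 f -> Ck k f.
Proof.
elim: k f => [|k IH] f [cf H]; split=> // j.
by have [dj Cj] := H j; split => //; exact: IH.
Qed.

Lemma Ck_add k f g : Ck k f -> Ck k g -> Ck k (fun x => f x + g x).
Proof.
move=> Cf Cg; have := Ck_lin 1 Cf Cg.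
by congr (Ck k _); apply/funext => x; rewrite -[LHS]/(1 *: f x + g x) scale1r.
Qed.

Lemma Ck_mul k f g : Ck k f -> Ck k g -> Ck k (fun x => f x * g x : R[i]^o).
Proof.
elim: k f g => [|k IH] f g.
  move=> [cf _] [cg _].
  by split; [exact: (continuousM_complex cf cg)|exact: I].
move=> Cf Cg; split=> [|j].
  by apply: continuousM_complex; [exact: Ck_continuous Cf|exact: Ck_continuous Cg].
have [dfj pfj] := Cf.2 j; have [dgj pgj] := Cg.2 j.
have [d ->] := partial_mul dfj dgj; split=> //.
by apply: Ck_add; apply: IH => //; exact: Ck_leS.
Qed.

Lemma smooth_mul f g : smooth f -> smooth g ->
  smooth (fun x => f x * g x : R[i]^o).
Proof. by move=> sf sg k; exact: Ck_mul. Qed.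

Lemma smooth_add f g : smooth f -> smooth g -> smooth (fun x => f x + g x).
Proof. by move=> sf sg k; exact: Ck_add. Qed.

Lemma smooth_continuous f : smooth f -> continuous f.
Proof. by move=> sf; exact: Ck_continuous (sf 0%N). Qed.

End Partial.

Lemma subrACA (V : zmodType) (a b c d : V) : a - b - (c - d) = a - c - (b - d).
Proof. by rewrite !opprB [d - c]addrC addrACA [- b + d]addrC. Qed.

Lemma dist_lt_split (R : realType) (a b m eps : R) :
  `|a - m| < eps -> `|b - m| < eps -> `|a - b| < eps + eps.
Proof.
move=> am bm; rewrite -(subrKA m) (le_lt_trans (ler_normD _ _))// ltrD//.
by rewrite distrC.
Qed.

Lemma eq_ReIm (R : realType) (z w : R[i]) :
  complex.Re z = complex.Re w -> complex.Im z = complex.Im w -> z = w.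
Proof. by case: z w => [a b] [c d] /= -> ->. Qed.

Section Clairaut.
Context {R : realType} {n : nat}.
Implicit Types (f g : 'rV[R]_n -> R[i]^o) (j : 'I_n).
Local Notation e j := (delta_mx 0 j : 'rV[R]_n).

(** The mean value theorem applied twice to the mixed second difference. *)
Lemma second_difference (f : 'rV[R]_n -> R) (v w x : 'rV[R]_n) (h : R) :
  (forall y, derivable f y v) ->
  (forall y, derivable (fun z => 'D_v f z) y w) ->
  exists c d : R, [/\ `|c| <= `|h|, `|d| <= `|h| &
    f (x + h *: v + h *: w) - f (x + h *: v) - (f (x + h *: w) - f x) =
    h * (h * 'D_w (fun z => 'D_v f z) (x + c *: v + d *: w))].
Proof.
move=> df ddf; pose g y := f (y + h *: w) - f y.
have dg y : is_derive y v g ('D_v f (y + h *: w) - 'D_v f y).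
  by apply: is_deriveB; [apply: derivable_shift; exact: derivableP|exact: derivableP].
have [c cr] := line_mvt x h (fun y => @ex_derive _ _ _ _ _ _ _ (dg y)).
rewrite /g derive_val => E; have [d dr] := line_mvt (x + c *: v) h ddf.
rewrite addrAC => Ed; exists c, d; split => //.
by rewrite E -Ed addrAC.
Qed.

(** The mixed second difference is symmetric in v and w, and divided by h^2 it
    tends to either of the two mixed derivatives. *)
Lemma derive_comm (f : 'rV[R]_n -> R) (v w x : 'rV[R]_n) :
  (forall y, derivable f y v) -> (forall y, derivable f y w) ->
  (forall y, derivable (fun z => 'D_v f z) y w) ->
  (forall y, derivable (fun z => 'D_w f z) y v) ->
  {for x, continuous (fun y => 'D_w (fun z => 'D_v f z) y)} ->
  {for x, continuous (fun y => 'D_v (fun z => 'D_w f z) y)} ->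
  'D_w (fun z => 'D_v f z) x = 'D_v (fun z => 'D_w f z) x.
Proof.
move=> dv dw dvw dwv cvw cwv.
have E0 h : f (x + h *: v + h *: w) - f (x + h *: v) - (f (x + h *: w) - f x) =
    f (x + h *: w + h *: v) - f (x + h *: w) - (f (x + h *: v) - f x).
  by rewrite (addrAC x (h *: w)) subrACA.
apply/eqP; rewrite -subr_eq0; apply/negPn/negP => ne0.
set A := fun y => 'D_w _ y in cvw ne0; set B := fun y => 'D_v _ y in cwv ne0.
pose eps := `|A x - B x| / 2.
have eps0 : 0 < eps by rewrite divr_gt0// normr_gt0.
have /cvgrPdist_lt /(_ _ eps0) /nbhs_normP[d1 /= d10 H1] := cvw.
have /cvgrPdist_lt /(_ _ eps0) /nbhs_normP[d2 /= d20 H2] := cwv.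
pose K := 1 + `|v| + `|w|.
have K0 : 0 < K by rewrite ltr_wpDr// ltr_wpDr.
(* Small enough for all intermediate points to stay within min(d1, d2) of x. *)
pose h := Num.min d1 d2 / 2 / K.
have m0 : 0 < Num.min d1 d2 by rewrite lt_min d10.
have h0 : 0 < h by rewrite !divr_gt0.
have small c d : `|c| <= `|h| -> `|d| <= `|h| ->
    `|x - (x + c *: v + d *: w)| < Num.min d1 d2.
  move=> cr dr; rewrite -addrA opprD addNKr normrN.
  apply: (le_lt_trans (ler_normD _ _)); rewrite !normrZ.
  apply: (@le_lt_trans _ _ (`|h| * K)).
    rewrite /K !mulrDr mulr1 -addrA ler_wpDl// lerD// ler_wpM2r//.
  rewrite gtr0_norm// /h divfK ?gt_eqF//.
  by rewrite ltr_pdivrMr// mulr2n mulrDr mulr1 ltrDl.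
have [c [d [cr dr E1]]] := second_difference x h dv dvw.
have [c' [d' [cr' dr' E2]]] := second_difference x h dw dwv.
have AB : A (x + c *: v + d *: w) = B (x + c' *: w + d' *: v).
  by move/(mulfI (lt0r_neq0 h0))/(mulfI (lt0r_neq0 h0)):
    (etrans (esym E1) (etrans (E0 h) E2)).
have /H1 : ball_ Num.norm x d1 (x + c *: v + d *: w).
  by apply: lt_le_trans (small _ _ cr dr) _; rewrite ge_min lexx.
have /H2 : ball_ Num.norm x d2 (x + c' *: w + d' *: v).
  rewrite /ball_ /= addrAC; apply: lt_le_trans (small _ _ dr' cr') _.
  by rewrite ge_min lexx orbT.
rewrite AB /= => Bb Ab; have := dist_lt_split Ab Bb.
by rewrite /eps -splitr ltxx.
Qed.

Lemma partial_comm f j k : Ck 2 f ->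
  partial j (partial k f) = partial k (partial j f).
Proof.
move=> [cf H].
have [dj [_ Hj]] := H j; have [dk [_ Hk]] := H k.
have [djk Cjk] := Hk j; have [dkj Ckj] := Hj k.
have /continuous_complexP[c1 c2] := Cjk.1.
have /continuous_complexP[c3 c4] := Ckj.1.
apply/funext => x.
have Er : complex.Re (partial j (partial k f) x) =
    complex.Re (partial k (partial j f) x).
  apply: (@derive_comm (fun y => complex.Re (f y)) (e k) (e j) x).
  - by move=> y; exact: (dk y).1.
  - by move=> y; exact: (dj y).1.
  - by move=> y; exact: (djk y).1.
  - by move=> y; exact: (dkj y).1.
  - exact: c1.
  - exact: c3.
have Ei : complex.Im (partial j (partial k f) x) =
    complex.Im (partial k (partial j f) x).
  apply: (@derive_comm (fun y => complex.Im (f y)) (e k) (e j) x).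
  - by move=> y; exact: (dk y).2.
  - by move=> y; exact: (dj y).2.
  - by move=> y; exact: (djk y).2.
  - by move=> y; exact: (dkj y).2.
  - exact: c2.
  - exact: c4.
exact: (eq_ReIm Er Ei).
Qed.

(** Derivatives along a list of directions rather than a multi-index: the order
    is the length, and induction on the list replaces induction on multi-indices. *)
Fixpoint dlist (s : seq 'I_n) f := if s is j :: s' then dlist s' (partial j f) else f.

Lemma dlist_cat s t f : dlist (s ++ t) f = dlist t (dlist s f).
Proof. by elim: s f => //= j s IH f. Qed.

Lemma dlist_rcons s j f : dlist (rcons s j) f = partial j (dlist s f).
Proof. by rewrite -cats1 dlist_cat. Qed.

Lemma dlist_partial s j f : smooth f -> dlist s (partial j f) = partial j (dlist s f).
Proof.
elim: s f => //= k s IH f sf; rewrite -(IH _ (smooth_partial _ sf)).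
by rewrite (partial_comm _ _ (sf 2%N)).
Qed.

(** Iterated symmetry of second derivatives: a derivative depends only on how
    often each direction occurs. *)
Lemma dlist_perm s t f : smooth f -> perm_eq s t -> dlist s f = dlist t f.
Proof.
elim: s t f => [|j s IH] t f sf; first by rewrite perm_sym => /perm_nilP ->.
move=> st; have jt : j \in t by rewrite -(perm_mem st) mem_head.
case/splitPr: jt st => t1 t2 jst.
have st : perm_eq s (t1 ++ t2).
  rewrite -(perm_cons j) (perm_trans jst)//.
  by rewrite -[j :: t2]cat1s -[j :: t1 ++ t2]cat1s perm_catCA.
rewrite /= (IH _ _ (smooth_partial _ sf) st).
by rewrite !dlist_cat /= dlist_partial.
Qed.

Definition mlist (al : multiindex n) : seq 'I_n :=
  flatten [seq nseq (al i) i | i <- rev (enum 'I_n)].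

Lemma iter_partial k j f : iter k (partial j) f = dlist (nseq k j) f.
Proof. by elim: k f => //= k IH f; rewrite -iterS iterSr IH. Qed.

Lemma mderiv_dlist al f : mderiv al f = dlist (mlist al) f.
Proof.
rewrite /mderiv /mlist; elim: (enum _) => //= i s ->.
by rewrite rev_cons map_rcons flatten_rcons dlist_cat iter_partial.
Qed.

Lemma count_mlist al j : count_mem j (mlist al) = al j.
Proof.
rewrite /mlist count_flatten sumnE !big_map (perm_big (enum 'I_n)) ?perm_rev//=.
rewrite big_enum (bigD1 j)//= count_nseq /= eqxx mul1n big1 ?addn0// => i ij.
by rewrite count_nseq /= (negbTE ij).
Qed.

Lemma size_mlist al : size (mlist al) = mabs al.
Proof.
rewrite /mlist size_flatten /shape sumnE !big_map (perm_big (enum 'I_n)) ?perm_rev//=.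
by rewrite big_enum; apply: eq_bigr => i _; rewrite size_nseq.
Qed.

Definition mcount (s : seq 'I_n) : multiindex n := [ffun i => count_mem i s].

(** Multi-indices and lists of directions describe the same derivatives; lists
    allow induction on the order. *)
Lemma dlist_mderiv s f : smooth f -> dlist s f = mderiv (mcount s) f.
Proof.
move=> sf; rewrite mderiv_dlist; apply: dlist_perm => //.
by apply/allP => i _ /=; rewrite count_mlist ffunE.
Qed.

Lemma mabs_mcount s : mabs (mcount s) = size s.
Proof.
rewrite -size_mlist; apply/perm_size.
by apply/allP => i _ /=; rewrite count_mlist ffunE.
Qed.

End Clairaut.

(** * Pointwise bounds on all derivatives up to a given order *)

Section Bounds.
Context {R : realType} {n : nat}.
Implicit Types (f g : 'rV[R]_n -> R[i]^o) (j : 'I_n) (w : 'rV[R]_n -> R).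
Local Notation e j := (delta_mx 0 j : 'rV[R]_n).

Definition derivs_bounded k w f : Prop :=
  forall s : seq 'I_n, (size s <= k)%N -> forall z, normc (dlist s f z) <= w z.

Lemma partial_add f g j : partial_derivable j f -> partial_derivable j g ->
  partial j (fun x => f x + g x) = (fun x => partial j f x + partial j g x).
Proof.
move=> df dg; have := partialD 1 df dg.
have -> : 1 *: f + g = (fun x => f x + g x).
  by apply/funext => x; rewrite -[LHS]/(1 *: f x + g x) scale1r.
by move=> ->; apply/funext => x; rewrite -[LHS]/(1 *: partial j f x + partial j g x) scale1r.
Qed.

Lemma dlist_add s f g : smooth f -> smooth g ->
  dlist s (fun x => f x + g x) = (fun x => dlist s f x + dlist s g x).
Proof.
elim: s f g => //= j s IH f g sf sg.
rewrite partial_add; [|exact: smooth_derivable..].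
by apply: IH; exact: smooth_partial.
Qed.

Lemma smooth_cst (c : R[i]^o) : smooth (fun _ : 'rV[R]_n => c).
Proof.
have H j : partial_derivable j (fun _ : 'rV[R]_n => c) /\
    partial j (fun _ : 'rV[R]_n => c) = 0.
  by apply: partialP => x; split; exact: is_derive_cst.
case=> [|k].
  by split; [exact: cst_continuous|exact: I].
split=> [|j]; first exact: cst_continuous.
by have [d ->] := H j; split; [exact: d|exact: Ck0].
Qed.

Lemma partial_cst (c : R[i]^o) j : partial j (fun _ : 'rV[R]_n => c) = fun=> 0.
Proof.
have [] // := @partialP R n (fun _ : 'rV[R]_n => c) j (fun=> 0).
by move=> x; split; exact: is_derive_cst.
Qed.

Lemma smooth_scale (c : R[i]^o) f : smooth f -> smooth (fun x => c * f x : R[i]^o).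
Proof. by move=> sf; apply: smooth_mul sf; exact: smooth_cst. Qed.

Lemma partial_scale (c : R[i]^o) f j : partial_derivable j f ->
  partial j (fun x => c * f x : R[i]^o) = fun x => c * partial j f x.
Proof.
move=> df; have [_ ->] := partial_mul (smooth_derivable j (smooth_cst c)) df.
by apply/funext => x; rewrite partial_cst mul0r add0r.
Qed.

Lemma dlist_scale (c : R[i]^o) s f : smooth f ->
  dlist s (fun x => c * f x : R[i]^o) = fun x => c * dlist s f x.
Proof.
elim: s f => //= j s IH f sf; rewrite partial_scale; last exact: smooth_derivable.
by rewrite IH//; exact: smooth_partial.
Qed.

Lemma derivs_bounded_ge0 k w f z : derivs_bounded k w f -> 0 <= w z.
Proof. by move=> /(_ [::] isT z); apply: le_trans; exact: normc_ge0. Qed.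

Lemma derivs_bounded_le k w w' f : (forall z, w z <= w' z) ->
  derivs_bounded k w f -> derivs_bounded k w' f.
Proof. by move=> ww' H s sk z; exact: le_trans (H s sk z) (ww' z). Qed.

Lemma derivs_bounded_partial k w f j :
  derivs_bounded k.+1 w f -> derivs_bounded k w (partial j f).
Proof. by move=> H s sk z; exact: (H (j :: s)). Qed.

Lemma derivs_bounded_leq k l w f : (k <= l)%N ->
  derivs_bounded l w f -> derivs_bounded k w f.
Proof. by move=> kl H s sk z; exact: H (leq_trans sk kl) z. Qed.

Lemma derivs_bounded_add k v w f g : smooth f -> smooth g ->
  derivs_bounded k v f -> derivs_bounded k w g ->
  derivs_bounded k (fun z => v z + w z) (fun x => f x + g x).
Proof.
move=> sf sg Hf Hg s sk z; rewrite dlist_add//.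
by rewrite (le_trans (le_normcD _ _))// lerD// ?Hf ?Hg.
Qed.

(** Leibniz rule by induction on the order: each derivative doubles the number
    of terms, hence the factor 2^k. *)
Lemma derivs_bounded_mul k v w f g : smooth f -> smooth g ->
  derivs_bounded k v f -> derivs_bounded k w g ->
  derivs_bounded k (fun z => 2 ^+ k * (v z * w z)) (fun x => f x * g x : R[i]^o).
Proof.
elim: k f g => [|k IH] f g sf sg Hf Hg.
  case=> // _ z; rewrite expr0 mul1r normcM ler_pM ?normc_ge0//.
    exact: (Hf [::]).
  exact: (Hg [::]).
case=> [_ z|j s sk z].
  have v0 := derivs_bounded_ge0 z Hf; have w0 := derivs_bounded_ge0 z Hg.
  rewrite -[X in X <= _]mul1r ler_pM ?normc_ge0 ?exprn_ege1 ?ler1n//.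
  rewrite normcM ler_pM ?normc_ge0//; [exact: (Hf [::])|exact: (Hg [::])].
have dfj := smooth_derivable j sf; have dgj := smooth_derivable j sg.
rewrite /= (partial_mul dfj dgj).2.
have sfj := smooth_partial j sf; have sgj := smooth_partial j sg.
rewrite dlist_add; [|exact: smooth_mul..].
rewrite (le_trans (le_normcD _ _))// exprS -mulrA mulr2n mulrDl mul1r lerD//.
  apply: (IH _ _ sfj sg) => //; first exact: derivs_bounded_partial.
  exact: derivs_bounded_leq Hg.
apply: (IH _ _ sf sgj) => //; first exact: derivs_bounded_leq Hf.
exact: derivs_bounded_partial.
Qed.

End Bounds.

Lemma normc_real (R : realType) (r : R) : normc (r%:C : R[i]) = `|r|.
Proof. by rewrite /normc /= expr0n addr0 sqrtr_sqr. Qed.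

Section Composition.
Context {R : realType} {p q : nat}.
Variables (L : 'rV[R]_p -> 'rV[R]_q) (sg : 'I_p -> 'I_q) (a : 'I_p -> R).
Hypothesis L_line : forall z j h,
  L (z + h *: delta_mx 0 j) = L z + (h * a j) *: delta_mx 0 (sg j).
Hypothesis cL : continuous L.
Implicit Types f : 'rV[R]_q -> R[i]^o.

Lemma is_derive_comp_line (F : 'rV[R]_q -> R) j z (l : R) :
  is_derive (L z) (delta_mx 0 (sg j)) F l ->
  is_derive z (delta_mx 0 j) (fun y => F (L y)) (a j * l).
Proof.
move=> dF; rewrite -[z]addr0 -[X in z + X](scale0r (delta_mx 0 j)).
apply/is_derive_line.
have -> : (fun s : R => F (L (z + s *: delta_mx 0 j))) =
    (fun s : R => F (L z + s *: delta_mx 0 (sg j))) \o (fun s : R => s * a j).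
  by apply/funext => s /=; rewrite L_line.
have d0 : is_derive (0 * a j : R) 1 (fun s : R => F (L z + s *: delta_mx 0 (sg j))) l.
  by rewrite mul0r; apply/is_derive_line; rewrite scale0r addr0.
have d1 : is_derive (0 : R) 1 (fun s : R => s * a j) (a j).
  have := is_deriveM (is_derive_id (0 : R) 1) (is_derive_cst (a j) (0 : R) 1).
  by rewrite scaler0 add0r => H; apply: is_derive_eq H _; exact: mulr1.
rewrite [a j * l]mulrC; exact: (@is_derive1_comp R _ _ 0 l (a j) d0 d1).
Qed.

Lemma partial_comp_line f j : partial_derivable (sg j) f ->
  partial_derivable j (fun z => f (L z)) /\
  partial j (fun z => f (L z)) = (fun z => (a j)%:C * partial (sg j) f (L z) : R[i]^o).
Proof.
move=> df; apply: partialP => z.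
have [fr fi] := is_derive_partial (L z) df.
split.
  apply: is_derive_eq (is_derive_comp_line fr) _.
  by case: (partial _ f _) => u v /=; rewrite mul0r subr0.
apply: is_derive_eq (is_derive_comp_line fi) _.
by case: (partial _ f _) => u v /=; rewrite mul0r addr0.
Qed.

Lemma smooth_comp_line f : smooth f -> smooth (fun z => f (L z)).
Proof.
move=> sf k; elim: k f sf => [|k IH] f sf.
  by split; [exact: continuous_compose cL (smooth_continuous sf)|exact: I].
split=> [|j]; first exact: continuous_compose cL (smooth_continuous sf).
have [d ->] := partial_comp_line (smooth_derivable (sg j) sf).
split; first exact: d.
apply: Ck_mul; first exact: smooth_cst.
by apply: IH; exact: smooth_partial.
Qed.

Lemma dlist_comp_line s f : smooth f ->
  dlist s (fun z => f (L z)) = fun z => (\prod_(j <- s) a j)%:C *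
    dlist (map sg s) f (L z).
Proof.
elim: s f => [|j s IH] f sf.
  by apply/funext => z; rewrite big_nil mul1r.
have sfj := smooth_partial (sg j) sf.
rewrite /= (partial_comp_line (smooth_derivable (sg j) sf)).2.
rewrite dlist_scale; last exact: smooth_comp_line.
by rewrite IH//; apply/funext => z; rewrite big_cons mulrA -rmorphM.
Qed.

Lemma derivs_bounded_comp_line k w f : smooth f -> (forall j, `|a j| <= 1) ->
  derivs_bounded k w f -> derivs_bounded k (fun z => w (L z)) (fun z => f (L z)).
Proof.
move=> sf a1 Hf s sk z; rewrite dlist_comp_line// normcM.
have P1 : normc (\prod_(j <- s) a j)%:C <= 1.
  rewrite normc_real; elim: (s) => [|j t IH].
    by rewrite big_nil normr1.
  by rewrite big_cons normrM mulr_ile1.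
rewrite -[w _]mul1r ler_pM ?normc_ge0//; apply: Hf.
by rewrite size_map.
Qed.

End Composition.

Section MeanValue.
Context {R : realType} {n : nat}.
Implicit Types (f : 'rV[R]_n -> R[i]^o) (j : 'I_n).

(** The increment is split along the coordinate axes, so that only partial
    derivatives inside the box spanned by x and x + v intervene. *)
Lemma mvt_row f (M : R) (x v : 'rV[R]_n) :
  (forall j, partial_derivable j f) ->
  (forall j (y : 'rV[R]_n), (forall k, `|y 0 k - x 0 k| <= `|v 0 k|) ->
     normc (partial j f y) <= M) ->
  normc (f (x + v) - f x) <= 2 * M * \sum_j `|v 0 j|.
Proof.
move=> df HM.
(* The corner of the box reached after moving along the directions in s. *)
pose y (s : seq 'I_n) : 'rV[R]_n := \row_k (x 0 k + v 0 k *+ (k \in s)).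
have H s : uniq s -> normc (f (y s) - f x) <= 2 * M * \sum_(j <- s) `|v 0 j|.
  elim: s => [_|j s IH /= /andP[js us]].
    have -> : y [::] = x by apply/rowP => k; rewrite mxE in_nil mulr0n addr0.
    by rewrite subrr normc0 big_nil mulr0.
  have yE : y (j :: s) = y s + v 0 j *: delta_mx 0 j.
    apply/rowP => k; rewrite !mxE in_cons eqxx /=; have [->|kj] := eqVneq k j.
      by rewrite (negbTE js) mulr0n addr0 mulr1 mulr1n.
    by rewrite mulr0 addr0.
  rewrite big_cons mulrDr -(subrKA (f (y s))).
  rewrite (le_trans (le_normcD _ _))// lerD//; last exact: IH.
  rewrite yE; apply: partial_bound_mvt => // c cv; apply: HM => k.
  rewrite /y !mxE eqxx /= -[x 0 k + _ + _]addrA [x 0 k + _]addrC addrK.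
  have [->|kj] := eqVneq k j; first by rewrite (negbTE js) mulr0n add0r mulr1.
  by rewrite mulr0 addr0; case: (k \in s); rewrite ?mulr1n// mulr0n normr0.
have := H (enum 'I_n) (enum_uniq _); rewrite big_enum /=.
suff -> : y (enum 'I_n) = x + v by [].
by apply/rowP => k; rewrite !mxE mem_enum mulr1n.
Qed.

Lemma taylor_partial f j M x (h : R) : partial_derivable j f ->
  partial_derivable j (partial j f) ->
  (forall c, `|c| <= `|h| -> normc (partial j (partial j f) (x + c *: delta_mx 0 j)) <= M) ->
  let r := f (x + h *: delta_mx 0 j) - f x - h%:C * partial j f x in
  `|complex.Re r| <= M * h ^+ 2 /\ `|complex.Im r| <= M * h ^+ 2.
Proof.
move=> df ddf HM r.
have real (F : 'rV[R]_n -> R) : (forall y, derivable F y (delta_mx 0 j)) ->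
  (forall y, derivable (fun z => 'D_(delta_mx 0 j) F z) y (delta_mx 0 j)) ->
  (forall c, `|c| <= `|h| ->
    `|'D_(delta_mx 0 j) (fun z => 'D_(delta_mx 0 j) F z) (x + c *: delta_mx 0 j)| <= M) ->
  `|F (x + h *: delta_mx 0 j) - F x - h * 'D_(delta_mx 0 j) F x| <= M * h ^+ 2.
  move=> dF ddF HF; have [c ch ->] := line_mvt x h dF.
  rewrite -mulrBr; have [d dc ->] := line_mvt x c ddF.
  rewrite !normrM -(real_normK (num_real h)) expr2 mulrA [M * _]mulrC -!mulrA.
  by rewrite ler_wpM2l// ler_pM//; exact: (HF d (le_trans dc ch)).
split.
  have -> : complex.Re r = complex.Re (f (x + h *: delta_mx 0 j)) -
      complex.Re (f x) - h * complex.Re (partial j f x).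
    rewrite /r; move: (f _) (f x) (partial j f x) => [u u'] [v v'] [w w'] /=; ring.
  apply: (real (fun y => complex.Re (f y))).
  - by move=> y; exact: (df y).1.
  - by move=> y; exact: (ddf y).1.
  - by move=> c ch; apply: le_trans (HM c ch); exact: (le_Re_normc (partial j (partial j f) _)).
have -> : complex.Im r = complex.Im (f (x + h *: delta_mx 0 j)) -
    complex.Im (f x) - h * complex.Im (partial j f x).
  rewrite /r; move: (f _) (f x) (partial j f x) => [u u'] [v v'] [w w'] /=; ring.
apply: (real (fun y => complex.Im (f y))).
- by move=> y; exact: (df y).2.
- by move=> y; exact: (ddf y).2.
- by move=> c ch; apply: le_trans (HM c ch); exact: (le_Im_normc (partial j (partial j f) _)).
Qed.

(** A first-order expansion with quadratic remainder determines the derivative;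
    derivatives under the integral sign and at the flat point of exp(-1/t) are
    found in this way. *)
Lemma is_derive_quadratic (V : normedModType R) (F : V -> R) (x v : V) (l K : R) :
  (forall h, `|h| <= 1 -> `|F (x + h *: v) - F x - h * l| <= K * h ^+ 2) ->
  is_derive x v F l.
Proof.
move=> H.
have cv : (fun h : R => h^-1 *: (F (h *: v + x) - F x)) @ 0^' --> l.
  apply/cvgrPdist_lt => e e0.
  have K1 : 0 < `|K| + 1 by rewrite ltr_wpDl.
  near=> h.
  have h0 : h != 0 by near: h; exact: nbhs_dnbhs_neq.
  have h1 : `|h| <= 1 by near: h; exact: dnbhs0_le.
  have he : `|h| < e / (`|K| + 1) by near: h; apply: dnbhs0_lt; exact: divr_gt0.
  rewrite distrC [h *: v + x]addrC.
  have -> : h^-1 *: (F (x + h *: v) - F x) - l = h^-1 * (F (x + h *: v) - F x - h * l).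
    by rewrite /GRing.scale /= [RHS]mulrBr mulKf.
  rewrite normrM normfV mulrC ltr_pdivrMr ?normr_gt0//.
  rewrite (le_lt_trans (H h h1))// -(real_normK (num_real h)) expr2 mulrA.
  rewrite ltr_pM2r ?normr_gt0// (le_lt_trans (ler_norm _))// normrM normr_id.
  rewrite (@le_lt_trans _ _ ((`|K| + 1) * `|h|))//.
    by rewrite ler_wpM2r// lerDl.
  by rewrite mulrC -ltr_pdivlMr.
by split; [apply/cvg_ex; exists l|exact: (cvg_lim _ cv)].
Unshelve. all: end_near. Qed.

End MeanValue.

Lemma continuousD_complex (R : realType) {T : topologicalType} (f g : T -> R[i]^o) :
  continuous f -> continuous g -> continuous (fun x => f x + g x).
Proof. by move=> cf cg x; apply: cvgD; [exact: cf|exact: cg]. Qed.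

Lemma continuous_normcP (R : realType) {T : topologicalType} (f : T -> R[i]^o) :
  (forall z (e : R), 0 < e -> \forall y \near z, normc (f z - f y) < e) ->
  continuous f.
Proof. by move=> H z; apply/cvg_normcP => e e0; exact: H. Qed.

Lemma near_row (R : realType) p (z : 'rV[R]_p) (del : R) : 0 < del ->
  \forall y \near z, forall k, `|(y : 'rV[R]_p) 0 k - z 0 k| <= del.
Proof.
move=> del0; apply/nbhs_ballP; exists del => // y [_ yz] k.
by rewrite distrC ltW//; exact: (yz 0 k).
Qed.

Lemma cdominated_lin (R : realType) q (c : R[i]^o) (f h : 'rV[R]_q -> R[i]^o) C E :
  cdominated C f -> cdominated E h ->
  cdominated (normc c * C + E) (fun x => c * f x + h x).
Proof.
move=> [cf fC] [ch hE]; split=> [|x].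
  apply: continuousD_complex ch; apply: continuousM_complex cf.
  exact: cst_continuous.
rewrite (le_trans (le_normcD _ _))// mulrDl normcM -mulrA lerD// ler_wpM2l//.
exact: normc_ge0.
Qed.

(** * Differentiation under the integral sign *)

Section ParametricIntegral.
Context {R : realType} {p q : nat} (I : Type).
Variables (g : I -> 'rV[R]_p -> 'rV[R]_q -> R[i]^o) (D : 'I_p -> I -> I).
Hypothesis g_partial : forall i j x, partial_derivable j (fun z => g i z x) /\
  partial j (fun z => g i z x) = (fun z => g (D j i) z x).
Hypothesis g_cont : forall i z, continuous (g i z).
Hypothesis g_bound : forall i (r : R), exists C, forall z : 'rV[R]_p,
  (forall k, `|z 0 k| <= r) -> forall x, normc (g i z x) <= C / weight x.

Let G i z := cintegral (g i z).

Lemma parametric_cdominated i z : exists C, cdominated C (g i z).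
Proof.
have [C HC] := g_bound i (\sum_k `|z 0 k|); exists C; split; first exact: g_cont.
by apply: HC => k; rewrite (bigD1 k)//= lerDl sumr_ge0.
Qed.

Lemma parametric_bound_partials i (r : R) : exists2 C, 0 <= C &
  forall (z : 'rV[R]_p) j, (forall k, `|z 0 k| <= r) -> forall x, normc (g (D j i) z x) <= C / weight x.
Proof.
pose M j := projT1 (cid (g_bound (D j i) r)).
have HM j := projT2 (cid (g_bound (D j i) r)).
exists (\sum_j `|M j|); first exact: sumr_ge0.
move=> z j zr x; apply: (le_trans (HM j z zr x)).
rewrite ler_wpM2r ?invr_ge0// (le_trans (ler_norm _))//.
by rewrite (bigD1 j)//= lerDl sumr_ge0.
Qed.

Lemma parametric_continuous i : continuous (G i).
Proof.
apply: continuous_normcP => z e e0.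
have [C C0 HC] := parametric_bound_partials i (\sum_k `|z 0 k| + 1).
pose K := 2 * (2 * C) * pi ^+ q * p%:R : R.
have K0 : 0 <= K by rewrite !mulr_ge0// exprn_ge0// pi_ge0.
have K1 : 0 < K + 1 by rewrite ltr_wpDl.
pose del := Num.min 1 (e / 2 / (K + 1)).
have del0 : 0 < del by rewrite lt_min ltr01 !divr_gt0.
apply: filterS (near_row z del0) => y yz.
have [Cz dz] := parametric_cdominated i z.
have [Cy dy] := parametric_cdominated i y.
pose E := 2 * C * (p%:R * del).
have dE : cdominated E (fun x => (-1) * g i y x + g i z x).
  split=> [|x]; first exact: (cdominated_lin (-1) dy dz).1.
  have := @mvt_row R p (fun z => g i z x) (C / weight x) z (y - z).
  rewrite (addrC z) subrK => H; rewrite mulN1r addrC normcB.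
  apply: (le_trans (H _ _)).
  - by move=> j; exact: (g_partial i j x).1.
  - move=> j w wz; rewrite (g_partial i j x).2; apply: HC => k.
    have := wz k; rewrite !mxE => {}wz.
    rewrite -[w 0 k](subrK (z 0 k)) addrC (le_trans (ler_normD _ _))// lerD//.
      by rewrite (bigD1 k)//= lerDl sumr_ge0.
    by rewrite (le_trans wz)// (le_trans (yz k))// ge_min lexx.
  rewrite /E [2 * (C / _)]mulrA mulrAC ler_wpM2r ?invr_ge0//.
  rewrite ler_wpM2l ?mulr_ge0//.
  have -> : p%:R * del = \sum_(j < p) del by rewrite sumr_const card_ord mulr_natl.
  by apply: ler_sum => j _; rewrite !mxE; exact: yz.
rewrite -[G i z - G i y]addrC -mulN1r -(cintegral_lin (-1) dy dz).
apply: (le_lt_trans (cintegral_bound dE)).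
have -> : 2 * E * pi ^+ q = K * del by rewrite /E /K; ring.
apply: (@le_lt_trans _ _ (K * (e / 2 / (K + 1)))).
  by rewrite ler_wpM2l// ge_min lexx orbT.
rewrite mulrA ltr_pdivrMr// mulrDr mulr1 [K * _]mulrC.
have : 0 <= e * K by rewrite mulr_ge0// ltW.
by nra.
Qed.

(** Taylor's formula bounds the remainder of the integrand by h^2 times a
    dominating function, uniformly on bounded sets of parameters; integrating
    it leaves a quadratic remainder for the integral. *)
Lemma parametric_partial i j :
  partial_derivable j (G i) /\ partial j (G i) = G (D j i).
Proof.
apply: partialP => z.
have [C HC] := g_bound (D j (D j i)) (\sum_k `|z 0 k| + 1).
have [Cz dz] := parametric_cdominated i z.
have [Cd dd] := parametric_cdominated (D j i) z.
have key h : `|h| <= 1 ->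
    `|complex.Re (G i (z + h *: delta_mx 0 j)) - complex.Re (G i z) -
      h * complex.Re (G (D j i) z)| <= C * pi ^+ q * h ^+ 2 /\
    `|complex.Im (G i (z + h *: delta_mx 0 j)) - complex.Im (G i z) -
      h * complex.Im (G (D j i) z)| <= C * pi ^+ q * h ^+ 2.
  move=> h1; have [Cy dy] := parametric_cdominated i (z + h *: delta_mx 0 j).
  pose r x := (- h)%:C * g (D j i) z x + ((-1) * g i z x + g i (z + h *: delta_mx 0 j) x).
  have dzy := cdominated_lin (-1) dz dy.
  have dr := cdominated_lin (- h)%:C dd dzy.
  have rE : cintegral r = (- h)%:C * G (D j i) z + ((-1) * G i z + G i (z + h *: delta_mx 0 j)).
    by rewrite /r (cintegral_lin _ dd dzy) (cintegral_lin _ dz dy).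
  have Tr x : `|complex.Re (r x)| <= C / weight x * h ^+ 2 /\
              `|complex.Im (r x)| <= C / weight x * h ^+ 2.
    have -> : r x = g i (z + h *: delta_mx 0 j) x - g i z x - h%:C * g (D j i) z x.
      by rewrite /r mulN1r rmorphN mulNr addrC [- g i z x + _]addrC.
    have [g1 g1E] := g_partial i j x; have [g2 g2E] := g_partial (D j i) j x.
    have := @taylor_partial R p (fun z => g i z x) j (C / weight x) z h g1.
    rewrite g1E g2E; apply => // c ch; apply: HC => k.
    rewrite !mxE (le_trans (ler_normD _ _))// lerD//.
      by rewrite (bigD1 k)//= lerDl sumr_ge0.
    rewrite normrM mulr_ile1// ?(le_trans ch)//.
    by case: (_ && _); rewrite ?normr1 ?normr0.
  have [dre dim] := cdominatedP dr.
  have bR : dominated (C * h ^+ 2) (fun x => complex.Re (r x)).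
    by split=> [|x]; [exact: dre.1|rewrite mulrAC; exact: (Tr x).1].
  have bI : dominated (C * h ^+ 2) (fun x => complex.Im (r x)).
    by split=> [|x]; [exact: dim.1|rewrite mulrAC; exact: (Tr x).2].
  have := rint_bound bR; have := rint_bound bI.
  rewrite -[rint (fun x => complex.Re (r x))]/(complex.Re (cintegral r)).
  rewrite -[rint (fun x => complex.Im (r x))]/(complex.Im (cintegral r)) rE.
  move: (G i z) (G (D j i) z) (G i _) => [a a'] [b b'] [c c'] /= bi br.
  split; [move: br|move: bi]; rewrite mulrAC; congr (`|_| <= _); ring.
split; apply: (@is_derive_quadratic R _ _ _ _ _ (C * pi ^+ q)) => h h1.
  by have [] := key h h1.
by have [] := key h h1.
Qed.

(** The family of integrands is closed under differentiation in the parameter,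
    so the induction on the order of smoothness stays inside the family. *)
Lemma parametric_smooth i : smooth (G i).
Proof.
move=> k; elim: k i => [|k IH] i.
  by split; [exact: parametric_continuous|exact: Logic.I].
split=> [|j]; first exact: parametric_continuous.
by have [d ->] := parametric_partial i j; split; [exact: d|exact: IH].
Qed.

End ParametricIntegral.

(** * Rapidly decreasing functions and their multipliers *)

Section SchwartzBounds.
Context {R : realType} {n : nat}.
Implicit Types (f g : 'rV[R]_n -> R[i]^o) (j : 'I_n).

(** One order N serves for the number of derivatives and for the decay; the
    seminorms so obtained are increasing in N. *)
Definition sbound N (B : R) f : Prop :=
  derivs_bounded N (fun x => B / weight x ^+ N) f.

Definition rapid f : Prop := smooth f /\ forall N, exists B, sbound N B f.

Lemma weightX_gt0 N (x : 'rV[R]_n) : 0 < weight x ^+ N.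
Proof. by rewrite exprn_gt0. Qed.

Lemma weightX_ge1 N (x : 'rV[R]_n) : 1 <= weight x ^+ N.
Proof. by rewrite exprn_ege1. Qed.

Lemma sbound_ge0 N B f : sbound N B f -> 0 <= B.
Proof.
move=> /(derivs_bounded_ge0 0); rewrite pmulr_lge0 ?invr_gt0 ?weightX_gt0//.
Qed.

(** In each coordinate 1 + x^2 is at most 2 when |x| <= 1 and at most 2 x^2
    otherwise; the multi-index selects the large coordinates.  It depends on x,
    which is harmless because its length is bounded. *)
Lemma weight_le_mpow N (x : 'rV[R]_n) : exists2 al : multiindex n,
  (mabs al <= n * (2 * N))%N & weight x ^+ N <= 2 ^+ (n * N) * `|mpow x al|.
Proof.
pose al : multiindex n := [ffun i => if 1 < `|x 0 i| then (2 * N)%N else 0%N].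
exists al.
  rewrite /mabs; apply: (@leq_trans (\sum_(i < n) (2 * N))%N).
    by apply: leq_sum => i _; rewrite ffunE; case: ifP.
  by rewrite sum_nat_const card_ord.
rewrite /weight -prodrXl mulnC exprM -[in X in X * _](card_ord n) -prodr_const.
rewrite /mpow normr_prod -big_split /=; apply: ler_prod => i _.
rewrite exprn_ge0 ?addr_ge0 ?sqr_ge0//= ffunE.
have [x1|x1] := ltP 1 `|x 0 i|.
  rewrite normrX exprM -exprMn lerXn2r ?nnegrE ?mulr_ge0 ?addr_ge0 ?sqr_ge0//.
  rewrite -[x 0 i ^+ 2]real_normK ?num_real// mulr2n mulrDl !mul1r lerD2r.
  by rewrite exprn_ege1// ltW.
rewrite expr0 normr1 mulr1 lerXn2r ?nnegrE ?addr_ge0 ?sqr_ge0//.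
have : x 0 i ^+ 2 <= 1 by rewrite -[x 0 i ^+ 2]real_normK ?num_real// exprn_ile1.
lra.
Qed.

Lemma mpow_le_weight (x : 'rV[R]_n) (al : multiindex n) :
  `|mpow x al| <= weight x ^+ mabs al.
Proof.
rewrite /mpow normr_prod /mabs -prodrXr; apply: ler_prod => i _.
rewrite normr_ge0/= normrX lerXn2r ?nnegrE//.
apply: le_trans (weight_coord x i).
rewrite -[x 0 i ^+ 2]real_normK ?num_real//.
by have := sqr_ge0 (`|x 0 i| - 1); have := normr_ge0 (x 0 i); nra.
Qed.

Lemma sboundP N B f : sbound N B f <->
  forall s, (size s <= N)%N -> forall x, weight x ^+ N * normc (dlist s f x) <= B.
Proof.
by split=> H s sN x; have := H s sN x; rewrite ler_pdivlMr ?weightX_gt0// mulrC.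
Qed.

(** Compares the two families of seminorms; the shift of the order comes from
    the length of the multi-index that dominates the weight. *)
Lemma schwartz_sbound N (phi : schwartz R n) :
  sbound N (2 ^+ (n * N) * schwartz_norm (n * (2 * N) + N) phi) phi.
Proof.
have /asboolP[sphi _] := valP phi.
apply/sboundP => s sN x; have [al alN wal] := weight_le_mpow N x.
rewrite (le_trans (ler_wpM2r (normc_ge0 _) wal))// -mulrA ler_wpM2l ?exprn_ge0//.
apply: ub_le_sup; first exact: schwartz_values_ub.
exists al, (mcount s); split; first by rewrite mabs_mcount leq_add.
by exists x; rewrite dlist_mderiv.
Qed.

Lemma schwartz_rapid (phi : schwartz R n) : rapid phi.
Proof.
have /asboolP[sphi _] := valP phi; split=> // N.
by eexists; exact: schwartz_sbound.
Qed.

Lemma rapid_schwartz f : rapid f -> f \in schwartz_pred.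
Proof.
move=> [sf bf]; apply/asboolP; split=> // al be.
have [B /sboundP HB] := bf (mabs al + mabs be)%N; exists B => x.
apply: le_trans (HB (mlist be) _ x); last by rewrite size_mlist leq_addl.
rewrite mderiv_dlist ler_wpM2r ?normc_ge0// (le_trans (mpow_le_weight _ _))//.
by rewrite ler_weXn2l ?weight_ge1// leq_addr.
Qed.

Lemma to_schwartzE f : rapid f -> to_schwartz f = f :> ('rV[R]_n -> R[i]^o).
Proof. by move=> rf; rewrite /to_schwartz insubdK//; exact: rapid_schwartz. Qed.

Lemma schwartz_norm_le N B (phi : schwartz R n) : sbound N B phi ->
  schwartz_norm N phi <= B.
Proof.
move=> bphi; have B0 := sbound_ge0 bphi; rewrite /schwartz_norm.
have [->|/set0P A0] := eqVneq (schwartz_values N phi) set0; first by rewrite sup0.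
apply: ge_sup => // _ [al [be [ab [x ->]]]].
move/sboundP : bphi => /(_ (mlist be)); rewrite size_mlist mderiv_dlist => H.
apply: le_trans (H _ x); last exact: leq_trans (leq_addl _ _) ab.
rewrite ler_wpM2r ?normc_ge0// (le_trans (mpow_le_weight _ _))//.
by rewrite ler_weXn2l ?weight_ge1// (leq_trans (leq_addr _ _) ab).
Qed.

Lemma sbound_leq M N B f : (M <= N)%N -> sbound N B f -> sbound M B f.
Proof.
move=> MN /sboundP H; apply/sboundP => s sM x.
apply: le_trans (H s (leq_trans sM MN) x).
by rewrite ler_wpM2r ?normc_ge0// ler_weXn2l ?weight_ge1.
Qed.

Lemma sbound_partial N B f j : sbound N.+1 B f -> sbound N B (partial j f).
Proof.
move=> /sboundP H; apply/sboundP => s sN x.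
apply: le_trans (H (j :: s) sN x).
by rewrite ler_wpM2r ?normc_ge0// ler_weXn2l ?weight_ge1.
Qed.

Lemma rapid_partial f j : rapid f -> rapid (partial j f).
Proof.
move=> [sf bf]; split; first exact: smooth_partial.
by move=> N; have [B HB] := bf N.+1; exists B; exact: sbound_partial.
Qed.

Lemma sbound_mul M N C B (h : 'rV[R]_n -> R[i]^o) f : smooth h -> smooth f ->
  derivs_bounded N (fun x => C * weight x ^+ M) h ->
  sbound (M + N) B f -> sbound N (2 ^+ N * C * B) (fun x => h x * f x : R[i]^o).
Proof.
move=> sh sf Hh Hf.
have Hf' : derivs_bounded N (fun x => B / weight x ^+ (M + N)) f.
  by apply: derivs_bounded_leq Hf; exact: leq_addl.
apply: derivs_bounded_le (derivs_bounded_mul sh sf Hh Hf') => x.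
rewrite exprD invfM le_eqVlt; apply/orP; left; apply/eqP.
have := weightX_gt0 M x; have := weightX_gt0 N x.
move: (weight x ^+ M) (weight x ^+ N) => u v v0 u0.
by field; rewrite !gt_eqF.
Qed.

(** The smooth multipliers of rapidly decreasing functions. *)
Definition moderate (h : 'rV[R]_n -> R[i]^o) : Prop := smooth h /\
  forall k, exists C M, derivs_bounded k (fun x => C * weight x ^+ M) h.

Lemma rapid_mul h f : moderate h -> rapid f -> rapid (fun x => h x * f x : R[i]^o).
Proof.
move=> [sh bh] [sf bf]; split; first exact: smooth_mul.
move=> N; have [C [M HC]] := bh N; have [B HB] := bf (M + N)%N.
by exists (2 ^+ N * C * B); exact: (sbound_mul sh sf HC HB).
Qed.

Lemma dlist_cst_le (c : R[i]^o) s z :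
  normc (dlist s (fun _ : 'rV[R]_n => c) z) <= normc c.
Proof.
elim: s c => [|j s IH] c //.
rewrite -[dlist _ _]/(dlist s (partial j (fun=> c))) partial_cst.
by apply: le_trans (IH 0) _; rewrite normc0 normc_ge0.
Qed.

Lemma moderate_cst (c : R[i]^o) : moderate (fun=> c).
Proof.
split; first exact: smooth_cst.
move=> k; exists (normc c), 0%N => s _ z; rewrite expr0 mulr1.
exact: dlist_cst_le.
Qed.

Lemma moderate_mul h g : moderate h -> moderate g ->
  moderate (fun x => h x * g x : R[i]^o).
Proof.
move=> [sh bh] [sg bg]; split; first exact: smooth_mul.
move=> k; have [C [M HC]] := bh k; have [E [N HE]] := bg k.
exists (2 ^+ k * C * E), (M + N)%N.
apply: derivs_bounded_le (derivs_bounded_mul sh sg HC HE) => x.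
by rewrite exprD le_eqVlt; apply/orP; left; apply/eqP; ring.
Qed.

Definition coordinate j : 'rV[R]_n -> R[i]^o := fun x => (x 0 j)%:C.

Lemma partial_coord j k : partial_derivable k (coordinate j) /\
  partial k (coordinate j) = fun=> (k == j)%:R%:C.
Proof.
apply: partialP => x; split; last exact: is_derive_cst.
rewrite -[x]addr0 -[X in x + X](scale0r (delta_mx 0 k)); apply/is_derive_line.
have -> : (fun s : R => complex.Re (coordinate j (x + s *: delta_mx 0 k))) =
    (fun s : R => x 0 j + s * (k == j)%:R).
  by apply/funext => s; rewrite /= !mxE eqxx /= eq_sym.
have := is_deriveD (is_derive_cst (x 0 j) (0 : R) 1)
   (is_deriveM (is_derive_id (0 : R) 1) (is_derive_cst ((k == j)%:R : R) (0 : R) 1)).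
by move=> H; apply: is_derive_eq H _; rewrite add0r scaler0 add0r; exact: mulr1.
Qed.

Lemma smooth_coord j : smooth (coordinate j).
Proof.
have c : continuous (coordinate j).
  by apply/continuous_complexP; split; [exact: coord_continuous|exact: cst_continuous].
case=> [|k]; first by split; [exact: c|exact: I].
split=> [|i]; first exact: c.
by have [d ->] := partial_coord j i; split; [exact: d|exact: smooth_cst].
Qed.

Lemma coord_bounded k j : derivs_bounded k (fun x => 1 * weight x ^+ 1) (coordinate j).
Proof.
case=> [_ z|i s _ z]; rewrite mul1r expr1.
  rewrite -[dlist _ _ z]/((z 0 j)%:C : R[i]) normc_real.
  apply: le_trans (weight_coord z j).
  rewrite -[z 0 j ^+ 2]real_normK ?num_real//.
  by have := sqr_ge0 (`|z 0 j| - 1); have := normr_ge0 (z 0 j); nra.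
rewrite -[dlist _ _]/(dlist s (partial i (coordinate j))) (partial_coord j i).2.
apply: le_trans (weight_ge1 z); apply: le_trans (dlist_cst_le _ _ _) _.
by rewrite normc_real; case: eqP => _; rewrite ?normr1 ?normr0.
Qed.

Lemma moderate_coord j : moderate (coordinate j).
Proof.
by split; [exact: smooth_coord|move=> k; exists 1, 1%N; exact: coord_bounded].
Qed.

Lemma sbound_coord N B f j : smooth f -> sbound N.+1 B f ->
  sbound N (2 ^+ N * B) (fun x => coordinate j x * f x : R[i]^o).
Proof.
move=> sf Hf; rewrite -[2 ^+ N]mulr1.
exact: (@sbound_mul 1 N 1 B _ _ (smooth_coord j) sf (@coord_bounded N j) Hf).
Qed.

(** Covers e^{i theta} whenever the derivatives of theta are moderate: E is
    bounded, and each derivative reproduces E times a moderate factor. *)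
Lemma moderate_exponential (E : 'rV[R]_n -> R[i]^o) (c : 'I_n -> 'rV[R]_n -> R[i]^o) :
  continuous E -> (forall x, normc (E x) <= 1) -> (forall j, moderate (c j)) ->
  (forall j, partial_derivable j E /\ partial j E = fun x => c j x * E x) ->
  moderate E.
Proof.
move=> cE E1 mc dE; have sE : smooth E.
  elim=> [|k IH]; first by split; [exact: cE|exact: I].
  split=> [|j]; first exact: cE.
  have [d ->] := dE j; split; first exact: d.
  by apply: Ck_mul IH; exact: (mc j).1.
split=> // k; elim: k => [|k [C [M HC]]].
  by exists 1, 0%N => -[|//] _ z; rewrite mul1r expr0; exact: E1.
have C0 : 0 <= C.
  by have := derivs_bounded_ge0 0 HC; rewrite pmulr_lge0 ?weightX_gt0.
pose A j := projT1 (cid ((mc j).2 k)).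
pose L j := projT1 (cid (projT2 (cid ((mc j).2 k)))).
have HA j : derivs_bounded k (fun x => A j * weight x ^+ L j) (c j).
  exact: (projT2 (cid (projT2 (cid ((mc j).2 k))))).
have A0 j : 0 <= A j.
  by have := derivs_bounded_ge0 0 (HA j); rewrite pmulr_lge0 ?weightX_gt0.
exists (1 + \sum_j 2 ^+ k * A j * C), (\sum_j L j + M)%N => -[_|j s sk] z.
  rewrite (le_trans (E1 z))// mulr_ege1 ?weightX_ge1//.
  by rewrite lerDl sumr_ge0// => j _; rewrite !mulr_ge0.
rewrite -[dlist _ _]/(dlist s (partial j E)) (dE j).2.
apply: le_trans (derivs_bounded_mul (mc j).1 sE (HA j) HC sk z) _.
have -> : 2 ^+ k * (A j * weight z ^+ L j * (C * weight z ^+ M)) =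
  2 ^+ k * A j * C * weight z ^+ (L j + M) by rewrite exprD mulrACA !mulrA.
rewrite ler_pM ?mulr_ge0 ?exprn_ge0//.
  by rewrite (bigD1 j)//= addrCA lerDl addr_ge0// sumr_ge0// => i _; rewrite !mulr_ge0.
by rewrite ler_weXn2l// leq_add2r (bigD1 j)//= leq_addr.
Qed.

Lemma normc_expi (t : R) : normc (expi t) = 1.
Proof. by rewrite /normc /expi /= cos2Dsin2 sqrtr1. Qed.

Lemma expiD (s t : R) : expi (s + t) = expi s * expi t.
Proof.
rewrite /expi cosD sinD; apply: eq_ReIm => /=; first by [].
by rewrite addrC.
Qed.

Lemma expi0 : expi 0 = 1 :> R[i].
Proof. by rewrite /expi cos0 sin0. Qed.

Lemma partial_expi (th : 'rV[R]_n -> R) (d : 'I_n -> 'rV[R]_n -> R) j :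
  (forall x s, th (x + s *: delta_mx 0 j) = th x + s * d j x) ->
  partial_derivable j (fun x => expi (th x)) /\
  partial j (fun x => expi (th x)) = (fun x => 'i * (d j x)%:C * expi (th x) : R[i]^o).
Proof.
move=> thE; apply: partialP => x.
have aff : is_derive (0 : R) 1 (fun s : R => th x + s * d j x) (d j x).
  have := is_deriveD (is_derive_cst (th x) (0 : R) 1)
     (is_deriveM (is_derive_id (0 : R) 1) (is_derive_cst (d j x) (0 : R) 1)).
  by move=> H; apply: is_derive_eq H _; rewrite add0r scaler0 add0r; exact: mulr1.
have th0 : th x + 0 * d j x = th x by rewrite mul0r addr0.
split; rewrite -[X in is_derive X]addr0 -[X in is_derive (x + X)](scale0r (delta_mx 0 j));
  apply/is_derive_line.
  have -> : (fun s : R => complex.Re (expi (th (x + s *: delta_mx 0 j)))) =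
     cos \o (fun s : R => th x + s * d j x).
    by apply/funext => s; rewrite thE.
  have dc : is_derive (th x + 0 * d j x) 1 (@cos R) (- sin (th x)).
    by rewrite th0; exact: is_derive_cos.
  apply: is_derive_eq (@is_derive1_comp R _ _ 0 _ _ dc aff) _.
  by rewrite /=; ring.
have -> : (fun s : R => complex.Im (expi (th (x + s *: delta_mx 0 j)))) =
   sin \o (fun s : R => th x + s * d j x).
  by apply/funext => s; rewrite thE.
have dc : is_derive (th x + 0 * d j x) 1 (@sin R) (cos (th x)).
  by rewrite th0; exact: is_derive_sin.
apply: is_derive_eq (@is_derive1_comp R _ _ 0 _ _ dc aff) _.
by rewrite /=; ring.
Qed.

Lemma continuous_expi {T : topologicalType} (th : T -> R) : continuous th ->
  continuous (fun x => expi (th x)).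
Proof.
move=> c; apply/continuous_complexP; split.
  exact: continuous_after (@continuous_cos R) c.
exact: continuous_after (@continuous_sin R) c.
Qed.

End SchwartzBounds.

(** * The Fourier transform of rapidly decreasing functions *)

Section FourierTransform.
Context {R : realType} {n : nat}.
Implicit Types (f g : 'rV[R]_n -> R[i]^o) (j : 'I_n).
Local Notation e j := (delta_mx 0 j : 'rV[R]_n).

Lemma sbound_cdominated N B f : smooth f -> sbound N.+1 B f -> cdominated B f.
Proof.
move=> sf Hf; split; first exact: smooth_continuous.
by move=> x; have := sbound_leq (ltn0Sn N) Hf (s := [::]) isT x; rewrite expr1.
Qed.

Lemma rapid_cdominated f : rapid f -> exists C, cdominated C f.
Proof. by move=> [sf /(_ 1%N)[B HB]]; exists B; exact: sbound_cdominated HB. Qed.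

Lemma rapid_continuous f : rapid f -> continuous f.
Proof. by move=> [/smooth_continuous]. Qed.

Lemma dotpC (x y : 'rV[R]_n) : dotp x y = dotp y x.
Proof. by apply: eq_bigr => i _; rewrite mulrC. Qed.

Lemma dotp_line (x y : 'rV[R]_n) j (s : R) :
  dotp x (y + s *: e j) = dotp x y + s * x 0 j.
Proof.
rewrite /dotp (eq_bigr (fun i => x 0 i * y 0 i + s * (x 0 i * (i == j)%:R))).
  rewrite big_split -mulr_sumr; congr (_ + s * _).
  rewrite (bigD1 j)//= eqxx mulr1 big1 ?addr0// => i ij.
  by rewrite (negbTE ij) mulr0.
by move=> i _; rewrite !mxE eqxx /= mulrDr mulrCA.
Qed.

Lemma continuous_dotp (y : 'rV[R]_n) : continuous (fun x : 'rV[R]_n => dotp x y).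
Proof.
apply: continuous_sum_seq => i; apply: continuous_mul; last exact: continuous_cst.
exact: coord_continuous.
Qed.

Definition ft (sg : R) f : 'rV[R]_n -> R[i]^o :=
  fun xi => cintegral (fun x => expi (sg * dotp x xi) * f x).

Definition mulX (sg : R) j f : 'rV[R]_n -> R[i]^o :=
  fun x => ('i * sg%:C) * (coordinate j x * f x).

Lemma rapid_scale (c : R[i]^o) f : rapid f -> rapid (fun x => c * f x : R[i]^o).
Proof. by apply: rapid_mul; exact: moderate_cst. Qed.

Lemma rapid_mulX sg j f : rapid f -> rapid (mulX sg j f).
Proof.
by move=> rf; apply: rapid_scale; apply: rapid_mul => //; exact: moderate_coord.
Qed.

Lemma sbound_scale N B (c : R[i]^o) f : smooth f -> normc c <= 1 -> sbound N B f ->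
  sbound N B (fun x => c * f x : R[i]^o).
Proof.
move=> sf c1 Hf s sN x; rewrite dlist_scale// normcM.
by rewrite -[X in _ <= X]mul1r ler_pM ?normc_ge0//; exact: Hf.
Qed.

Lemma normc_i (sg : R) : normc ('i * sg%:C : R[i]) = `|sg|.
Proof. by rewrite normcM normc_real /normc /= expr0n add0r expr1n sqrtr1 mul1r. Qed.

Lemma moderate_phase (sg : R) (y : 'rV[R]_n) :
  moderate (fun x : 'rV[R]_n => expi (sg * dotp x y)) /\
  forall j, partial_derivable j (fun x : 'rV[R]_n => expi (sg * dotp x y)) /\
  partial j (fun x : 'rV[R]_n => expi (sg * dotp x y)) =
  (fun x => ('i * (sg * y 0 j)%:C) * expi (sg * dotp x y) : R[i]^o).
Proof.
have H j := @partial_expi R n (fun x => sg * dotp x y) (fun j _ => sg * y 0 j) j.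
have {}H j : partial_derivable j (fun x : 'rV[R]_n => expi (sg * dotp x y)) /\
  partial j (fun x : 'rV[R]_n => expi (sg * dotp x y)) =
  (fun x => ('i * (sg * y 0 j)%:C) * expi (sg * dotp x y) : R[i]^o).
  apply: (H j) => x s; rewrite dotpC dotp_line mulrDr dotpC mulrCA; congr (_ + _ * _).
split=> //; apply: (moderate_exponential (c := fun j _ => 'i * (sg * y 0 j)%:C)) => //.
- apply: continuous_expi; apply: continuous_mul; first exact: continuous_cst.
  exact: continuous_dotp.
- by move=> x; rewrite normc_expi.
- by move=> j; exact: moderate_cst.
Qed.

Let idx := {f : 'rV[R]_n -> R[i]^o | rapid f}.

(** Differentiating under the integral multiplies f by i sg x_j. *)
Lemma ft_smooth_partial sg f : rapid f -> smooth (ft sg f) /\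
  forall j, partial j (ft sg f) = ft sg (mulX sg j f).
Proof.
move=> rf.
pose g (i : idx) (z x : 'rV[R]_n) : R[i]^o := expi (sg * dotp x z) * proj1_sig i x.
pose D j (i : idx) : idx := exist _ (mulX sg j (proj1_sig i)) (rapid_mulX sg j (proj2_sig i)).
have g1 i j x : partial_derivable j (fun z => g i z x) /\
    partial j (fun z => g i z x) = (fun z => g (D j i) z x).
  have [//|d dE] := @partial_expi R n (fun z => sg * dotp x z) (fun j _ => sg * x 0 j) j.
    by move=> z s; rewrite dotp_line mulrDr mulrCA.
  have dc := smooth_derivable j (smooth_cst (proj1_sig i x)).
  have [d2 d2E] := partial_mul d dc; split; first exact: d2.
  rewrite d2E dE partial_cst; apply/funext => z.
  rewrite /g /D /mulX /coordinate /= mulr0 addr0 rmorphM.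
  by rewrite [RHS]mulrC -!mulrA; congr (_ * (_ * (_ * _))); rewrite mulrC.
have g2 i z : continuous (g i z).
  apply: continuousM_complex; last exact: rapid_continuous (proj2_sig i).
  by have [[/smooth_continuous]] := moderate_phase sg z.
have g3 i (r : R) : exists C, forall z : 'rV[R]_n, (forall k, `|z 0 k| <= r) ->
    forall x, normc (g i z x) <= C / weight x.
  have [C [_ HC]] := rapid_cdominated (proj2_sig i); exists C => z _ x.
  by rewrite /g normcM normc_expi mul1r; exact: HC.
split; first exact: (parametric_smooth g1 g2 g3 (exist _ f rf)).
by move=> j; have [_] := parametric_partial g1 g2 g3 (exist _ f rf) j.
Qed.

(** The integral of f(x + z e_j) is constant in z by translation invariance, and
    its derivative at z = 0 is the integral of the partial derivative. *)
Lemma cintegral_partial j f : rapid f -> cintegral (partial j f) = 0.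
Proof.
move=> rf.
pose g (i : idx) (z : 'rV[R]_1) (x : 'rV[R]_n) : R[i]^o := proj1_sig i (z 0 0 *: e j + x).
pose D (_ : 'I_1) (i : idx) : idx := exist _ (partial j (proj1_sig i)) (rapid_partial j (proj2_sig i)).
have g1 i k x : partial_derivable k (fun z => g i z x) /\
    partial k (fun z => g i z x) = (fun z => g (D k i) z x).
  have sd := smooth_derivable j (proj2_sig i).1.
  have [] := @partial_comp_line R 1 n (fun z => z 0 0 *: e j + x) (fun=> j) (fun=> 1) _
    (proj1_sig i) k sd.
    move=> z l h; rewrite !mxE !ord1 eqxx mulr1 scalerDl addrAC; congr (_ + _).
  move=> d ->; split; first exact: d.
  by apply/funext => z; rewrite mul1r.
have g2 i z : continuous (g i z).
  apply: (@continuous_compose _ _ _ (fun x => z 0 0 *: e j + x)).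
    apply: continuous_into_row => k.
    under eq_fun do rewrite mxE.
    by apply: continuous_add; [exact: continuous_cst|exact: coord_continuous].
  exact: rapid_continuous (proj2_sig i).
have g3 i (r : R) : exists C, forall z : 'rV[R]_1, (forall k, `|z 0 k| <= r) ->
    forall x, normc (g i z x) <= C / weight x.
  have [C dC] := rapid_cdominated (proj2_sig i).
  have [_ HC] := dC; have C0 := cdominated_ge0 dC.
  exists (C * ((1 + 2 / 1 ^+ 2) ^+ n * (1 + r ^+ 2) ^+ n)) => z zr x.
  apply: (le_trans (HC _)); rewrite -mulrA ler_wpM2l//.
  rewrite ler_pdivlMr// mulrC ler_pdivrMr//.
  have := @weight_affine R n 1 (z 0 0 *: e j) (oner_neq0 _) x.
  rewrite scale1r [x + _]addrC => /le_trans; apply.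
  rewrite ler_wpM2r// ler_wpM2l ?exprn_ge0 ?addr_ge0//.
  have -> : (1 + r ^+ 2) ^+ n = \prod_(i < n) (1 + r ^+ 2).
    by rewrite prodr_const card_ord.
  apply: ler_prod => k _; rewrite addr_ge0 ?sqr_ge0//= lerD2l !mxE eqxx /=.
  rewrite -[X in X <= _]real_normK ?num_real// lerXn2r ?nnegrE//.
    exact: le_trans (normr_ge0 _) (zr 0).
  by apply: le_trans (zr 0); case: eqP => _; rewrite ?mulr1// mulr0 normr0.
have [_ E] := parametric_partial g1 g2 g3 (exist _ f rf) 0.
have [C dC] := rapid_cdominated rf.
have G z : cintegral (g (exist _ f rf) z) = cintegral f.
  rewrite [RHS](cintegral_affine (z 0 0 *: e j) (oner_neq0 _) dC).
  rewrite normr1 expr1n mul1r; apply: eq_cintegral => x.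
  by rewrite /g /= scale1r addrC.
have GE : (fun z => cintegral (g (exist _ f rf) z)) = (fun=> cintegral f).
  exact/funext.
have E0 := congr1 (fun h => h 0) E; rewrite GE partial_cst in E0.
apply: etrans (esym E0); apply: eq_cintegral => x.
by rewrite /g /= mxE scale0r add0r.
Qed.

(** Integration by parts. *)
Lemma ft_coord sg j f xi : sg ^+ 2 = 1 -> rapid f ->
  coordinate j xi * ft sg f xi = ft sg (fun x => ('i * sg%:C) * partial j f x) xi.
Proof.
move=> sg1 rf; have [mE dE] := moderate_phase sg xi.
pose E (x : 'rV[R]_n) : R[i]^o := expi (sg * dotp x xi).
have rEf := rapid_mul mE rf; have rEd := rapid_mul mE (rapid_partial j rf).
have [C dC] := rapid_cdominated rEf; have [C' dC'] := rapid_cdominated rEd.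
have := cintegral_partial j rEf.
have [d dEj] := dE j.
rewrite (partial_mul d (smooth_derivable j rf.1)).2 dEj.
rewrite (@eq_cintegral _ _ _ (fun x => ('i * (sg * xi 0 j)%:C) * (E x * f x) +
  E x * partial j f x)); last by move=> x; rewrite /E !mulrA.
rewrite (cintegral_lin _ dC dC') => /eqP; rewrite addr_eq0 => /eqP H.
have -> : ft sg (fun x => 'i * sg%:C * partial j f x) xi =
    'i * sg%:C * cintegral (fun x => E x * partial j f x).
  by rewrite -(cintegralZ _ dC'); apply: eq_cintegral => x; rewrite mulrCA.
have -> : cintegral (fun x => E x * partial j f x) = - ('i * (sg * xi 0 j)%:C * ft sg f xi).
  by rewrite /ft H opprK.
have iK : 'i * 'i = -1 :> R[i] by apply: eq_ReIm => /=; ring.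
have K : 'i * sg%:C * ('i * (sg * xi 0 j)%:C) = - coordinate j xi :> R[i].
  by rewrite mulrACA iK -rmorphM mulrA -expr2 sg1 mul1r mulN1r.
by rewrite mulrN mulrA K mulNr opprK.
Qed.

Lemma ft_bound sg N f B xi : rapid f -> sbound N.+1 B f ->
  normc (ft sg f xi) <= 2 * B * pi ^+ n.
Proof.
move=> rf Hf; have [mE _] := moderate_phase sg xi.
have [cf fB] := sbound_cdominated rf.1 Hf.
apply: cintegral_bound; split; last by move=> x; rewrite normcM normc_expi mul1r.
exact: continuousM_complex (smooth_continuous mE.1) cf.
Qed.

Lemma mpow_mlist (x : 'rV[R]_n) al : mpow x al = \prod_(j <- mlist al) x 0 j.
Proof.
rewrite /mlist big_flatten big_map (perm_big (enum 'I_n)) ?perm_rev//=.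
by rewrite big_enum; apply: eq_bigr => i _; rewrite big_nseq -Monoid.iteropE.
Qed.

(** Trades derivatives of the transform for powers of x in the integrand;
    [ft_coords] trades powers of xi for derivatives. *)
Lemma ft_dlist sg K N s f B : `|sg| = 1 -> 2 ^+ K <= N -> rapid f ->
  forall M, (M + size s <= K)%N -> sbound (M + size s) B f ->
  exists f', [/\ rapid f', dlist s (ft sg f) = ft sg f' &
    sbound M (N ^+ size s * B) f'].
Proof.
move=> sg1 KN; elim: s f B => [|j s IH] f B rf M MK Hf.
  by exists f; split=> //; rewrite expr0 mul1r -[M]addn0.
have [sm pm] := ft_smooth_partial sg rf.
have [||f' [rf' Ef' Bf']] := IH (mulX sg j f) (N * B) (rapid_mulX sg j rf) M.
- by rewrite (leq_trans _ MK)// leq_add2l.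
- apply: sbound_scale; first by apply: smooth_mul rf.1; exact: smooth_coord.
    by rewrite normc_i sg1.
  have B0 := sbound_ge0 Hf.
  have : sbound (M + size s) (2 ^+ (M + size s) * B) (fun x => coordinate j x * f x : R[i]^o).
    by apply: sbound_coord rf.1 _; rewrite -addnS.
  apply: derivs_bounded_le => x; rewrite ler_wpM2r ?invr_ge0 ?exprn_ge0//.
  rewrite ler_wpM2r// (le_trans _ KN)// ler_weXn2l ?ler1n//.
  by rewrite (leq_trans _ MK)// leq_add2l.
exists f'; split=> //; first by rewrite /= pm.
by rewrite exprSr -mulrA.
Qed.

Lemma ft_coords sg s f B M (xi : 'rV[R]_n) : sg ^+ 2 = 1 -> rapid f ->
  sbound (M + size s) B f ->
  exists f', [/\ rapid f', (\prod_(j <- s) xi 0 j)%:C * ft sg f xi = ft sg f' xi &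
    sbound M B f'].
Proof.
move=> sg2; have sg1 : `|sg| = 1.
  by apply/eqP; rewrite -(@eqrXn2 _ 2)// real_normK ?num_real// sg2 expr1n.
elim: s f => [|j s IH] f rf Hf.
  exists f; split => //; first by rewrite big_nil mul1r.
  by move: Hf; rewrite addn0.
have rf1 : rapid (fun x => 'i * sg%:C * partial j f x : R[i]^o).
  by apply: rapid_scale; exact: rapid_partial.
have [|f' [rf' Ef' Bf']] := IH (fun x => 'i * sg%:C * partial j f x) rf1.
  apply: sbound_scale; [exact: smooth_partial rf.1|by rewrite normc_i sg1|].
  by apply: sbound_partial; rewrite -addnS.
exists f'; split => //.
rewrite -Ef' -(ft_coord j xi sg2 rf) big_cons rmorphM /coordinate.
by rewrite [RHS]mulrCA mulrA.
Qed.

Definition ft_const (N : nat) : R :=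
  let K := (n * (2 * N) + N).+1 in 2 ^+ (n * N) * (2 * ((2 ^+ K) ^+ N) * pi ^+ n).

Lemma ft_const_ge0 N : 0 <= ft_const N.
Proof. by rewrite /ft_const !mulr_ge0// ?exprn_ge0// ?exprn_ge0// pi_ge0. Qed.

(** A seminorm of order N of the transform needs at most n * 2N derivatives to
    produce the weight, N powers of x to produce the derivatives and one more
    weight for integrability. *)
Lemma ft_sbound sg N f B : sg ^+ 2 = 1 -> rapid f ->
  sbound (n * (2 * N) + N).+1 B f -> sbound N (ft_const N * B) (ft sg f).
Proof.
move=> sg2 rf Hf; apply/sboundP => s sN xi.
have sg1 : `|sg| = 1.
  by apply/eqP; rewrite -(@eqrXn2 _ 2)// real_normK ?num_real// sg2 expr1n.
have B0 := sbound_ge0 Hf.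
have [al alN wal] := weight_le_mpow N xi.
rewrite (le_trans (ler_wpM2r (normc_ge0 _) wal))//.
set K := (n * (2 * N) + N).+1 in Hf.
have Kle : ((mabs al).+1 + size s <= K)%N by rewrite addSn ltnS leq_add.
have [f1 [rf1 -> Hf1]] := ft_dlist sg1 (lexx (2 ^+ K)) rf Kle (sbound_leq Kle Hf).
rewrite -size_mlist in Hf1.
have [f2 [rf2 E2 Hf2]] := @ft_coords sg (mlist al) f1 _ 1 xi sg2 rf1 Hf1.
rewrite -mulrA -normc_real -normcM mpow_mlist E2 /ft_const -/K -mulrA.
rewrite ler_wpM2l ?exprn_ge0//; apply: (le_trans (ft_bound sg xi rf2 Hf2)).
rewrite [X in _ <= X]mulrAC ler_wpM2r ?exprn_ge0 ?pi_ge0// -mulrA ler_wpM2l//.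
rewrite ler_wpM2r// ler_weXn2l// ?exprn_ege1// ?ler1n//.
Qed.

Lemma ft_rapid sg f : sg ^+ 2 = 1 -> rapid f -> rapid (ft sg f).
Proof.
move=> sg2 rf; split; first by have [] := ft_smooth_partial sg rf.
move=> N; have [B HB] := rf.2 (n * (2 * N) + N).+1.
by eexists; exact: ft_sbound sg2 rf HB.
Qed.

Lemma fourierE f : fourier f = ft (-1) f.
Proof.
by apply/funext => xi; apply: eq_cintegral => x; rewrite mulN1r.
Qed.

Lemma inv_fourierE f : inv_fourier f = fun x => ((2 * pi) ^- n)%:C * ft 1 f x.
Proof.
apply/funext => xi; congr (_ * _); apply: eq_cintegral => x.
by rewrite mul1r dotpC.
Qed.

End FourierTransform.

Lemma real_complexM (R : realType) (x y : R) : (x * y)%:C = x%:C * y%:C :> R[i].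
Proof. by rewrite rmorphM. Qed.

(** * Fourier inversion at the origin *)

Section Damping.
Context {R : realType}.
Local Notation lam := (@lebesgue_measure R).

(** The summand 1 makes the integrand nonnegative, as the fundamental theorem
    on a half-line requires. *)
Lemma integral_exp_cos (t : R) :
  (\int[lam]_x (expR (- `|x|) * (1 + cos (t * x)))%:E =
   (2 * (1 + (1 + t ^+ 2)^-1))%:E)%E.
Proof.
pose f (x : R) := expR (- `|x|) * (1 + cos (t * x)).
have f0 x : 0 <= f x.
  by rewrite /f mulr_ge0 ?expR_ge0//; have := cos_geN1 (t * x); lra.
have cf : continuous f.
  apply: continuous_mul.
    apply: (@continuous_after _ _ (@expR R)); first exact: continuous_expR.
    by apply: continuous_opp => x; exact: norm_continuous.
  apply: continuous_add; first exact: continuous_cst.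
  apply: (@continuous_after _ _ (@cos R)); first exact: continuous_cos.
  by apply: continuous_mul; [exact: continuous_cst|move=> x; exact: cvg_id].
rewrite (ge0_symfun_integralT f0 cf); last first.
  by move=> x; rewrite /f /= normrN mulrN cosN.
rewrite (_ : [set x | _] = `[0, +oo[%classic); last first.
  by apply/seteqP; split=> x /=; rewrite in_itv/= andbT.
(* A primitive of the integrand on the half-line, vanishing at infinity. *)
pose F (x : R) := expR (- x) * ((1 + t ^+ 2)^-1 * (t * sin (t * x) - cos (t * x)) - 1).
have t1 : 1 + t ^+ 2 != 0 by rewrite gt_eqF// ltr_wpDr// sqr_ge0.
pose g (x : R) := expR (- x) * (1 + cos (t * x)).
have dF (x : R) : is_derive x 1 F (g x).
  have dt : is_derive x 1 (fun x : R => t * x) t.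
    have := is_deriveZ t (is_derive_id x 1); by rewrite [t *: _]mulr1.
  have ds := @is_derive1_comp R (@sin R) _ x _ _ (is_derive_sin _) dt.
  have dc := @is_derive1_comp R (@cos R) _ x _ _ (is_derive_cos _) dt.
  have de := @is_derive1_comp R (@expR R) _ x _ _ (is_derive_expR _) (is_deriveNid x 1).
  have := is_deriveM de (is_deriveB (is_deriveZ (1 + t ^+ 2)^-1
     (is_deriveB (is_deriveZ t ds) dc)) (is_derive_cst (1 : R) x 1)).
  move=> H; apply: is_derive_eq H _.
  rewrite -[X in _ + X *: _]/((1 + t ^+ 2)^-1 * (t * sin (t * x) - cos (t * x)) - 1).
  rewrite /g /GRing.scale /=; move: (expR _) (sin _) (cos _) => E S K.
  by field.
have -> : (\int[lam]_(x in `[0%R, +oo[) (f x)%:E = \int[lam]_(x in `[0%R, +oo[) (g x)%:E)%E.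
  by apply: eq_integral => x; rewrite inE /= in_itv /= andbT => x0; rewrite /f /g ger0_norm.
have F0 : F 0 = - (1 + (1 + t ^+ 2)^-1).
  by rewrite /F oppr0 expR0 mulr0 sin0 cos0; ring.
have Fy : F x @[x --> +oo] --> 0.
  pose K := (1 + t ^+ 2)^-1 * (`|t| + 1) + 1.
  have e0 : K * expR (- x) @[x --> +oo] --> 0.
    by rewrite -[X in _ --> X](mulr0 K); apply: cvgM; [exact: cvg_cst|exact: cvgr_expR].
  apply: (@squeeze_cvgr _ _ _ _ (fun x => - (K * expR (- x))) (fun x => K * expR (- x))).
  - near=> x; rewrite -ler_norml /F normrM [K * _]mulrC ger0_norm ?expR_ge0//.
    rewrite ler_wpM2l ?expR_ge0// /K (le_trans (ler_normB _ _))// normr1 lerD2r.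
    rewrite normrM ger0_norm ?invr_ge0 ?addr_ge0 ?sqr_ge0// ler_wpM2l ?invr_ge0 ?addr_ge0 ?sqr_ge0//.
    rewrite (le_trans (ler_normB _ _))// lerD// ?normrM ?ler_piMr// ler_norml;
      by rewrite ?sin_geN1 ?sin_le1 ?cos_geN1 ?cos_le1.
  - by rewrite -oppr0; apply: cvgN.
  - exact: e0.
have cF : continuous F.
  by move=> x; apply/differentiable_continuous/derivable1_diffP; case: (dF x).
rewrite (@ge0_continuous_FTC2y R g F 0 0) => //.
- by rewrite F0 sub0e -EFinN opprK -EFinM.
- by move=> x x0; have := f0 x; rewrite /f ger0_norm.
- apply: continuous_subspaceT; apply: continuous_mul.
    apply: (@continuous_after _ _ (@expR R)); first exact: continuous_expR.
    by apply: continuous_opp => x; exact: cvg_id.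
  apply: continuous_add; first exact: continuous_cst.
  apply: (@continuous_after _ _ (@cos R)); first exact: continuous_cos.
  by apply: continuous_mul; [exact: continuous_cst|move=> x; exact: cvg_id].
- exact/cvg_at_right_filter/cF.
- by move=> x _; rewrite derive1E derive_val.
Unshelve. all: end_near. Qed.

Lemma rint1_ge0 (f : R -> R) : continuous f -> (forall x, 0 <= f x) ->
  rint (fun y : 'rV[R]_1 => f (y 0 0)) = fine (\int[lam]_x (f x)%:E)%E.
Proof.
move=> cf f0; rewrite /rint /Rintegral.
have cf1 : continuous (fun y : 'rV[R]_1 => f (y 0 0)).
  by apply: continuous_after cf _; exact: coord_continuous.
congr fine; rewrite tuple_tonelliS; first last.
- by move=> t; rewrite lee_fin.
- exact: (measurable_row_tnth_EFin cf1).
apply: eq_integral => x _; rewrite integral_dirac//.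
  by rewrite diracT mul1e mxE tnth0.
apply: (measurableT_comp (measurable_row_tnth_EFin cf1)).
apply: (measurableT_comp (measurable_tuple_cons (n := 0))).
exact: measurable_pair1.
Qed.

Definition damp n (y : 'rV[R]_n) : R := \prod_(i < n) expR (- `|y 0 i|).

Lemma damp_ge0 n (y : 'rV[R]_n) : 0 <= damp y.
Proof. by apply: prodr_ge0 => i _; exact: expR_ge0. Qed.

Lemma damp_le1 n (y : 'rV[R]_n) : damp y <= 1.
Proof.
apply: prodr_ile1 => i _; rewrite expR_ge0 /=.
by rewrite -[X in _ <= X]expR0 ler_expR oppr_le0.
Qed.

Lemma continuous_damp n : continuous (@damp n).
Proof.
apply: continuous_prod_seq => i.
apply: (@continuous_after _ _ (@expR R)); first exact: continuous_expR.
apply: continuous_opp; apply: (@continuous_after _ _ (fun x => `|x|)).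
  by move=> x; exact: norm_continuous.
exact: coord_continuous.
Qed.

Lemma damp_le n (y : 'rV[R]_n) : damp y <= 4 ^+ n / weight y.
Proof.
have -> : 4 ^+ n / weight y = \prod_(i < n) (4 / (1 + y 0 i ^+ 2)).
  by rewrite prodf_div prodr_const card_ord.
apply: ler_prod => i _; rewrite expR_ge0 /= expRN.
have e0 : 0 < expR `|y 0 i| by exact: expR_gt0.
have w0 : 0 < 1 + y 0 i ^+ 2 by rewrite ltr_wpDr// sqr_ge0.
rewrite ler_pdivlMr// mulrC ler_pdivrMr//.
have -> : expR `|y 0 i| = expR (`|y 0 i| / 2) ^+ 2.
  by rewrite -expRM_natr divfK.
have h : 1 + `|y 0 i| / 2 <= expR (`|y 0 i| / 2) by exact: expR_ge1Dx.
have := normr_ge0 (y 0 i); rewrite -[y 0 i ^+ 2]real_normK ?num_real//.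
move: (expR (_ / 2)) h => E; move: `|y 0 i| => a h a0; nra.
Qed.

Lemma damp_row_mx n m (x : 'rV[R]_n) (y : 'rV[R]_m) :
  damp (row_mx x y) = damp x * damp y.
Proof.
rewrite /damp big_split_ord; congr (_ * _); apply: eq_bigr => i _.
  by rewrite row_mxEl.
by rewrite row_mxEr.
Qed.

Lemma cdominated_damp n (xi : 'rV[R]_n) :
  cdominated (4 ^+ n) (fun y => expi (dotp y xi) * (damp y)%:C : R[i]^o).
Proof.
split=> [|y].
  apply: continuousM_complex; first exact/continuous_expi/continuous_dotp.
  by apply/continuous_complexP; split; [exact: continuous_damp|exact: cst_continuous].
by rewrite normcM normc_expi mul1r normc_real ger0_norm ?damp_ge0// damp_le.
Qed.

Lemma damp_scale_le n (a : R) (y : 'rV[R]_n) : a != 0 ->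
  damp (a *: y) <= 4 ^+ n * ((1 + 2 / a ^+ 2) ^+ n * weight (0 : 'rV[R]_n)) / weight y.
Proof.
move=> a0; apply: (le_trans (damp_le _)); rewrite -mulrA ler_wpM2l ?exprn_ge0//.
rewrite ler_pdivlMr// mulrC ler_pdivrMr//.
by have := weight_affine 0 a0 y; rewrite addr0.
Qed.

Lemma ft_damp1 (xi : 'rV[R]_1) :
  cintegral (fun y : 'rV[R]_1 => expi (dotp y xi) * (damp y)%:C) =
  (2 / weight xi)%:C.
Proof.
pose t := xi 0 0.
have dE (y : 'rV[R]_1) : dotp y xi = t * y 0 0 by rewrite /dotp big_ord1 mulrC.
have aE (y : 'rV[R]_1) : damp y = expR (- `|y 0 0|) by rewrite /damp big_ord1.
have wE : weight xi = 1 + t ^+ 2 by rewrite /weight big_ord1.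
have [dr di] := cdominatedP (cdominated_damp xi).
have [d0 _] := cdominatedP (@cdominated_damp 1 0).
have E0 (y : 'rV[R]_1) : expi (dotp y 0) = 1 :> R[i].
  by rewrite dotpC /dotp big1 ?expi0// => i _; rewrite mxE mul0r.
have R0 (y : 'rV[R]_1) : complex.Re (expi (dotp y 0) * (damp y)%:C) = damp y.
  by rewrite E0 mul1r.
have Ry (y : 'rV[R]_1) : complex.Re (expi (dotp y xi) * (damp y)%:C) =
   cos (t * y 0 0) * damp y by rewrite /= dE; ring.
have ge0 s (x : R) : 0 <= expR (- `|x|) * (1 + cos (s * x)).
  by rewrite mulr_ge0 ?expR_ge0//; have := cos_geN1 (s * x); lra.
have cc s : continuous (fun x : R => expR (- `|x|) * (1 + cos (s * x))).
  apply: continuous_mul.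
    apply: (@continuous_after _ _ (@expR R)); first exact: continuous_expR.
    by apply: continuous_opp => x; exact: norm_continuous.
  apply: continuous_add; first exact: continuous_cst.
  apply: (@continuous_after _ _ (@cos R)); first exact: continuous_cos.
  by apply: continuous_mul; [exact: continuous_cst|move=> x; exact: cvg_id].
have I s : rint (fun y : 'rV[R]_1 => expR (- `|y 0 0|) * (1 + cos (s * y 0 0))) =
    2 * (1 + (1 + s ^+ 2)^-1).
  by rewrite (rint1_ge0 (cc s) (ge0 s)) integral_exp_cos.
have D1 : rint (fun y : 'rV[R]_1 => damp y) = 2.
  have := I 0; rewrite expr0n addr0 invr1.
  have -> : (fun y : 'rV[R]_1 => expR (- `|y 0 0|) * (1 + cos (0 * y 0 0))) =
      (fun y => 2 * damp y).
    by apply/funext => y; rewrite mul0r cos0 aE mulrC.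
  have dd : dominated (4 ^+ 1) (fun y : 'rV[R]_1 => damp y).
    by move: d0; congr (dominated _ _); apply/funext => y; rewrite R0.
  by rewrite (rintZ 2 dd); lra.
rewrite cintegralE; apply: eq_ReIm => /=.
  have := I t.
  have -> : (fun y : 'rV[R]_1 => expR (- `|y 0 0|) * (1 + cos (t * y 0 0))) =
    (fun y => 1 * complex.Re (expi (dotp y 0) * (damp y)%:C) +
       complex.Re (expi (dotp y xi) * (damp y)%:C)).
    by apply/funext => y; rewrite R0 Ry aE; ring.
  rewrite (rint_lin 1 d0 dr).
  have -> : (fun y : 'rV[R]_1 => complex.Re (expi (dotp y 0) * (damp y)%:C)) = @damp 1.
    exact/funext.
  by rewrite D1 wE; lra.
have m1 : (-1 : R) != 0 by rewrite oppr_eq0 oner_neq0.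
pose J (y : 'rV[R]_1) := complex.Im (expi (dotp y xi) * (damp y)%:C).
(* The imaginary part is odd, so the substitution y -> - y kills it. *)
have JN : rint J = - rint J.
  have L := rintZ (-1) (di : dominated (4 ^+ 1) J).
  rewrite mulN1r in L.
  rewrite {1}(rint_affine 0 m1 (di : dominated (4 ^+ 1) J)) normrN normr1 expr1n mul1r -L.
  congr rint; apply/funext => y; rewrite /J addr0 scaleN1r !dE !aE !mxE normrN /=.
  by rewrite mulrN sinN; ring.
by rewrite -[LHS]/(rint J); lra.
Qed.

Lemma dotp_row_mx n m (x x' : 'rV[R]_n) (y y' : 'rV[R]_m) :
  dotp (row_mx x y) (row_mx x' y') = dotp x x' + dotp y y'.
Proof.
rewrite /dotp big_split_ord; congr (_ + _); apply: eq_bigr => i _.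
  by rewrite !row_mxEl.
by rewrite !row_mxEr.
Qed.

(** The damping factor is a product, so its transform is the product of the
    one-dimensional ones; it is again explicit and positive with known integral. *)
Lemma ft_damp n (xi : 'rV[R]_n) :
  cintegral (fun y => expi (dotp y xi) * (damp y)%:C) = (2 ^+ n / weight xi)%:C.
Proof.
elim: n xi => [|n IH] xi.
  have e (y : 'rV[R]_0) : expi (dotp y xi) * (damp y)%:C = (1 / weight y)%:C :> R[i].
    rewrite /dotp big_ord0 expi0 mul1r /damp /weight !big_ord0.
    by rewrite invr1 mulr1.
  rewrite (eq_cintegral e) cintegralE /= /weight big_ord0 expr0 invr1 mulr1.
  have := @rint_weightV R 0 1; rewrite mulr1 => ->.
  have := @rint_weightV R 0 0; rewrite mul0r.
  have -> : (fun x : 'rV[R]_0 => 0 / weight x) = fun=> 0.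
    by apply/funext => x; rewrite mul0r.
  by move=> ->.
have dn := cdominated_damp (xi : 'rV[R]_(1 + n)).
rewrite (@cintegral_row_mx R 1 n _ _ dn).
have xiE : xi = row_mx (lsubmx (xi : 'rV_(1 + n))) (rsubmx (xi : 'rV_(1 + n))) :> 'rV_(1 + n).
  by rewrite hsubmxK.
move: (lsubmx (xi : 'rV_(1 + n))) (rsubmx (xi : 'rV_(1 + n))) xiE => a b ->.
have d1 := cdominated_damp a; have d2 := cdominated_damp b.
rewrite (@eq_cintegral _ _ _ (fun x => (2 ^+ n / weight b)%:C * (expi (dotp x a) * (damp x)%:C))).
  rewrite (cintegralZ _ d1) ft_damp1 (@weight_row_mx R 1 n) -rmorphM; congr (_%:C).
  by rewrite exprS invfM; ring.
move=> x; rewrite (@eq_cintegral _ _ _ (fun y => (expi (dotp x a) * (damp x)%:C) *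
   (expi (dotp y b) * (damp y)%:C))).
  by rewrite (cintegralZ _ d2) IH mulrC.
by move=> y; rewrite dotp_row_mx expiD (@damp_row_mx 1 n) rmorphM mulrACA.
Qed.

End Damping.

Section ContinuousBlocks.
Context {R : realType} {n : nat}.

Lemma continuous_affine (a : R) (v : 'rV[R]_n) :
  continuous (fun x : 'rV[R]_n => a *: x + v).
Proof.
apply: continuous_into_row => i; under eq_fun do rewrite !mxE.
apply: continuous_add; last exact: continuous_cst.
by apply: continuous_mul; [exact: continuous_cst|exact: coord_continuous].
Qed.

End ContinuousBlocks.

Lemma continuous_dotp2 (R : realType) n {T : topologicalType} (u v : T -> 'rV[R]_n) :
  continuous u -> continuous v -> continuous (fun t => dotp (u t) (v t)).
Proof.
move=> cu cv; apply: continuous_sum_seq => i; apply: continuous_mul.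
  exact: continuous_compose cu (@coord_continuous R 1 n 0 i).
exact: continuous_compose cv (@coord_continuous R 1 n 0 i).
Qed.

Lemma weight_split (R : realType) n m (z : 'rV[R]_(n + m)) :
  weight z = weight (lsubmx z) * weight (rsubmx z).
Proof. by rewrite -weight_row_mx hsubmxK. Qed.

Lemma dotpZl (R : realType) n (a : R) (x y : 'rV[R]_n) : dotp (a *: x) y = a * dotp x y.
Proof. by rewrite /dotp mulr_sumr; apply: eq_bigr => i _; rewrite mxE mulrA. Qed.

Lemma cvg_uniqueC (R : realType) (u : nat -> R[i]^o) (a b : R[i]^o) :
  u @ \oo --> a -> u @ \oo --> b -> a = b.
Proof. by move=> ua ub; apply: (cvg_unique _ ua ub). Qed.

Section Inversion.
Context {R : realType} {n : nat}.
Implicit Types (f : 'rV[R]_n -> R[i]^o).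

Lemma rapid_affine (a : R) (v : 'rV[R]_n) f : a != 0 -> rapid f ->
  rapid (fun x => f (a *: x + v)).
Proof.
move=> a0 [sf bf].
have L_line (z : 'rV[R]_n) j h : a *: (z + h *: delta_mx 0 j) + v =
    (a *: z + v) + (h * a) *: delta_mx 0 j.
  by rewrite scalerDr scalerA [a * h]mulrC addrAC.
have cL : continuous (fun z : 'rV[R]_n => a *: z + v).
  apply: continuous_into_row => i; under eq_fun do rewrite !mxE.
  apply: continuous_add; last exact: continuous_cst.
  by apply: continuous_mul; [exact: continuous_cst|exact: coord_continuous].
split; first exact: (smooth_comp_line L_line cL sf).
move=> N; have [B HB] := bf N.
pose K := (1 + 2 / a ^+ 2) ^+ n * weight v.
have K0 : 0 <= K by rewrite mulr_ge0// exprn_ge0// addr_ge0// divr_ge0// sqr_ge0.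
pose A := Num.max 1 `|a|.
have A1 : 1 <= A by rewrite le_max lexx.
have A0 : 0 <= A by exact: le_trans A1.
exists (A ^+ N * (K ^+ N * B)); apply/sboundP => s sN x.
have B0 := sbound_ge0 HB.
rewrite (dlist_comp_line L_line cL s sf) normcM normc_real map_id.
have P : `|\prod_(j <- s) a| <= A ^+ N.
  apply: (@le_trans _ _ (A ^+ size s)); last by rewrite ler_weXn2l.
  elim: (s) => [|j t IH]; first by rewrite big_nil normr1.
  by rewrite big_cons normrM exprS ler_pM// le_max lexx orbT.
rewrite mulrCA ler_pM// ?mulr_ge0 ?normc_ge0 ?exprn_ge0//.
have wK : weight x ^+ N <= K ^+ N * weight (a *: x + v) ^+ N.
  rewrite -exprMn; apply: lerXn2r; rewrite ?nnegrE//; first exact: mulr_ge0.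
  exact: (weight_affine v a0 x).
rewrite (le_trans (ler_wpM2r (normc_ge0 _) wK))// -mulrA ler_wpM2l ?exprn_ge0//.
by move/sboundP : HB; apply.
Qed.

Lemma rapid_dilation (a : R) f : a != 0 -> rapid f -> rapid (fun x => f (a *: x)).
Proof.
move=> a0 rf; have := rapid_affine 0 a0 rf; congr rapid.
by apply/funext => x; rewrite addr0.
Qed.

Lemma cvg_line (f : 'rV[R]_n -> R[i]^o) (x y : 'rV[R]_n) (eps : nat -> R) :
  continuous f -> eps @ \oo --> (0 : R) ->
  (fun m => f (x + eps m *: y)) @ \oo --> f x.
Proof.
move=> cf e0; pose h (r : R) := f (x + r *: y).
have ch : continuous h.
  apply: (@continuous_compose _ _ _ (fun r : R => x + r *: y)) cf.
  apply: continuous_into_row => i; under eq_fun do rewrite !mxE.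
  apply: continuous_add; first exact: continuous_cst.
  by apply: continuous_mul; [move=> r; exact: cvg_id|exact: continuous_cst].
have <- : h 0 = f x by rewrite /h scale0r addr0.
exact: (cvg_comp _ _ e0 (ch 0)).
Qed.

(** The integral of the transform is damped by prod_j exp(-eps |y_j|).  By Fubini
    it equals the integral of psi(eps x) against 2^n / weight x; as eps tends to 0
    dominated convergence on the two sides gives the integral of the transform
    and psi(0) 2^n pi^n. *)
Lemma inversion0 (psi : 'rV[R]_n -> R[i]^o) : rapid psi ->
  cintegral (ft 1 psi) = ((2 * pi) ^+ n)%:C * psi 0.
Proof.
move=> rpsi; pose eps m : R := m.+1%:R^-1.
have e0 : eps @ \oo --> (0 : R) := @cvg_harmonic R.
have ep m : 0 < eps m by rewrite invr_gt0.
have en m : eps m != 0 by rewrite gt_eqF.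
have rF : rapid (ft 1 psi) by apply: ft_rapid rpsi; rewrite expr1n.
have [C [cF FC]] := rapid_cdominated rF.
have [C' dpsi] := rapid_cdominated rpsi.
have [cpsi psiC] := dpsi; have C0 := cdominated_ge0 dpsi.
have cdampc (a : R) : continuous (fun y : 'rV[R]_n => (damp (a *: y))%:C : R[i]^o).
  apply/continuous_complexP; split; last exact: cst_continuous.
  apply: (@continuous_compose _ _ _ (fun y : 'rV[R]_n => a *: y)); last exact: continuous_damp.
  apply: continuous_into_row => i; under eq_fun do rewrite !mxE.
  by apply: continuous_mul; [exact: continuous_cst|exact: coord_continuous].
have cdampN (y : 'rV[R]_n) : normc ((damp y)%:C : R[i]) <= 1.
  by rewrite normc_real ger0_norm ?damp_ge0// damp_le1.
have cdampC : continuous (fun y : 'rV[R]_n => (damp y)%:C : R[i]^o).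
  by have := cdampc 1; under eq_fun do rewrite scale1r.
pose A m := cintegral (fun y : 'rV[R]_n => ft 1 psi y * (damp (eps m *: y))%:C).
have damp0 : damp (0 : 'rV[R]_n) = 1.
  by rewrite /damp big1// => i _; rewrite mxE normr0 oppr0 expR0.
have A1 : A @ \oo --> cintegral (ft 1 psi).
  apply: (@cintegral_dct _ _ C) => [m||x].
  - split; first exact: (continuousM_complex cF (cdampc (eps m))).
    move=> y; rewrite normcM (le_trans _ (FC y))//.
    by rewrite ler_piMr ?normc_ge0.
  - exact: cF.
  rewrite -[X in _ --> X]mulr1; apply: cvgM; first exact: cvg_cst.
  have := @cvg_line (fun y => (damp y)%:C) 0 x eps cdampC e0; rewrite damp0.
  by under eq_fun do rewrite add0r.
pose B m := cintegral (fun x : 'rV[R]_n => psi (0 + eps m *: x) * (2 ^+ n / weight x)%:C).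
have cW : continuous (fun x : 'rV[R]_n => (2 ^+ n / weight x)%:C : R[i]^o).
  apply/continuous_complexP; split; last exact: cst_continuous.
  by apply: continuous_mul; [exact: continuous_cst|exact: continuous_weightV].
have W0 (x : 'rV[R]_n) : 0 <= 2 ^+ n / weight x by rewrite divr_ge0// exprn_ge0.
have dW : cdominated (2 ^+ n) (fun x : 'rV[R]_n => (2 ^+ n / weight x)%:C).
  by split=> // x; rewrite normc_real ger0_norm.
have psiB x : normc (psi x) <= C' by exact: cdominated_le.
have B1 : B @ \oo --> cintegral (fun x : 'rV[R]_n => psi 0 * (2 ^+ n / weight x)%:C).
  apply: (@cintegral_dct _ _ (C' * 2 ^+ n)) => [m||x].
  - split.
      apply: continuousM_complex cW.
      apply: (@continuous_compose _ _ _ (fun x : 'rV[R]_n => 0 + eps m *: x)) cpsi.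
      apply: continuous_into_row => i; under eq_fun do rewrite !mxE.
      apply: continuous_add; first exact: continuous_cst.
      by apply: continuous_mul; [exact: continuous_cst|exact: coord_continuous].
    move=> x; rewrite normcM normc_real (ger0_norm (W0 x)) -mulrA.
    by rewrite ler_wpM2r.
  - by apply: continuousM_complex cW; exact: cst_continuous.
  - by apply: cvgM; [exact: (@cvg_line psi 0 x eps cpsi e0)|exact: cvg_cst].
have AB m : A m = B m.
  pose a := eps m; have a0 : a != 0 := en m.
  have ap : 0 < a := ep m.
  pose G (z : 'rV[R]_(n + n)) : R[i]^o := (damp (a *: lsubmx z))%:C *
    (expi (1 * dotp (rsubmx z) (lsubmx z)) * psi (rsubmx z)).
  have [D dG] : exists D, cdominated D G.
    have K0 : 0 <= (1 + 2 / a ^+ 2) ^+ n * weight (0 : 'rV[R]_n).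
      by rewrite mulr_ge0// exprn_ge0// addr_ge0// divr_ge0// sqr_ge0.
    exists (4 ^+ n * ((1 + 2 / a ^+ 2) ^+ n * weight (0 : 'rV[R]_n)) * C'); split=> [|z].
      apply: continuousM_complex.
        exact: (continuous_compose (@continuous_lsubmx _ 1 _ _) (cdampc a)).
      apply: continuousM_complex.
        apply: continuous_expi; apply: continuous_mul; first exact: continuous_cst.
        exact: continuous_dotp2 (@continuous_rsubmx _ 1 _ _) (@continuous_lsubmx _ 1 _ _).
      exact: continuous_compose (@continuous_rsubmx _ 1 _ _) cpsi.
    rewrite weight_split /G !normcM normc_expi mul1r normc_real.
    move: (lsubmx z) (rsubmx z) => y x.
    rewrite (ger0_norm (damp_ge0 _)) -mulf_div ler_pM ?damp_ge0 ?normc_ge0//.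
    exact: damp_scale_le.
  have AG : A m = cintegral G.
    rewrite (cintegral_row_mx dG); apply: eq_cintegral => y.
    have dy : cdominated C' (fun x => expi (1 * dotp x y) * psi x : R[i]^o).
      split; last by move=> x; rewrite normcM normc_expi mul1r.
      by have [mE _] := moderate_phase 1 y;
        exact: continuousM_complex (smooth_continuous mE.1) cpsi.
    rewrite mulrC /ft -(cintegralZ _ dy); apply: eq_cintegral => x.
    by rewrite /G row_mxKl row_mxKr.
  have ai0 : a^-1 != 0 by rewrite invr_eq0.
  have K0 : 0 <= (1 + 2 / a ^+ 2) ^+ n * weight (0 : 'rV[R]_n).
    by rewrite mulr_ge0// exprn_ge0// addr_ge0// divr_ge0// sqr_ge0.
  have I (x : 'rV[R]_n) : cintegral (fun y : 'rV[R]_n => expi (dotp y x) * (damp (a *: y))%:C) =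
      (a ^- n * (2 ^+ n / weight (a^-1 *: x)))%:C.
    have dI : cdominated (4 ^+ n * ((1 + 2 / a ^+ 2) ^+ n * weight (0 : 'rV[R]_n)))
       (fun y : 'rV[R]_n => expi (dotp y x) * (damp (a *: y))%:C : R[i]^o).
      split=> [|y].
        by apply: continuousM_complex (cdampc a); exact/continuous_expi/continuous_dotp.
      rewrite normcM normc_expi mul1r normc_real (ger0_norm (damp_ge0 _)).
      exact: damp_scale_le.
    rewrite (cintegral_affine 0 ai0 dI) ger0_norm ?invr_ge0 ?(ltW ap)// exprVn.
    rewrite real_complexM -ft_damp; apply: (congr1 (fun w => _ * w)); apply: eq_cintegral => y.
    by rewrite addr0 scalerA mulfV// scale1r dotpZl dotpC -dotpZl dotpC.
  have dh : cdominated (C' * (a ^- n * 2 ^+ n))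
     (fun x : 'rV[R]_n => psi x * (a ^- n * (2 ^+ n / weight (a^-1 *: x)))%:C).
    have an0 : 0 <= a ^- n by rewrite invr_ge0 exprn_ge0// ltW.
    split=> [|x].
      apply: continuousM_complex cpsi _.
      apply/continuous_complexP; split; last exact: cst_continuous.
      apply: continuous_mul; first exact: continuous_cst.
      apply: continuous_mul; first exact: continuous_cst.
      apply: (@continuous_compose _ _ _ (fun x : 'rV[R]_n => a^-1 *: x) (fun x => (weight x)^-1)).
        by have := @continuous_affine R n a^-1 0; under eq_fun do rewrite addr0.
      exact: continuous_weightV.
    have q0 : 0 <= a ^- n * (2 ^+ n / weight (a^-1 *: x)).
      by rewrite mulr_ge0// divr_ge0// exprn_ge0.
    have q1 : a ^- n * (2 ^+ n / weight (a^-1 *: x)) <= a ^- n * 2 ^+ n.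
      by rewrite ler_wpM2l// ler_pdivrMr// ler_peMr// exprn_ge0.
    rewrite normcM normc_real ger0_norm//.
    by rewrite [X in _ <= X]mulrAC ler_pM ?normc_ge0.
  rewrite AG (cintegral_row_mxC dG).
  rewrite (@eq_cintegral _ _ _ (fun x : 'rV[R]_n => psi x * (a ^- n * (2 ^+ n / weight (a^-1 *: x)))%:C)).
    rewrite (cintegral_affine 0 a0 dh) (ger0_norm (ltW ap)).
    have dB : cdominated (C' * 2 ^+ n) (fun x : 'rV[R]_n => psi (a *: x + 0) * (2 ^+ n / weight x)%:C).
      split.
        apply: continuousM_complex cW.
        exact: continuous_compose (@continuous_affine R n a 0) cpsi.
      move=> x; rewrite normcM normc_real (ger0_norm (W0 x)) -mulrA.
      by rewrite ler_wpM2r.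
    rewrite (@eq_cintegral _ _ _ (fun x : 'rV[R]_n => (a ^- n)%:C *
       (psi (a *: x + 0) * (2 ^+ n / weight x)%:C))).
      rewrite (cintegralZ _ dB) mulrA -rmorphM mulfV ?expf_neq0// mul1r.
      by apply: eq_cintegral => x; rewrite addr0 add0r.
    by move=> x; rewrite addr0 scalerA mulVf// scale1r rmorphM mulrCA.
  move=> x; rewrite -I.
  rewrite (@eq_cintegral _ _ _ (fun y : 'rV[R]_n => psi x * (expi (dotp y x) * (damp (a *: y))%:C))).
    have dI : cdominated (4 ^+ n * ((1 + 2 / a ^+ 2) ^+ n * weight (0 : 'rV[R]_n)))
       (fun y : 'rV[R]_n => expi (dotp y x) * (damp (a *: y))%:C : R[i]^o).
      split=> [|y].
        by apply: continuousM_complex (cdampc a); exact/continuous_expi/continuous_dotp.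
      rewrite normcM normc_expi mul1r normc_real (ger0_norm (damp_ge0 _)).
      exact: damp_scale_le.
    exact: (cintegralZ _ dI).
  by move=> y; rewrite /G row_mxKl row_mxKr mul1r dotpC mulrC [RHS]mulrCA mulrA.
rewrite (funext AB) in A1; rewrite (cvg_uniqueC A1 B1).
rewrite (cintegralZ _ dW) mulrC; congr (_ * _).
by rewrite cintegralE rint_weightV rint0 exprMn.
Qed.

End Inversion.

(** * Existence of cutoff functions *)

Section FlatFunction.
Context {R : realType}.
Local Notation "p ^r" := (('X^2 * (p - p^`()) : {poly R})) (at level 2).

(** The k-th derivative of exp(-1/t) is p_k(1/t) exp(-1/t) with p_0 = 1 and
    p_{k+1} = X^2 (p_k - p_k'). *)
Fixpoint flat_poly (k : nat) : {poly R} :=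
  if k is k'.+1 then (flat_poly k') ^r else 1.

Definition flat (k : nat) (t : R) : R :=
  if 0 < t then (flat_poly k).[t^-1] * expR (- t^-1) else 0.

Lemma monomial_le_expR k (u : R) : 0 <= u -> u ^+ k <= k`!%:R * expR u.
Proof.
case: k => [|k] u0.
  by rewrite expr0 fact0 mul1r -[X in X <= _]expR0 ler_expR.
have := expR_ge1Dxn k u0; have f0 : 0 < (k.+1)`!%:R :> R by rewrite ltr0n fact_gt0.
move=> h; rewrite mulrC -ler_pdivrMr//; apply: le_trans h.
by rewrite lerDr.
Qed.

Lemma poly_le_expR (p : {poly R}) : exists C, forall u, 0 <= u -> `|p.[u]| <= C * expR u.
Proof.
exists (\sum_(i < size p) `|p`_i| * i`!%:R) => u u0.
rewrite horner_coef (le_trans (ler_norm_sum _ _ _))// mulr_suml.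
apply: ler_sum => i _; rewrite normrM (ger0_norm (exprn_ge0 _ u0)) -mulrA.
by rewrite ler_wpM2l// monomial_le_expR.
Qed.

(** Only the point 0 needs an argument: u^2 |p(u)| <= C e^u with u = 1/t shows
    that p(1/t) exp(-1/t) is O(t^2) there. *)
Lemma is_derive_flat k (t : R) : is_derive t 1 (flat k) (flat k.+1 t).
Proof.
have [t0|t0|->] := ltgtP t 0.
- apply: (near_eq_is_derive (f := fun=> 0 : R)).
    have : \forall s \near t, s < 0 by apply: lt_nbhsl.
    by apply: filterS => s s0; rewrite /flat ltNge (ltW s0).
  by rewrite /flat ltNge (ltW t0); exact: is_derive_cst.
- apply: (@near_eq_is_derive R R^o R^o (fun s : R => (flat_poly k).[s^-1] * expR (- s^-1)) (flat k)).
    have : \forall s \near t, 0 < s by apply: lt_nbhsr.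
    by apply: filterS => s s0; rewrite /flat s0.
  have dV : is_derive t 1 (fun s : R => s^-1) (- t ^- 2).
    have tn0 : t != 0 by rewrite gt_eqF.
    by have := is_deriveV tn0 (is_derive_id t 1); rewrite [_ *: _]mulr1.
  have dp := @is_derive1_comp R (horner (flat_poly k)) _ t _ _ (is_derive_poly _ _) dV.
  have de := @is_derive1_comp R (@expR R) _ t _ _ (is_derive_expR _) (is_deriveN dV).
  apply: is_derive_eq (is_deriveM dp de) _.
  rewrite /flat t0 /= hornerM hornerXn hornerD hornerN /GRing.scale /= exprVn.
  ring.
have [C HC] := poly_le_expR ('X^2 * flat_poly k).
have -> : flat k.+1 0 = 0 by rewrite /flat ltxx.
apply: (@is_derive_quadratic R _ _ _ _ _ C) => s _.
rewrite add0r [s *: _]mulr1 mulr0 subr0.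
have -> : flat k 0 = 0 by rewrite /flat ltxx.
rewrite subr0.
have C0 : 0 <= C.
  by have := le_trans (normr_ge0 _) (HC 0 (lexx _)); rewrite expR0 mulr1.
rewrite /flat; case: ifPn => s0; last by rewrite normr0 mulr_ge0// sqr_ge0.
have := HC s^-1; rewrite invr_ge0 (ltW s0) => /(_ isT).
rewrite hornerM hornerXn normrM => h.
rewrite ger0_norm ?sqr_ge0// exprVn in h.
have E0 : 0 < expR (- s^-1) by exact: expR_gt0.
have s2 : 0 < s ^+ 2 by rewrite exprn_gt0.
rewrite normrM (ger0_norm (ltW E0)) expRN -ler_pdivlMr ?invr_gt0 ?expR_gt0// invrK.
by rewrite mulrAC mulrC -ler_pdivrMl// mulrC.
Qed.

Lemma flat_gt0 t : 0 < t -> 0 < flat 0 t.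
Proof. by move=> t0; rewrite /flat t0 hornerC mul1r expR_gt0. Qed.

Lemma flat_le0 t : t <= 0 -> flat 0 t = 0.
Proof. by rewrite /flat ltNge => ->. Qed.

End FlatFunction.

Section SmoothCompose.
Context {R : realType} {n : nat}.

(** A whole sequence h of successive derivatives is carried along so that the
    chain rule can be iterated. *)
Lemma smooth_compose_real (h : nat -> R -> R) (q : 'rV[R]_n -> R) :
  (forall k (t : R), is_derive t 1 (h k) (h k.+1 t)) ->
  smooth (fun x => (q x)%:C : R[i]^o) ->
  smooth (fun x => (h 0%N (q x))%:C : R[i]^o).
Proof.
move=> dh sq.
have ch k : continuous (h k).
  by move=> t; apply/differentiable_continuous/derivable1_diffP; case: (dh k t).
have cq : continuous q by have /continuous_complexP[] := smooth_continuous sq.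
have cH k : continuous (fun x => (h k (q x))%:C : R[i]^o).
  apply/continuous_complexP; split; last exact: cst_continuous.
  exact: continuous_after (ch k) cq.
have dH k j : partial_derivable j (fun x => (h k (q x))%:C : R[i]^o) /\
    partial j (fun x => (h k (q x))%:C : R[i]^o) =
    (fun x => (h k.+1 (q x))%:C * partial j (fun x => (q x)%:C : R[i]^o) x).
  apply: partialP => x.
  have [dq di] := is_derive_partial x (smooth_derivable j sq).
  have i0 : complex.Im (partial j (fun x => (q x)%:C : R[i]^o) x) = 0.
    rewrite -(@derive_val _ _ _ _ _ _ _ di); exact: derive_cst.
  move: dq i0; move: (partial _ _ x) => w dq i0; split; last first.
    rewrite (_ : complex.Im _ = 0); first exact: is_derive_cst.
    by case: w i0 {dq} => a b /= ->; rewrite mulr0 mul0r addr0.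
  rewrite (_ : complex.Re _ = h k.+1 (q x) * complex.Re w); last first.
    by case: w i0 {dq} => a b /= ->; rewrite mulr0 subr0.
  move: dq; set d := complex.Re w => dq.
  rewrite -[x]addr0 -[X in x + X](scale0r (delta_mx 0 j)).
  apply/is_derive_line.
  have dq0 : is_derive (0 : R) 1 (fun s : R => q (x + s *: delta_mx 0 j)) d.
    by apply/is_derive_line; rewrite scale0r addr0.
  have e0 : q (x + 0 *: delta_mx 0 j) = q x by rewrite scale0r addr0.
  have dhq : is_derive (q (x + 0 *: delta_mx 0 j)) 1 (h k) (h k.+1 (q x)).
    by rewrite e0; exact: dh.
  have := @is_derive1_comp R (h k) (fun s : R => q (x + s *: delta_mx 0 j)) 0 _ _ dhq dq0.
  by rewrite scale0r addr0.
suff H N k : Ck N (fun x => (h k (q x))%:C : R[i]^o) by move=> N; exact: H.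
elim: N k => [|N IH] k; first by split; [exact: cH|exact: I].
split=> [|j]; first exact: cH.
have [d ->] := dH k j; split; first exact: d.
apply: Ck_mul; first exact: IH.
exact: (smooth_partial j sq N).
Qed.

Lemma smooth_sum (I : Type) (r : seq I) (F : I -> 'rV[R]_n -> R[i]^o) :
  (forall i, smooth (F i)) -> smooth (fun x => \sum_(i <- r) F i x).
Proof.
move=> sF; elim: r => [|i r IH].
  rewrite (_ : (fun _ => _) = fun=> 0); first exact: smooth_cst.
  by apply/funext => x; rewrite big_nil.
rewrite (_ : (fun _ => _) = fun x => F i x + \sum_(j <- r) F j x).
  exact: smooth_add.
by apply/funext => x; rewrite big_cons.
Qed.

End SmoothCompose.

Section Cutoff.
Context {R : realType} {n : nat}.

Let q (x : 'rV[R]_n) : R := 1 - dotp x x.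
Let u (x : 'rV[R]_n) : R := flat 0 (q x).
Let del : R := flat 0 1 / 2.
Let bump (x : 'rV[R]_n) : R := 1 - flat 0 (del - u x) / flat 0 del.

Let del_gt0 : 0 < del.
Proof. by rewrite /del divr_gt0// flat_gt0. Qed.

Let smooth_q : smooth (fun x => (q x)%:C : R[i]^o).
Proof.
have -> : (fun x => (q x)%:C : R[i]^o) =
    (fun x => 1 + (-1) * \sum_(j < n) coordinate j x * coordinate j x).
  apply/funext => x; rewrite /q rmorphB rmorph1 mulN1r; congr (1 - _).
  have addC : {morph (fun a : R => a%:C : R[i]^o) : a b / a + b} by move=> a b; rewrite rmorphD.
  rewrite [LHS](big_morph (fun a : R => a%:C : R[i]^o) addC erefl).
  by apply: eq_bigr => i _; rewrite real_complexM.
apply: smooth_add; first exact: smooth_cst.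
apply: smooth_scale; apply: smooth_sum => j.
by apply: smooth_mul; exact: smooth_coord.
Qed.

Let smooth_u : smooth (fun x => (u x)%:C : R[i]^o).
Proof. exact: smooth_compose_real is_derive_flat smooth_q. Qed.

Let smooth_bump : smooth (fun x => (bump x)%:C : R[i]^o).
Proof.
have sdu : smooth (fun x => (del - u x)%:C : R[i]^o).
  have -> : (fun x => (del - u x)%:C : R[i]^o) = (fun x => del%:C + (-1) * (u x)%:C).
    by apply/funext => x; rewrite rmorphB mulN1r.
  by apply: smooth_add; [exact: smooth_cst|apply: smooth_scale; exact: smooth_u].
have -> : (fun x => (bump x)%:C : R[i]^o) =
    (fun x => 1 + (- (flat 0 del)^-1)%:C * (flat 0 (del - u x))%:C).
  apply/funext => x; rewrite /bump rmorphB rmorph1 -real_complexM mulNr rmorphN.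
  by rewrite mulrC.
apply: smooth_add; first exact: smooth_cst.
by apply: smooth_scale; exact: smooth_compose_real is_derive_flat sdu.
Qed.

Let bump_supp x : bump x != 0 -> dotp x x <= 1.
Proof.
apply: contraNT; rewrite -ltNge => x1; rewrite /bump.
have -> : u x = 0 by rewrite /u flat_le0// /q subr_le0 ltW.
by rewrite subr0 divff ?subrr// gt_eqF// flat_gt0.
Qed.

Let bump_testfun : (fun x => (bump x)%:C : R[i]^o) \in testfun_pred.
Proof.
apply/asboolP; split; first exact: smooth_bump.
pose K : set 'rV[R]_n := [set v | forall i, `[-1, 1]%classic (v 0 i)].
have cK : compact K.
  apply: (@rV_compact R^o n (fun=> `[-1, 1]%classic)) => i.
  exact: segment_compact.
have clK : closed K by apply: compact_closed cK; exact: norm_hausdorff.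
apply: (subclosed_compact _ cK); first exact: closed_closure.
rewrite closureE => x; apply; split => // y /= y0.
have {y0} y1 : dotp y y <= 1.
  by apply: bump_supp; apply: contra_neq y0 => ->.
move=> i; rewrite /= in_itv /= -ler_norml -(@ler_pXn2r _ 2)// ?nnegrE// expr1n.
rewrite real_normK ?num_real// (le_trans _ y1)// /dotp (bigD1 i)//= -expr2 lerDl.
by apply: sumr_ge0 => j _; rewrite -expr2 sqr_ge0.
Qed.

Let bump0 : \forall x \near (0 : 'rV[R]_n), bump x = 1.
Proof.
have cu : continuous u by have /continuous_complexP[] := smooth_continuous smooth_u.
have u0 : del < u 0.
  rewrite /u /q /dotp big1 => [|i _]; last by rewrite mxE mulr0.
  by rewrite subr0 /del ltr_pdivrMr// mulr2n mulrDr mulr1 ltrDl flat_gt0.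
have : \forall x \near (0 : 'rV[R]_n), del < u x.
  exact: (@cvgr_gt R _ _ _ u (u 0) (cu 0) del u0).
apply: filterS => x ux; rewrite /bump flat_le0 ?mul0r ?subr0//.
by rewrite subr_le0 ltW.
Qed.

(** With u = exp(-1/(1-|x|^2)) on the unit ball, the bump is
    1 - f(d - u)/f(d), where f(t) = exp(-1/t) for t > 0 and 0 otherwise: it equals
    1 where u >= d, which includes a neighbourhood of 0, and vanishes where u = 0. *)
Lemma cutoff_exists : exists psi : testfun R n, is_cutoff psi.
Proof.
exists (Testfun bump_testfun); apply: filterS bump0 => x /= ->.
by [].
Qed.

End Cutoff.

(** * Distributions and transposed operators *)

Section WeakStar.
Context {R : realType} {n : nat}.

Lemma initial_cvgP (S : choiceType) (T : topologicalType) (f : S -> T)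
    (F : set_system (initial_topology f)) (u : initial_topology f) :
  Filter F -> F --> u <-> f @ F --> f u.
Proof.
move=> FF; split=> [Fu|fFu].
  apply: (@cvg_comp _ _ _ id f F (nbhs u)) => //.
  exact: initial_continuous.
move=> A; rewrite nbhsE => -[U [[B oB BO] Ou] OA].
apply: (filterS OA); rewrite -BO; apply: fFu.
by apply: open_nbhs_nbhs; split => //; move: Ou; rewrite -BO.
Qed.

Lemma ptws_cvgP (U : choiceType) (F : set_system {ptws U -> R[i]^o})
    (f : {ptws U -> R[i]^o}) : Filter F ->
  F --> f <-> forall t, (fun g : U -> R[i]^o => g t) @ F --> f t.
Proof.
move=> FF; rewrite cvg_sup; split=> H t.
  by move: (H t) => /initial_cvgP; exact.
exact/initial_cvgP/H.
Qed.

Lemma tdist_cvgP (F : set_system (tdist R n)) (u : tdist R n) : Filter F ->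
  F --> u <-> forall phi, (fun v : tdist R n => v phi) @ F --> u phi.
Proof.
move=> FF.
apply: (iff_trans (@initial_cvgP _ _ (fun u : tdist R n => (u : {ptws schwartz R n -> R[i]^o})) F u FF)).
exact: (@ptws_cvgP _ (_ @ F) (u : {ptws schwartz R n -> R[i]^o})).
Qed.

Lemma distr_cvgP (F : set_system (distr R n)) (u : distr R n) : Filter F ->
  F --> u <-> forall phi, (fun v : distr R n => v phi) @ F --> u phi.
Proof.
move=> FF.
apply: (iff_trans (@initial_cvgP _ _ (fun u : distr R n => (u : {ptws testfun R n -> R[i]^o})) F u FF)).
exact: (@ptws_cvgP _ (_ @ F) (u : {ptws testfun R n -> R[i]^o})).
Qed.

Lemma tdist_eqP (u v : tdist R n) : u =1 v -> u = v.
Proof. by move=> uv; apply: val_inj; apply/funext. Qed.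

Lemma distr_eqP (u v : distr R n) : u =1 v -> u = v.
Proof. by move=> uv; apply: val_inj; apply/funext. Qed.

Lemma distr_seq_cvgP (u_ : nat -> distr R n) (u : distr R n) :
  u_ @ \oo --> u <-> forall phi, (fun m => u_ m phi) @ \oo --> u phi.
Proof. exact: (@distr_cvgP (u_ @ \oo) u _). Qed.

Lemma distr_cvg_unique (u_ : nat -> distr R n) (v w : distr R n) :
  u_ @ \oo --> v -> u_ @ \oo --> w -> v = w.
Proof.
move=> /distr_seq_cvgP uv /distr_seq_cvgP uw; apply: distr_eqP => phi.
exact: cvg_uniqueC (uv phi) (uw phi).
Qed.

Lemma tdist_linE (c : R[i]) (u v : tdist R n) phi :
  (c *: u + v) phi = c * u phi + v phi.
Proof. by []. Qed.

Lemma distr_linE (c : R[i]) (u v : distr R n) phi :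
  (c *: u + v) phi = c * u phi + v phi.
Proof. by []. Qed.

Lemma tdist_linear (u : tdist R n) : linear u.
Proof. by have /asboolP[] := valP u. Qed.

Lemma tdist_bound (u : tdist R n) : exists C N, forall phi : schwartz R n,
  normc (u phi) <= C * schwartz_norm N phi.
Proof. by have /asboolP[] := valP u. Qed.

Lemma to_tdistE (u : schwartz R n -> R[i]^o) : linear u ->
  (exists C N, forall phi, normc (u phi) <= C * schwartz_norm N phi) ->
  to_tdist u = u :> (schwartz R n -> R[i]^o).
Proof. by move=> lu bu; rewrite /to_tdist insubdK//; apply/asboolP. Qed.

Lemma schwartz_eqP (f g : schwartz R n) : f =1 g -> f = g.
Proof. by move=> fg; apply: val_inj; apply/funext. Qed.

Lemma to_schwartz_lin (c : R[i]) (f g : 'rV[R]_n -> R[i]^o) : rapid f -> rapid g ->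
  to_schwartz (c *: f + g) = c *: to_schwartz f + to_schwartz g.
Proof.
move=> rf rg; apply: val_inj => /=.
rewrite to_schwartzE; last first.
  have /asboolP [sfg bfg] : c *: f + g \in schwartz_pred.
    by apply: rpredD; [apply: rpredZ|]; exact: rapid_schwartz.
  have sch : c *: f + g \in schwartz_pred by apply/asboolP.
  exact: (schwartz_rapid (Schwartz sch)).
by rewrite -[in LHS](to_schwartzE rf) -[in LHS](to_schwartzE rg).
Qed.

End WeakStar.

Section RapidOperators.
Context {R : realType} {n : nat}.
Implicit Types (A : ('rV[R]_n -> R[i]^o) -> 'rV[R]_n -> R[i]^o).

(** Continuous linear operators on S, given on functions so that they can be
    composed without wrapping their values as elements of S. *)
Definition rapid_operator A : Prop :=
  [/\ forall f, rapid f -> rapid (A f),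
      forall (c : R[i]) f g, rapid f -> rapid g ->
        A (c *: f + g) = c *: A f + A g &
      forall N, exists K C, forall B f, rapid f -> sbound K B f ->
        sbound N (C * B) (A f)].

Definition transpose A (u : tdist R n) : tdist R n :=
  to_tdist (fun phi => u (to_schwartz (A phi))).

Lemma tdist_sbound (u : tdist R n) : exists N C, 0 <= C /\ forall (phi : schwartz R n) B,
  sbound N B phi -> normc (u phi) <= C * B.
Proof.
have [C [N uC]] := tdist_bound u; exists N, `|C|; split => // phi B bphi.
apply: le_trans (uC phi) _; apply: le_trans (ler_wpM2r _ (ler_norm C)) _.
  exact: schwartz_norm_ge0.
by rewrite ler_wpM2l// schwartz_norm_le.
Qed.

Lemma transposeE A u phi : rapid_operator A ->
  transpose A u phi = u (to_schwartz (A phi)).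
Proof.
move=> [rA lA bA]; rewrite /transpose to_tdistE// => [c f g|].
  rewrite -[RHS]tdist_linear -to_schwartz_lin ?lA//.
  1-4: by do ?apply: rA; exact: schwartz_rapid.
have [N [D [D0 uD]]] := tdist_sbound u; have [K [C AC]] := bA N.
exists (D * (C * 2 ^+ (n * K))), (n * (2 * K) + K)%N => {}phi.
rewrite -!mulrA; apply: uD; rewrite to_schwartzE; last exact/rA/schwartz_rapid.
by apply: AC; [exact: schwartz_rapid|exact: schwartz_sbound].
Qed.

Lemma transpose_linear A : rapid_operator A -> linear (transpose A).
Proof.
move=> oA c u v; apply: tdist_eqP => phi.
by rewrite transposeE// [LHS]tdist_linE [RHS]tdist_linE !transposeE.
Qed.

Lemma transpose_continuous A : rapid_operator A -> continuous (transpose A).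
Proof.
move=> oA u; apply: (proj2 (@tdist_cvgP _ _ (transpose A @ nbhs u) (transpose A u) _)) => phi.
rewrite transposeE// -fmap_comp.
rewrite (_ : _ \o _ = fun v : tdist R n => v (to_schwartz (A phi))).
  exact: (proj1 (@tdist_cvgP _ _ (nbhs u) u _) (@cvg_id _ (nbhs u))).
by apply/funext => v /=; rewrite transposeE.
Qed.

Lemma rapid_operator_comp A A' : rapid_operator A -> rapid_operator A' ->
  rapid_operator (fun f => A (A' f)).
Proof.
move=> [rA lA bA] [rA' lA' bA']; split.
- by move=> f /rA' /rA.
- by move=> c f g rf rg; rewrite lA'// lA//; exact: rA'.
move=> N; have [K [C AC]] := bA N; have [K' [C' AC']] := bA' K.
exists K', (C * C') => B f rf bf; rewrite -mulrA; apply: AC; first exact: rA'.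
exact: AC'.
Qed.

Lemma rapid_operator_mul (h : 'rV[R]_n -> R[i]^o) : moderate h ->
  rapid_operator (fun f x => h x * f x).
Proof.
move=> [sh mh]; split.
- by move=> f rf; exact: rapid_mul.
- move=> c f g _ _; apply/funext => x.
  by rewrite -[LHS]/(h x * (c * f x + g x)) mulrDr mulrCA.
move=> N; have [C [M hC]] := mh N; exists (M + N)%N, (2 ^+ N * C) => B f rf.
by move=> bf; apply: sbound_mul hC _ => //; case: rf.
Qed.

Lemma rapid_operator_ft (sg : R) : sg ^+ 2 = 1 -> rapid_operator (@ft R n sg).
Proof.
move=> s1; split.
- by move=> f; exact: ft_rapid.
- move=> c f g rf rg; apply/funext => xi; rewrite /ft.
  have [mE _] := moderate_phase sg xi.
  have [C fC] := rapid_cdominated (rapid_mul mE rf).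
  have [D gD] := rapid_cdominated (rapid_mul mE rg).
  rewrite -[RHS]/(c * _ + _) -(cintegral_lin c fC gD); apply: eq_cintegral => x.
  by rewrite -[(c *: f + g) x]/(c * f x + g x) mulrDr mulrCA.
move=> N; exists (n * (2 * N) + N).+1, (ft_const (n := n) N) => B f rf.
exact: ft_sbound.
Qed.

Lemma rapid_operator_fourier : rapid_operator (@fourier R n).
Proof.
rewrite (_ : @fourier R n = ft (-1)); first by apply: rapid_operator_ft; rewrite sqrrN expr1n.
by apply/funext => f; exact: fourierE.
Qed.

Lemma rapid_operator_inv_fourier : rapid_operator (@inv_fourier R n).
Proof.
rewrite (_ : @inv_fourier R n = fun f x => ((2 * pi) ^- n)%:C * ft 1 f x).
  apply: (@rapid_operator_comp (fun f x => ((2 * pi) ^- n)%:C * f x)).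
    exact: rapid_operator_mul (moderate_cst _).
  by apply: rapid_operator_ft; rewrite expr1n.
by apply/funext => f; exact: inv_fourierE.
Qed.

Lemma fourier_multiplierE (chi : 'rV[R]_n -> R[i]^o) u phi : moderate chi ->
  fourier_multiplier chi u phi =
  u (to_schwartz (fourier (fun x => chi x * inv_fourier phi x))).
Proof.
move=> mchi.
have oF := rapid_operator_fourier; have oI := rapid_operator_inv_fourier.
have oM := rapid_operator_mul mchi.
have rI : rapid (inv_fourier phi) by case: oI => + _ _; apply; exact: schwartz_rapid.
have rM : rapid (fun x => chi x * inv_fourier phi x) by exact: rapid_mul.
rewrite [LHS](transposeE _ _ oI) [LHS](transposeE _ _ oM) [LHS](transposeE _ _ oF).
by rewrite (to_schwartzE rI) (to_schwartzE rM).
Qed.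

End RapidOperators.

Section FunctionDistributions.
Context {R : realType} {n : nat}.

Definition tempered (f : 'rV[R]_n -> R[i]^o) : Prop :=
  continuous f /\ exists C M, forall x, normc (f x) <= C * weight x ^+ M.

Lemma tempered_mul (f phi : 'rV[R]_n -> R[i]^o) M C B : continuous f ->
  (forall x, normc (f x) <= C * weight x ^+ M) -> smooth phi -> sbound M.+1 B phi ->
  cdominated (C * B) (fun x => f x * phi x).
Proof.
move=> cf fC sphi bphi; split.
  exact: (continuousM_complex cf (smooth_continuous sphi)).
move=> x; rewrite normcM.
apply: le_trans (ler_pM (normc_ge0 _) (normc_ge0 _) (fC x) (bphi [::] _ x)) _ => //.
rewrite le_eqVlt; apply/orP; left; apply/eqP.
have w0 : weight x ^+ M != 0 by rewrite gt_eqF// weightX_gt0.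
have w1 : weight x != 0 by rewrite gt_eqF.
rewrite exprS; move: (weight x ^+ M) (weight x) w0 w1 => W w w0 w1.
by field; rewrite w0 w1.
Qed.

Lemma tempered_cdominated (f phi : 'rV[R]_n -> R[i]^o) : tempered f -> rapid phi ->
  exists C, cdominated C (fun x => f x * phi x).
Proof.
move=> [cf [C [M fC]]] [sphi bphi]; have [B bB] := bphi M.+1.
by exists (C * B); exact: tempered_mul.
Qed.

Lemma tdist_of_funE f (phi : schwartz R n) : tempered f ->
  tdist_of_fun f phi = cintegral (fun x => f x * phi x).
Proof.
move=> tf; rewrite /tdist_of_fun to_tdistE// => [c u v|].
  have [C uC] := tempered_cdominated tf (schwartz_rapid u).
  have [D vD] := tempered_cdominated tf (schwartz_rapid v).
  rewrite -[RHS]/(c * _ + _) -(cintegral_lin c uC vD); apply: eq_cintegral => x.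
  by rewrite -[(c *: u + v) x]/(c * u x + v x) mulrDr mulrCA.
have [cf [C [M fC]]] := tf.
exists (2 * (C * 2 ^+ (n * M.+1)) * pi ^+ n), (n * (2 * M.+1) + M.+1)%N => {}phi.
have [sphi _] := schwartz_rapid phi.
have := cintegral_bound (tempered_mul cf fC sphi (@schwartz_sbound _ _ M.+1 phi)).
by move=> /le_trans; apply; rewrite le_eqVlt; apply/orP; left; apply/eqP; ring.
Qed.

End FunctionDistributions.

(** * Test functions are rapidly decreasing *)

Section TestFunctions.
Context {R : realType} {n : nat}.

Lemma partial_vanish (O : set 'rV[R]_n) f j : open O -> (forall x, O x -> f x = 0 :> R[i]^o) ->
  forall x, O x -> partial j f x = 0.
Proof.
move=> oO f0 x Ox.
have nO : nbhs x O by apply: open_nbhs_nbhs.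
have d0 (g : 'rV[R]_n -> R) : (forall y, O y -> g y = 0) -> 'D_(delta_mx 0 j) g x = 0.
  move=> g0; rewrite (@near_eq_derive R 'rV[R]_n R^o g (cst 0)); first exact: derive_cst.
  by apply: filterS nO => y Oy; rewrite g0.
rewrite /partial !d0// => y Oy; by rewrite f0.
Qed.

Lemma dlist_vanish (O : set 'rV[R]_n) s f : open O -> (forall x, O x -> f x = 0 :> R[i]^o) ->
  forall x, O x -> dlist s f x = 0.
Proof.
move=> oO; elim: s f => [|j s IH] f f0 x Ox /=; first exact: f0.
by apply: IH => // y Oy; exact: (partial_vanish j oO f0 Oy).
Qed.

Lemma testfun_vanish (phi : testfun R n) s x :
  ~ closure [set x | phi x != 0] x -> dlist s phi x = 0.
Proof.
apply: (@dlist_vanish (~` closure [set x | phi x != 0])).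
  by apply: closed_openC; exact: closed_closure.
move=> y /= ny; apply/eqP; apply: contra_notT ny => phiy.
exact: subset_closure.
Qed.

(** Derivatives vanish off the support, and on this compact set every
    continuous function is bounded. *)
Lemma testfun_schwartz (phi : testfun R n) : testfun_fun phi \in schwartz_pred.
Proof.
have /asboolP[sphi cK] := valP phi.
apply/asboolP; split=> // al be.
have [M HM] := continuous_compact_bounded (smooth_continuous (smooth_mderiv be sphi)) cK.
have [W HW] : exists W, forall x, closure [set x | phi x != 0] x -> `|mpow x al| <= W.
  have cm : continuous (fun x : 'rV[R]_n => (mpow x al)%:C : R[i]^o).
    apply/continuous_complexP; split; last exact: cst_continuous.
    apply: continuous_prod_seq => i; elim: (al i) => [|k IH].
      by rewrite (_ : (fun _ => _) = fun=> 1)//; exact: cst_continuous.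
    rewrite (_ : (fun _ => _) = fun x : 'rV[R]_n => x 0 i * x 0 i ^+ k).
      by apply: continuous_mul => //; exact: continuous_coord.
    by apply/funext => x; rewrite exprS.
  have [W HW] := continuous_compact_bounded cm cK.
  by exists W => x /HW; rewrite normc_real.
exists (`|W| * `|M|) => x.
have [Kx|nKx] := pselect (closure [set x | phi x != 0] x); last first.
  by rewrite mderiv_dlist testfun_vanish// normc0 mulr0 mulr_ge0.
apply: ler_pM => //; first exact: normc_ge0.
  exact: le_trans (HW x Kx) (ler_norm _).
exact: le_trans (HM x Kx) (ler_norm _).
Qed.

Lemma testfun_rapid (phi : testfun R n) : rapid phi.
Proof. exact: (schwartz_rapid (Schwartz (testfun_schwartz phi))). Qed.

Lemma to_schwartz_testfun (phi : testfun R n) : to_schwartz phi = phi :> ('rV[R]_n -> R[i]^o).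
Proof. exact/to_schwartzE/testfun_rapid. Qed.

(** On test functions supported in K the Schwartz seminorms are bounded by the
    seminorms over K, so a tempered distribution restricts to a distribution. *)
Lemma tdist_distrE (u : tdist R n) phi : tdist_distr u phi = u (to_schwartz phi).
Proof.
rewrite /tdist_distr /to_distr insubdK//; apply/asboolP; split.
  move=> c f g; rewrite -[RHS]tdist_linear -to_schwartz_lin//; exact: testfun_rapid.
move=> K cK; have [N [C [C0 uC]]] := tdist_sbound u.
have [W HW] : exists W, forall x, K x -> weight x ^+ N <= W.
  have cm : continuous (fun x : 'rV[R]_n => (weight x ^+ N)%:C : R[i]^o).
    apply/continuous_complexP; split; last exact: cst_continuous.
    elim: N {uC} => [|k IH].
      by rewrite (_ : (fun _ => _) = fun=> 1)//; exact: cst_continuous.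
    rewrite (_ : (fun _ => _) = fun x : 'rV[R]_n => weight x * weight x ^+ k).
      by apply: continuous_mul => //; exact: continuous_weight.
    by apply/funext => x; rewrite exprS.
  have [W HW] := continuous_compact_bounded cm cK.
  by exists W => x /HW; rewrite normc_real; apply: le_trans; exact: ler_norm.
exists (C * `|W|), N => {}phi phiK; rewrite -mulrA; apply: uC.
rewrite to_schwartz_testfun; apply/sboundP => s sN x.
have [Kx|nKx] := pselect (closure [set x | phi x != 0] x); last first.
  by rewrite testfun_vanish// normc0 mulr0 mulr_ge0// test_norm_ge0.
apply: ler_pM; [exact/ltW/weightX_gt0|exact: normc_ge0| |].
  exact: le_trans (HW x (phiK _ Kx)) (ler_norm _).
have /asboolP[sphi _] := valP phi.
apply: ub_le_sup; first exact: test_values_ub.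
exists (mcount s); rewrite mabs_mcount; split => //; exists x; first exact: phiK.
by rewrite -dlist_mderiv.
Qed.

Lemma tdist_distr_linear : linear (@tdist_distr R n).
Proof.
move=> c u v; apply: distr_eqP => phi; rewrite [LHS]tdist_distrE.
by rewrite [LHS]tdist_linE [RHS]distr_linE !tdist_distrE.
Qed.

End TestFunctions.

(** * Symbol classes as bounds in terms of the weight *)

Section Blocks.
Context {R : realType} {n : nat}.

(** A partial derivative in either block of R^n x R^n is one in R^n; the block
    that does not move is given the factor 0. *)
Definition fold_index (j : 'I_(n + n)) : 'I_n :=
  match fintype.split j with inl i => i | inr i => i end.
Definition left_index (j : 'I_(n + n)) : R :=
  match fintype.split j with inl _ => 1 | inr _ => 0 end.
Definition right_index (j : 'I_(n + n)) : R :=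
  match fintype.split j with inl _ => 0 | inr _ => 1 end.

Lemma split_lshift (i : 'I_n) : fintype.split (lshift n i) = inl i.
Proof. exact: (unsplitK (inl i)). Qed.

Lemma split_rshift (i : 'I_n) : fintype.split (rshift n i) = inr i.
Proof. exact: (unsplitK (inr i)). Qed.

Lemma lsubmx_line (z : 'rV[R]_(n + n)) j h :
  lsubmx (z + h *: delta_mx 0 j) =
  lsubmx z + (h * left_index j) *: delta_mx 0 (fold_index j).
Proof.
apply/rowP => k; rewrite !mxE eqxx /= /left_index /fold_index.
case: (split_ordP j) => i ->; rewrite ?split_lshift ?split_rshift.
  by rewrite (inj_eq (@lshift_inj _ _)) mulr1.
by rewrite eq_lrshift mulr0n !mulr0 mul0r.
Qed.

Lemma rsubmx_line (z : 'rV[R]_(n + n)) j h :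
  rsubmx (z + h *: delta_mx 0 j) =
  rsubmx z + (h * right_index j) *: delta_mx 0 (fold_index j).
Proof.
apply/rowP => k; rewrite !mxE eqxx /= /right_index /fold_index.
case: (split_ordP j) => i ->; rewrite ?split_lshift ?split_rshift.
  by rewrite eq_rlshift mulr0n !mulr0 mul0r.
by rewrite (inj_eq (@rshift_inj _ _)) mulr1.
Qed.

Lemma left_index_le1 j : `|left_index j| <= 1.
Proof. by rewrite /left_index; case: fintype.split => _; rewrite ?normr1 ?normr0 ?ler01. Qed.

Lemma right_index_le1 j : `|right_index j| <= 1.
Proof. by rewrite /right_index; case: fintype.split => _; rewrite ?normr1 ?normr0 ?ler01. Qed.

Lemma row_mx_linel (y x : 'rV[R]_n) j (h : R) :
  row_mx (x + h *: delta_mx 0 j) y = row_mx x y + (h * 1) *: delta_mx 0 (lshift n j).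
Proof.
apply/rowP => k; case: (split_ordP k) => i ->; rewrite !(row_mxEl, row_mxEr, mxE) ?eqxx /=.
  by rewrite (inj_eq (@lshift_inj _ _)) mulr1.
by rewrite eq_rlshift mulr0n mulr0 addr0.
Qed.

Lemma row_mx_liner (x y : 'rV[R]_n) j (h : R) :
  row_mx x (y + h *: delta_mx 0 j) = row_mx x y + (h * 1) *: delta_mx 0 (rshift n j).
Proof.
apply/rowP => k; case: (split_ordP k) => i ->; rewrite !(row_mxEl, row_mxEr, mxE) ?eqxx /=.
  by rewrite eq_lrshift mulr0n mulr0 addr0.
by rewrite (inj_eq (@rshift_inj _ _)) mulr1.
Qed.

End Blocks.

Lemma continuous_row_mx (R : realType) n m {T : topologicalType} (u : T -> 'rV[R]_n) (v : T -> 'rV[R]_m) :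
  continuous u -> continuous v -> continuous (fun t => row_mx (u t) (v t)).
Proof.
move=> cu cv; apply: continuous_into_row => i; case: (split_ordP i) => j ->.
  under eq_fun do rewrite row_mxEl; exact: continuous_compose cu (@continuous_coord R n j).
under eq_fun do rewrite row_mxEr; exact: continuous_compose cv (@continuous_coord R m j).
Qed.

Section SymbolBounds.
Context {R : realType} {n : nat}.
Implicit Types (b : symbol R n).

Lemma eucl_norm_ge0 (x : 'rV[R]_n) : 0 <= eucl_norm x.
Proof. exact: sqrtr_ge0. Qed.

Lemma eucl_normE (x : 'rV[R]_n) : eucl_norm x ^+ 2 = \sum_i x 0 i ^+ 2.
Proof.
rewrite /eucl_norm sqr_sqrtr; last by apply: sumr_ge0 => i _; rewrite -expr2 sqr_ge0.
by apply: eq_bigr => i _; rewrite expr2.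
Qed.

(** Together with [eucl_le_weight] this shows that powers of the weight and of
    1 + |eta| define the same classes of rapidly decreasing symbols. *)
Lemma weight_le_eucl (x : 'rV[R]_n) : weight x <= (1 + eucl_norm x) ^+ (2 * n).
Proof.
rewrite exprM -[X in _ ^+ X](card_ord n) -prodr_const; apply: ler_prod => i _.
rewrite addr_ge0 ?sqr_ge0//= sqrrD expr1n mul1r.
have : x 0 i ^+ 2 <= eucl_norm x ^+ 2.
  by rewrite eucl_normE (bigD1 i)//= lerDl sumr_ge0// => j _; exact: sqr_ge0.
have := eucl_norm_ge0 x; lra.
Qed.

Lemma sum_sqr_le_weight (x : 'rV[R]_n) : 1 + \sum_i x 0 i ^+ 2 <= weight x.
Proof.
rewrite /weight; elim: (index_enum _) => [|i r IH]; first by rewrite !big_nil addr0.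
rewrite !big_cons; set S := \sum_(j <- r) _ in IH *.
have S0 : 0 <= S by apply: sumr_ge0 => j _; exact: sqr_ge0.
apply: le_trans (ler_wpM2l _ IH); last by rewrite addr_ge0// sqr_ge0.
have := sqr_ge0 (x 0 i); nra.
Qed.

Lemma eucl_le_weight (x : 'rV[R]_n) : 1 + eucl_norm x <= 2 * weight x.
Proof.
have := sum_sqr_le_weight x; rewrite -eucl_normE.
have := eucl_norm_ge0 x; set t := eucl_norm x; nra.
Qed.

Lemma symbol_deriv_dlist al be b : exists2 s,
  (size s = mabs al + mabs be)%N & symbol_deriv al be b = dlist s b.
Proof.
rewrite /symbol_deriv mderiv_dlist; eexists; last reflexivity.
rewrite size_mlist /mabs big_split_ord /= addnC; congr (_ + _)%N.
  by apply: eq_bigr => i _; rewrite ffunE split_rshift.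
by apply: eq_bigr => i _; rewrite ffunE split_lshift.
Qed.

Lemma dlist_symbol_deriv s b : smooth b -> exists al be,
  (mabs al + mabs be = size s)%N /\ dlist s b = symbol_deriv al be b.
Proof.
move=> sb.
exists [ffun i => mcount s (rshift n i)], [ffun i => mcount s (lshift n i)].
split; last first.
  rewrite dlist_mderiv// /symbol_deriv; congr mderiv; apply/ffunP => k; rewrite !ffunE.
  by case: (split_ordP k) => i ->; rewrite ?split_lshift ?split_rshift !ffunE.
rewrite -mabs_mcount /mabs big_split_ord /= addnC; congr (_ + _)%N.
  by apply: eq_bigr => i _; rewrite ffunE.
by apply: eq_bigr => i _; rewrite ffunE.
Qed.

(** Finitely many derivatives have order at most k, so their constants can be
    replaced by one. *)
Lemma symbol_derivs_bounded k (w : 'rV[R]_n -> R) b : smooth b ->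
  (forall eta, 0 <= w eta) ->
  (forall al be, (mabs al + mabs be <= k)%N -> exists C, forall x eta,
     normc (symbol_deriv al be b (row_mx x eta)) <= C * w eta) ->
  exists2 C, 0 <= C & derivs_bounded k (fun z => C * w (rsubmx z)) b.
Proof.
move=> sb w0 H.
have {}H (ga : multiindex (n + n)) : exists C, (mabs ga <= k)%N ->
    forall z, normc (mderiv ga b z) <= C * w (rsubmx z).
  have [gk|//] := leqP (mabs ga) k; last by exists 0.
  have [al [be [abk E]]] := dlist_symbol_deriv (mlist ga) sb.
  have [|C HC] := H al be; first by rewrite abk size_mlist.
  by exists C => _ z; rewrite mderiv_dlist E -{1}[z]hsubmxK.
pose F ga := projT1 (cid (H ga)).
have HF ga := projT2 (cid (H ga)).
have [M HM] := multiindex_bound k F.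
exists `|M| => // s sk z; rewrite dlist_mderiv//.
have gk : (mabs (mcount s) <= k)%N by rewrite mabs_mcount.
apply: le_trans (HF _ gk z) _; apply: ler_wpM2r => //.
exact: le_trans (HM _ gk) (ler_norm _).
Qed.

Definition symbol_rapid b : Prop := smooth b /\ forall k, exists B,
  derivs_bounded k (fun z => B / weight (rsubmx z) ^+ k) b.

Lemma weightX_invle (x : 'rV[R]_n) k l : (k <= l)%N ->
  (weight x ^+ l)^-1 <= (weight x ^+ k)^-1.
Proof.
move=> kl; rewrite lef_pV2 ?posrE ?weightX_gt0//.
by rewrite ler_weXn2l.
Qed.

Lemma symbol_rapidW b k M : symbol_rapid b -> exists2 B, 0 <= B &
  derivs_bounded k (fun z => B / weight (rsubmx z) ^+ M) b.
Proof.
move=> [sb /(_ (maxn k M))[B HB]]; exists `|B| => //.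
apply: derivs_bounded_leq (leq_maxl k M) _.
apply: derivs_bounded_le HB => z; apply: le_trans (ler_wpM2r _ (ler_norm B)) _.
  by rewrite invr_ge0 exprn_ge0.
by rewrite ler_wpM2l// weightX_invle// leq_maxr.
Qed.

Lemma S_minus_inftyP b : S_minus_infty b <-> symbol_rapid b.
Proof.
split=> -[sb H]; split=> //.
  move=> k.
  have [|al be _|C C0 HC] := @symbol_derivs_bounded k (fun eta => (weight eta ^+ k)^-1) b sb.
  - by move=> eta; rewrite invr_ge0 exprn_ge0.
  - have [C HC] := H al be (2 * n * k)%N; exists `|C| => x eta.
    apply: le_trans (HC x eta) _; apply: le_trans (ler_wpM2r _ (ler_norm C)) _.
      by rewrite invr_ge0 exprn_ge0// addr_ge0// eucl_norm_ge0.
    apply: ler_wpM2l => //.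
    rewrite lef_pV2 ?posrE ?weightX_gt0 ?exprn_gt0 ?ltr_wpDr ?eucl_norm_ge0//.
    by rewrite [in leRHS]exprM lerXn2r ?nnegrE ?exprn_ge0 ?addr_ge0 ?eucl_norm_ge0// weight_le_eucl.
  by exists C.
move=> al be N; have [s sE ->] := symbol_deriv_dlist al be b.
have [B B0 HB] := symbol_rapidW (size s) N (conj sb H).
exists (B * 2 ^+ N) => x eta; apply: le_trans (HB s (leqnn _) _) _.
rewrite row_mxKr -mulrA ler_wpM2l// ler_pdivlMr ?exprn_gt0 ?ltr_wpDr ?eucl_norm_ge0//.
rewrite mulrC ler_pdivrMr ?weightX_gt0// -exprMn lerXn2r ?nnegrE ?addr_ge0 ?eucl_norm_ge0//.
  by rewrite mulr_ge0.
exact: eucl_le_weight.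
Qed.

(** Of order 0: the decay beats the negative exponent -|alpha|. *)
Lemma S_minus_infty_S11 b : S_minus_infty b -> S11_infty b.
Proof.
move=> [sb H]; exists 0; split=> // al be.
have [C HC] := H al be (mabs al); exists `|C| => x eta.
apply: le_trans (HC x eta) _; have e1 : 1 <= 1 + eucl_norm eta by rewrite lerDl eucl_norm_ge0.
have e0 : 0 < 1 + eucl_norm eta by exact: lt_le_trans e1.
apply: le_trans (ler_wpM2r _ (ler_norm C)) _; first by rewrite invr_ge0 exprn_ge0// ltW.
apply: ler_wpM2l => //.
rewrite -(powR_invn (mabs al) (ltW e0)); apply: (ler_powR e1).
by rewrite add0r lerDl.
Qed.

Lemma S11_moderate b : S11_infty b -> smooth b /\ forall k, exists C M,
  derivs_bounded k (fun z => C * weight (rsubmx z) ^+ M) b.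
Proof.
move=> [d [sb H]]; split=> // k.
pose M := (Num.truncn (`|d| + k%:R : R)).+1.
have [|al be abk|C C0 HC] := @symbol_derivs_bounded k (fun eta => (2 * weight eta) ^+ M) b sb.
- by move=> eta; rewrite exprn_ge0// mulr_ge0.
- have [C HC] := H al be; exists `|C| => x eta.
  apply: le_trans (HC x eta) _.
  have e1 : 1 <= 1 + eucl_norm eta by rewrite lerDl eucl_norm_ge0.
  have e0 : 0 < 1 + eucl_norm eta by exact: lt_le_trans e1.
  apply: le_trans (ler_wpM2r _ (ler_norm C)) _; first exact: powR_ge0.
  rewrite ler_wpM2l//.
  apply: le_trans (_ : (1 + eucl_norm eta) ^+ M <= _); last first.
    apply: lerXn2r; last exact: eucl_le_weight.
      by rewrite nnegrE ltW.
    by rewrite nnegrE mulr_ge0.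
  rewrite -(powR_mulrn M (ltW e0)); apply: (ler_powR e1); rewrite /M.
  have := truncnS_gt (`|d| + k%:R); rewrite -/M => /ltW h; apply: le_trans h.
  rewrite -addrA lerD ?ler_norm//.
  have bek : (mabs be)%:R <= k%:R :> R by rewrite ler_nat (leq_trans _ abk)// leq_addl.
  by rewrite addrC (le_trans _ bek)// gerDl oppr_le0.
exists (C * 2 ^+ M), M; apply: derivs_bounded_le HC => z.
by rewrite exprMn mulrA.
Qed.

End SymbolBounds.

(** * The transpose of OP(b) for b of order minus infinity *)

Section SymbolProducts.
Context {R : realType} {n : nat}.
Implicit Types (b h : symbol R n) (f phi : 'rV[R]_n -> R[i]^o).

Definition eta_moderate h : Prop := smooth h /\ forall k, exists C M,
  derivs_bounded k (fun z => C * weight (rsubmx z) ^+ M) h.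

Lemma symbol_rapid_moderate b : symbol_rapid b -> eta_moderate b.
Proof.
move=> rb; have [sb _] := rb; split=> // k.
have [B _ HB] := symbol_rapidW k 0 rb; exists B, 0%N.
by apply: derivs_bounded_le HB => z; rewrite expr0 divr1 mulr1.
Qed.

(** Moderate growth in eta is absorbed by decay of a higher order. *)
Lemma symbol_rapid_mul h b : eta_moderate h -> symbol_rapid b ->
  symbol_rapid (fun z => h z * b z).
Proof.
move=> [sh mh] rb; have [sb _] := rb; split; first exact: smooth_mul.
move=> k; have [C [M HC]] := mh k; have [B B0 HB] := symbol_rapidW k (M + k) rb.
exists (2 ^+ k * (C * B)).
apply: derivs_bounded_le (derivs_bounded_mul sh sb HC HB) => z.
have w0 := lt0r_neq0 (weightX_gt0 M (rsubmx z)).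
have w1 := lt0r_neq0 (weightX_gt0 k (rsubmx z)).
rewrite exprD; move: (weight _ ^+ M) (weight _ ^+ k) w0 w1 => W w w0 w1.
by rewrite le_eqVlt; apply/orP; left; apply/eqP; field; rewrite w0 w1.
Qed.

Lemma derivs_bounded_rsubmx k (w : 'rV[R]_n -> R) f : smooth f -> derivs_bounded k w f ->
  derivs_bounded k (fun z : 'rV[R]_(n + n) => w (rsubmx z)) (fun z => f (rsubmx z)).
Proof.
move=> sf Hf.
exact: (@derivs_bounded_comp_line R (n + n) n (fun z => rsubmx z) fold_index right_index
  rsubmx_line (@continuous_rsubmx _ 1 n n) k w f sf right_index_le1 Hf).
Qed.

Lemma derivs_bounded_lsubmx k (w : 'rV[R]_n -> R) f : smooth f -> derivs_bounded k w f ->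
  derivs_bounded k (fun z : 'rV[R]_(n + n) => w (lsubmx z)) (fun z => f (lsubmx z)).
Proof.
move=> sf Hf.
exact: (@derivs_bounded_comp_line R (n + n) n (fun z => lsubmx z) fold_index left_index
  lsubmx_line (@continuous_lsubmx _ 1 n n) k w f sf left_index_le1 Hf).
Qed.

Lemma smooth_rsubmx f : smooth f -> smooth (fun z : 'rV[R]_(n + n) => f (rsubmx z)).
Proof. exact: (smooth_comp_line rsubmx_line (@continuous_rsubmx _ 1 n n)). Qed.

Lemma smooth_lsubmx f : smooth f -> smooth (fun z : 'rV[R]_(n + n) => f (lsubmx z)).
Proof. exact: (smooth_comp_line lsubmx_line (@continuous_lsubmx _ 1 n n)). Qed.

Lemma rapid_symbol f : rapid f -> symbol_rapid (fun z : 'rV[R]_(n + n) => f (rsubmx z)).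
Proof.
move=> [sf bf]; split; first exact: smooth_rsubmx.
by move=> k; have [B HB] := bf k; exists B; exact: (derivs_bounded_rsubmx sf HB).
Qed.

Definition phase : symbol R n := fun z => expi (dotp (lsubmx z) (rsubmx z)).

Lemma continuous_phase : continuous phase.
Proof.
apply: continuous_expi; apply: continuous_dotp2; [exact: (@continuous_lsubmx _ 1)|exact: (@continuous_rsubmx _ 1)].
Qed.

(** The derivatives of x.eta are the coordinates of the other block. *)
Lemma moderate_phase2 : moderate phase.
Proof.
pose sw (j : 'I_(n + n)) := match fintype.split j with
  inl i => rshift n i | inr i => lshift n i end.
apply: (moderate_exponential (c := fun j z => 'i * coordinate (sw j) z)).
- exact: continuous_phase.
- by move=> z; rewrite normc_expi.
- by move=> j; apply: moderate_mul; [exact: moderate_cst|exact: moderate_coord].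
move=> j; apply: (@partial_expi R _ _ (fun j z => z 0 (sw j))) => z s.
rewrite lsubmx_line rsubmx_line /left_index /right_index /fold_index /sw.
case: (split_ordP j) => i _; rewrite mulr1 mulr0 scale0r addr0.
  by rewrite dotpC dotp_line dotpC mxE.
by rewrite dotp_line mxE.
Qed.

End SymbolProducts.

Section Pairing.
Context {R : realType} {n : nat}.
Implicit Types (b : symbol R n) (f phi : 'rV[R]_n -> R[i]^o).

Definition pairing_density b phi : symbol R n :=
  fun z => phase z * (b z * phi (lsubmx z)).

(** The operator P_b whose transpose is OP(b), as a restriction of a Fourier
    transform in 2n variables. *)
Definition pairing b phi : 'rV[R]_n -> R[i]^o :=
  fun y => ((2 * pi) ^- n)%:C * ft (-1) (pairing_density b phi) (row_mx 0 y).

Lemma pairing_density_sbound N : exists K C, forall b B phi D,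
  smooth b -> derivs_bounded K (fun z => B / weight (rsubmx z) ^+ K) b ->
  smooth phi -> sbound K D phi -> sbound N (C * (B * D)) (pairing_density b phi).
Proof.
have [sE mE] := @moderate_phase2 R n; have [C [M HC]] := mE N.
exists (M + N)%N, (2 ^+ N * C * 2 ^+ (M + N)) => b B phi D sb HB sphi HD.
have sl := smooth_lsubmx sphi.
have HS : sbound (M + N) (2 ^+ (M + N) * (B * D)) (fun z => b z * phi (lsubmx z)).
  have := derivs_bounded_mul sb sl HB (derivs_bounded_lsubmx sphi HD).
  apply: derivs_bounded_le => z; rewrite weight_split exprMn.
  have w0 := lt0r_neq0 (weightX_gt0 (M + N) (lsubmx z)).
  have w1 := lt0r_neq0 (weightX_gt0 (M + N) (rsubmx z)).
  move: (weight _ ^+ _) (weight _ ^+ _) w0 w1 => W w w0 w1.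
  by rewrite le_eqVlt; apply/orP; left; apply/eqP; field; rewrite w0 w1.
have := sbound_mul sE (smooth_mul sb sl) HC HS.
by rewrite [_ * (2 ^+ (M + N) * _)]mulrA.
Qed.

Lemma smooth_pairing_density b phi : smooth b -> smooth phi ->
  smooth (pairing_density b phi).
Proof.
move=> sb sphi; have [sE _] := @moderate_phase2 R n.
by apply: smooth_mul => //; apply: smooth_mul => //; exact: smooth_lsubmx.
Qed.

Lemma rapid_pairing_density b phi : symbol_rapid b -> rapid phi ->
  rapid (pairing_density b phi).
Proof.
move=> [sb bb] [sphi bphi]; split; first exact: smooth_pairing_density.
move=> N; have [K [C H]] := pairing_density_sbound N.
have [B HB] := bb K; have [D HD] := bphi K.
by exists (C * (B * D)); exact: H.
Qed.

Lemma smooth_row_mxr (F : symbol R n) : smooth F -> smooth (fun y => F (row_mx 0 y)).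
Proof.
have cL : continuous (fun y : 'rV[R]_n => row_mx (0 : 'rV[R]_n) y).
  by apply: continuous_row_mx => y; [exact: cst_continuous|exact: cvg_id].
exact: (smooth_comp_line (@row_mx_liner R n 0) cL).
Qed.

Lemma sbound_row_mxr N B (F : symbol R n) : smooth F -> sbound N B F ->
  sbound N B (fun y => F (row_mx 0 y)).
Proof.
move=> sF HF.
have cL : continuous (fun y : 'rV[R]_n => row_mx (0 : 'rV[R]_n) y).
  by apply: continuous_row_mx => y; [exact: cst_continuous|exact: cvg_id].
have a1 (j : 'I_n) : `|1 : R| <= 1 by rewrite normr1.
have := derivs_bounded_comp_line (@row_mx_liner R n 0) cL sF a1 HF.
apply: derivs_bounded_le => y; rewrite weight_row_mx.
rewrite (_ : weight (0 : 'rV[R]_n) = 1) ?mul1r//.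
by rewrite /weight big1// => i _; rewrite mxE expr0n addr0.
Qed.

Lemma normc_const_le1 : normc (((2 * pi) ^- n)%:C : R[i]) <= 1.
Proof.
rewrite normc_real ger0_norm ?invr_ge0 ?exprn_ge0 ?mulr_ge0 ?pi_ge0//.
rewrite invf_le1 ?exprn_gt0 ?mulr_gt0 ?pi_gt0//; apply: exprn_ege1.
have := @pi_ge2 R; lra.
Qed.

Lemma sqrN1 : (-1) ^+ 2 = 1 :> R.
Proof. by rewrite sqrrN expr1n. Qed.

(** The bound is a product of one seminorm of b and one of phi; its linearity in b
    is what turns convergence of symbols into convergence of operators. *)
Lemma pairing_sbound N : exists K C, 0 <= C /\ forall b B phi D,
  symbol_rapid b -> derivs_bounded K (fun z => B / weight (rsubmx z) ^+ K) b ->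
  rapid phi -> sbound K D phi -> sbound N (C * (B * D)) (pairing b phi).
Proof.
have [K [C H]] := pairing_density_sbound ((n + n) * (2 * N) + N).+1.
exists K, (ft_const (n := n + n) N * `|C|); split.
  by rewrite mulr_ge0// ft_const_ge0.
move=> b B phi D rb HB rphi HD.
have rF := rapid_pairing_density rb rphi.
have [sF _] := ft_rapid sqrN1 rF.
apply: sbound_scale; [exact: smooth_row_mxr|exact: normc_const_le1|].
apply: sbound_row_mxr => //; rewrite -mulrA; apply: ft_sbound => //; first exact: sqrN1.
have BD0 : 0 <= B * D.
  apply: mulr_ge0; last exact: sbound_ge0 HD.
  have := derivs_bounded_ge0 0 HB; rewrite pmulr_lge0// invr_gt0; exact: weightX_gt0.
have := H b B phi D rb.1 HB rphi.1 HD; apply: derivs_bounded_le => z.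
rewrite ler_wpM2r ?invr_ge0 ?exprn_ge0//.
by rewrite ler_wpM2r// ler_norm.
Qed.

Lemma pairing_operator b : symbol_rapid b -> rapid_operator (pairing b).
Proof.
move=> rb; split.
- move=> f rf; split.
    apply: smooth_scale; apply: smooth_row_mxr => //.
    by have [] := ft_rapid sqrN1 (rapid_pairing_density rb rf).
  move=> N; have [K [C [_ H]]] := pairing_sbound N.
  have [B HB] := rb.2 K; have [D HD] := rf.2 K.
  by exists (C * (B * D)); exact: H.
- move=> c f g rf rg; apply/funext => y.
  have E : pairing_density b (c *: f + g) =
      c *: (pairing_density b f : 'rV[R]_(n + n) -> R[i]^o) + pairing_density b g.
    apply/funext => z; rewrite /pairing_density.
    rewrite -[RHS]/(c * (phase z * (b z * f (lsubmx z))) + phase z * (b z * g (lsubmx z))).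
    rewrite -[(c *: f + g) _]/(c * f (lsubmx z) + g (lsubmx z)).
    move: (phase z) (b z) (f _) (g _) => p q r s.
    by rewrite (mulrDr q) (mulrDr p) (mulrCA q c r) (mulrCA p c).
  have [_ lft _] := @rapid_operator_ft R (n + n) (-1) sqrN1.
  rewrite /pairing E lft; [|exact: rapid_pairing_density..].
  rewrite -[RHS]/(c * _ + _) -[X in _ * X]/(c * _ + _).
  move: (ft _ _ _) (ft _ _ _) (_ ^- n)%:C => p q d.
  by rewrite (mulrDr d) (mulrCA d c).
move=> N; have [K [C [_ H]]] := pairing_sbound N.
have [B HB] := rb.2 K; exists K, (C * B) => D f rf HD.
by rewrite -mulrA; exact: H.
Qed.

Lemma pairing_linl (c : R[i]) b b' phi : symbol_rapid b -> symbol_rapid b' -> rapid phi ->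
  pairing (fun z => c * b z + b' z) phi = c *: pairing b phi + pairing b' phi.
Proof.
move=> rb rb' rf; apply/funext => y.
have E : pairing_density (fun z => c * b z + b' z) phi =
    c *: (pairing_density b phi : 'rV[R]_(n + n) -> R[i]^o) + pairing_density b' phi.
  apply/funext => z; rewrite /pairing_density.
  rewrite -[RHS]/(c * (phase z * (b z * phi (lsubmx z))) + phase z * (b' z * phi (lsubmx z))).
  move: (phase z) (b z) (b' z) (phi _) => p q q' r.
  by rewrite (mulrDl _ _ r) (mulrDr p) -(mulrA c) (mulrCA p c).
have [_ lft _] := @rapid_operator_ft R (n + n) (-1) sqrN1.
rewrite /pairing E lft; [|exact: rapid_pairing_density..].
rewrite -[RHS]/(c * _ + _) -[X in _ * X]/(c * _ + _).
move: (ft _ _ _) (ft _ _ _) (_ ^- n)%:C => p q d.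
by rewrite (mulrDr d) (mulrCA d c).
Qed.

End Pairing.

(** * Agreement with OP(b) on Schwartz functions *)

Section PhaseIntegral.
Context {R : realType} {n : nat}.
Implicit Types (b q : symbol R n).

Let partially_rapid q : Prop := smooth q /\ forall k K, exists C M,
  derivs_bounded k (fun z => C * weight (lsubmx z) ^+ M / weight (rsubmx z) ^+ K) q.

Let partially_rapid_partial q j : partially_rapid q -> partially_rapid (partial j q).
Proof.
move=> [sq bq]; split; first exact: smooth_partial.
move=> k K; have [C [M HC]] := bq k.+1 K; exists C, M.
exact: derivs_bounded_partial.
Qed.

Let partially_rapid_phase b : symbol_rapid b -> partially_rapid (fun z => phase z * b z).
Proof.
move=> rb; have [sE mE] := @moderate_phase2 R n; have [sb _] := rb.
split; first exact: smooth_mul.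
(* The M extra orders of decay compensate the growth of the phase in eta. *)
move=> k K; have [C [M HC]] := mE k; have [B B0 HB] := symbol_rapidW k (M + K) rb.
exists (2 ^+ k * (C * B)), M.
apply: derivs_bounded_le (derivs_bounded_mul sE sb HC HB) => z.
rewrite weight_split exprMn exprD.
have w0 := lt0r_neq0 (weightX_gt0 M (rsubmx z)).
have w1 := lt0r_neq0 (weightX_gt0 K (rsubmx z)).
move: (weight (rsubmx z) ^+ M) (weight (rsubmx z) ^+ K) (weight _ ^+ M) w0 w1 => W w v w0 w1.
by rewrite le_eqVlt; apply/orP; left; apply/eqP; field; rewrite w0 w1.
Qed.

Lemma continuous_row_mxl (eta : 'rV[R]_n) : continuous (fun x : 'rV[R]_n => row_mx x eta).
Proof. by apply: continuous_row_mx => x; [exact: cvg_id|exact: cst_continuous]. Qed.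

Lemma continuous_row_mxr (x : 'rV[R]_n) : continuous (fun eta : 'rV[R]_n => row_mx x eta).
Proof. by apply: continuous_row_mx => y; [exact: cst_continuous|exact: cvg_id]. Qed.

Lemma weight_bounded (r : R) (z : 'rV[R]_n) : (forall k, `|z 0 k| <= r) ->
  weight z <= (1 + r ^+ 2) ^+ n.
Proof.
move=> zr; rewrite -[X in _ ^+ X](card_ord n) -prodr_const; apply: ler_prod => i _.
rewrite addr_ge0 ?sqr_ge0//= lerD2l -[X in X <= _]real_normK ?num_real//.
by rewrite lerXn2r ?nnegrE// (le_trans _ (zr i)).
Qed.

(** Continuity in x comes from the parametric integral: derivatives in x
    produce powers of eta, which the decay of b absorbs. *)
Lemma tempered_phase_integral b : symbol_rapid b ->
  tempered (fun x => cintegral (fun eta => phase (row_mx x eta) * b (row_mx x eta))).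
Proof.
move=> rb; split.
  pose I := {q : symbol R n | partially_rapid q}.
  pose g (i : I) (x eta : 'rV[R]_n) : R[i]^o := proj1_sig i (row_mx x eta).
  pose D j (i : I) : I := exist _ (partial (lshift n j) (proj1_sig i))
    (partially_rapid_partial (lshift n j) (proj2_sig i)).
  have g1 i j eta : partial_derivable j (fun x => g i x eta) /\
      partial j (fun x => g i x eta) = (fun x => g (D j i) x eta).
    have [sq _] := proj2_sig i.
    have [d dE] := partial_comp_line (row_mx_linel eta) (smooth_derivable (lshift n j) sq).
    split; first exact: d.
    by rewrite [LHS]dE; apply/funext => x; rewrite mul1r.
  have g2 i x : continuous (g i x).
    have [sq _] := proj2_sig i.
    exact: (continuous_compose (f := proj1_sig i) (@continuous_row_mxr x) (smooth_continuous sq)).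
  have g3 i (r : R) : exists C, forall x : 'rV[R]_n, (forall k, `|x 0 k| <= r) ->
      forall eta, normc (g i x eta) <= C / weight eta.
    have [_ bq] := proj2_sig i; have [C [M HC]] := bq 0%N 1%N.
    exists (`|C| * ((1 + r ^+ 2) ^+ n) ^+ M) => x xr eta.
    apply: le_trans (HC [::] isT _) _; rewrite row_mxKl row_mxKr expr1.
    rewrite ler_wpM2r ?invr_ge0//; apply: le_trans (ler_wpM2r _ (ler_norm C)) _.
      exact/ltW/weightX_gt0.
    rewrite ler_wpM2l//; apply: lerXn2r; rewrite ?nnegrE//.
      by rewrite exprn_ge0// addr_ge0// sqr_ge0.
    exact: weight_bounded.
  exact: (@parametric_continuous _ _ _ _ g D g1 g2 g3 (exist _ _ (partially_rapid_phase rb))).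
have [B B0 HB] := symbol_rapidW 0 1 rb.
exists (2 * B * pi ^+ n), 0%N => x; rewrite expr0 mulr1.
apply: cintegral_bound; split.
  apply: continuousM_complex.
    exact: continuous_compose (@continuous_row_mxr x) (@continuous_phase R n).
  exact: continuous_compose (@continuous_row_mxr x) (smooth_continuous rb.1).
move=> eta; rewrite normcM normc_expi mul1r.
by have := HB [::] isT (row_mx x eta); rewrite row_mxKr expr1.
Qed.

Lemma rapid_fourier (f : 'rV[R]_n -> R[i]^o) : rapid f -> rapid (fourier f).
Proof. by case: (@rapid_operator_fourier R n) => + _ _; exact. Qed.

Lemma OP_schwartzE b (u : schwartz R n) : OP_schwartz b u = fun x => ((2 * pi) ^- n)%:C *
  cintegral (fun eta => phase (row_mx x eta) *
    (b (row_mx x eta) * fourier u (rsubmx (row_mx x eta)))).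
Proof.
apply/funext => x; rewrite /OP_schwartz; congr (_ * _); apply: eq_cintegral => eta.
by rewrite /phase row_mxKl row_mxKr mulrA.
Qed.

Lemma symbol_rapid_fourier b f : symbol_rapid b -> rapid f ->
  symbol_rapid (fun z => b z * fourier f (rsubmx z)).
Proof.
move=> rb rf; apply: symbol_rapid_mul; first exact: symbol_rapid_moderate.
exact/rapid_symbol/rapid_fourier.
Qed.

Lemma tempered_scale (c : R[i]^o) (f : 'rV[R]_n -> R[i]^o) : tempered f ->
  tempered (fun x => c * f x).
Proof.
move=> [cf [C [M HC]]]; split.
  by apply: (continuousM_complex _ cf); exact: cst_continuous.
exists (normc c * C), M => x; by rewrite normcM -mulrA ler_wpM2l ?normc_ge0//.
Qed.

Lemma tempered_OP_schwartz b (u : schwartz R n) : symbol_rapid b ->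
  tempered (OP_schwartz b u).
Proof.
move=> rb; rewrite OP_schwartzE; apply: tempered_scale.
apply: (@tempered_phase_integral (fun z => b z * fourier u (rsubmx z))).
by apply: symbol_rapid_fourier => //; exact: schwartz_rapid.
Qed.

Lemma rapid_tempered (f : 'rV[R]_n -> R[i]^o) : rapid f -> tempered f.
Proof.
move=> rf; split; first exact: rapid_continuous.
have [C dC] := rapid_cdominated rf; exists C, 0%N => x; rewrite expr0 mulr1.
exact: cdominated_le.
Qed.

Lemma dotp_row_mx0 (z : 'rV[R]_(n + n)) (y : 'rV[R]_n) :
  dotp z (row_mx 0 y) = dotp (rsubmx z) y.
Proof.
rewrite -{1}[z]hsubmxK dotp_row_mx (_ : dotp _ 0 = 0) ?add0r//.
by rewrite /dotp big1// => i _; rewrite [X in _ * X]mxE mulr0.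
Qed.

(** Both sides are the integral over (x, eta, y) of
    u(y) e^{i (x - y).eta} b(x,eta) phi(x). *)
Lemma pairing_fubini b (u phi : 'rV[R]_n -> R[i]^o) : symbol_rapid b -> rapid u -> rapid phi ->
  cintegral (fun y => u y * ft (-1) (pairing_density b phi) (row_mx 0 y)) =
  cintegral (fun x => cintegral (fun eta => phase (row_mx x eta) *
    (b (row_mx x eta) * fourier u (rsubmx (row_mx x eta)))) * phi x).
Proof.
move=> rb ru rphi; set G := pairing_density b phi.
have rG : rapid G by exact: rapid_pairing_density.
have [Cg [cG HG]] := rapid_cdominated rG; have [Cu [cu Hu]] := rapid_cdominated ru.
pose E (z : 'rV[R]_(n + n)) (y : 'rV[R]_n) : R[i]^o := expi (-1 * dotp z (row_mx 0 y)).
pose F (w : 'rV[R]_((n + n) + n)) : R[i]^o :=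
  E (lsubmx w) (rsubmx w) * (G (lsubmx w) * u (rsubmx w)).
have cl := @continuous_lsubmx R 1 (n + n) n.
have cr := @continuous_rsubmx R 1 (n + n) n.
have dF : cdominated (Cg * Cu) F.
  split.
    apply: continuousM_complex.
      apply: continuous_expi; apply: continuous_mul; first exact: continuous_cst.
      have cz : continuous (fun _ : 'rV[R]_((n + n) + n) => 0 : 'rV[R]_n).
        by move=> w; exact: cst_continuous.
      exact: (continuous_dotp2 cl (continuous_row_mx cz cr)).
    apply: continuousM_complex; [exact: continuous_compose cl cG|exact: continuous_compose cr cu].
  move=> w; rewrite /F /E normcM (normcM (G _)) normc_expi mul1r weight_split invfM mulrACA.
  by apply: ler_pM; rewrite ?normc_ge0.
have := cintegral_row_mxC dF; rewrite (cintegral_row_mx dF).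
have Ey y z : F (row_mx z y) = u y * (E z y * G z).
  by rewrite /F row_mxKl row_mxKr; move: (E z y) (G z) (u y) => p q r; rewrite (mulrC r) mulrA.
have Ez z y : F (row_mx z y) = G z * (expi (-1 * dotp y (rsubmx z)) * u y).
  rewrite /F row_mxKl row_mxKr /E dotp_row_mx0 (dotpC (rsubmx z)).
  by move: (expi _) (G z) (u y) => p q r; rewrite (mulrCA p).
have phu (v : 'rV[R]_n) := rapid_mul (moderate_phase (-1) v).1 ru.
have phG (v : 'rV[R]_(n + n)) := rapid_mul (moderate_phase (-1) v).1 rG.
have -> : cintegral (fun y => cintegral (fun z => F (row_mx z y))) =
    cintegral (fun y => u y * ft (-1) G (row_mx 0 y)).
  apply: eq_cintegral => y; rewrite (eq_cintegral (Ey y)).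
  have [C HC] := rapid_cdominated (phG (row_mx 0 y)); exact: (cintegralZ _ HC).
move=> <-.
have -> : cintegral (fun z => cintegral (fun y => F (row_mx z y))) =
    cintegral (fun z => G z * fourier u (rsubmx z)).
  apply: eq_cintegral => z; rewrite (eq_cintegral (Ez z)).
  have [C HC] := rapid_cdominated (phu (rsubmx z)).
  by rewrite (cintegralZ _ HC) fourierE.
have rfu := rapid_fourier ru.
have [C' dfu] := rapid_cdominated rfu.
have dH : cdominated (Cg * C') (fun z => G z * fourier u (rsubmx z)).
  split.
    apply: (continuousM_complex cG).
    exact: continuous_compose (@continuous_rsubmx R 1 n n) dfu.1.
  move=> z; rewrite normcM mulrAC; apply: ler_pM; rewrite ?normc_ge0//.
  exact: cdominated_le dfu.
rewrite (cintegral_row_mx dH); apply: eq_cintegral => x.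
have rb' := symbol_rapid_fourier rb ru.
have [B B0 HB] := symbol_rapidW 0 1 rb'.
pose q eta := phase (row_mx x eta) * (b (row_mx x eta) * fourier u (rsubmx (row_mx x eta))).
have dq : cdominated B q.
  split.
    apply: continuousM_complex.
      exact: continuous_compose (@continuous_row_mxr x) (@continuous_phase R n).
    exact: continuous_compose (@continuous_row_mxr x) (smooth_continuous rb'.1).
  move=> eta; rewrite normcM normc_expi mul1r.
  by apply: le_trans (HB [::] isT (row_mx x eta)) _; rewrite row_mxKr expr1.
rewrite -[RHS]mulrC -(cintegralZ (phi x) dq); apply: eq_cintegral => eta.
rewrite /G /pairing_density /q row_mxKl.
move: (phase _) (b _) (phi x) (fourier _ _) => p1 p2 p3 p4.
by rewrite (mulrC p3) -!mulrA (mulrC p3).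
Qed.

Lemma pairing_OP b (u : schwartz R n) : symbol_rapid b ->
  transpose (pairing b) (tdist_of_fun u) = tdist_of_fun (OP_schwartz b u).
Proof.
move=> rb; apply: tdist_eqP => phi.
have ru := schwartz_rapid u; have rphi := schwartz_rapid phi.
have oP := pairing_operator rb; have [rP _ _] := oP.
rewrite (transposeE _ _ oP) tdist_of_funE; last exact: rapid_tempered.
rewrite tdist_of_funE; last exact: tempered_OP_schwartz.
rewrite to_schwartzE; last exact: rP.
rewrite OP_schwartzE /pairing.
have rG := rapid_pairing_density rb rphi.
have [sG bG] := ft_rapid (@sqrN1 R) rG.
have rr : rapid (fun y => ft (-1) (pairing_density b phi) (row_mx 0 y)).
  split; first exact: smooth_row_mxr.
  by move=> N; have [B HB] := bG N; exists B; exact: sbound_row_mxr.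
have [C HC] := tempered_cdominated (rapid_tempered ru) rr.
have tI := tempered_phase_integral (symbol_rapid_fourier rb ru).
have [C' HC'] := tempered_cdominated tI rphi.
transitivity (((2 * pi) ^- n)%:C * cintegral (fun y => u y *
    ft (-1) (pairing_density b phi) (row_mx 0 y))).
  rewrite -(cintegralZ _ HC); apply: eq_cintegral => y.
  by move: (u y) (ft _ _ _) (_ ^- n)%:C => p q r; rewrite (mulrCA p).
rewrite (pairing_fubini rb ru rphi) -(cintegralZ _ HC'); apply: eq_cintegral => x.
by rewrite mulrA.
Qed.

Lemma pairing_OP_extension b : symbol_rapid b ->
  is_OP_extension b (transpose (pairing b)).
Proof.
move=> rb; have oP := pairing_operator rb; split.
- exact: transpose_linear.
- exact: transpose_continuous.
- by move=> u; exact: pairing_OP.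
Qed.

End PhaseIntegral.

(** * Density of S in S' and uniqueness of OP(b) *)

Section PositiveIntegral.
Context {R : realType} {n : nat}.
Implicit Types (f g : 'rV[R]_n -> R).

Lemma rint_ge0 f : (forall x, 0 <= f x) -> 0 <= rint f.
Proof. by move=> f0; apply: Rintegral_ge0. Qed.

Lemma rint_le C D f g : dominated C f -> dominated D g -> (forall x, f x <= g x) ->
  rint f <= rint g.
Proof.
move=> df dg fg; rewrite -subr_ge0.
have := rint_lin (-1) df dg; rewrite mulN1r addrC => <-.
by apply: rint_ge0 => x; rewrite mulN1r addrC subr_ge0.
Qed.

Lemma cvg_eps : (fun m => (2 ^- m : R)) @ \oo --> (0 : R).
Proof.
rewrite (_ : (fun m => _) = (fun m => (2^-1 : R) ^+ m)).
  by apply: cvg_expr; rewrite ger0_norm ?invr_ge0// invf_lt1// ltr1n.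
by apply/funext => m; rewrite exprVn.
Qed.

(** If f(x) were positive, averages of f near x would be too; but the average of
    f(x + eps y) against 1/weight y is at most eps^{-n} times the integral of f. *)
Lemma rint_eq0 C f : dominated C f -> (forall x, 0 <= f x) -> rint f = 0 ->
  forall x, f x = 0.
Proof.
move=> df f0 If x; have [cf fC] := df.
have C0 : 0 <= C by have := le_trans (normr_ge0 _) (fC 0); rewrite pmulr_lge0 ?invr_gt0.
pose eps (m : nat) : R := 2 ^- m.
have eps0 m : eps m != 0 by rewrite invr_eq0 expf_neq0.
have cfx m : continuous (fun y : 'rV[R]_n => f (x + eps m *: y)).
  rewrite (_ : (fun y => _) = fun y => f (eps m *: y + x)).
    exact: (continuous_compose (@continuous_affine R n (eps m) x) cf).
  by apply/funext => y; rewrite addrC.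
have fle y : f y <= C.
  apply: le_trans (ler_norm _) _; apply: le_trans (fC y) _.
  by rewrite ler_pdivrMr// ler_peMr.
have dom m : dominated C (fun y => f (x + eps m *: y) / weight y).
  split; first exact: (continuous_mul (cfx m) (@continuous_weightV R n)).
  move=> y; rewrite ger0_norm ?divr_ge0// ler_wpM2r ?invr_ge0//.
have lim0 : (fun m => rint (fun y => f (x + eps m *: y) / weight y)) @ \oo -->
    rint (fun y : 'rV[R]_n => f x / weight y).
  apply: (rint_dct dom).
    exact: (continuous_mul (@continuous_cst _ _ (f x)) (@continuous_weightV R n)).
  move=> y; apply: cvgMr_tmp.
  have cfC : continuous (fun y => (f y)%:C : R[i]^o).
    by apply/continuous_complexP; split=> //; exact: cst_continuous.
  by have /cvg_complexP[] := @cvg_line R n (fun y => (f y)%:C) x y eps cfC cvg_eps.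
have z m : rint (fun y => f (x + eps m *: y) / weight y) = 0.
  apply/eqP; rewrite eq_le rint_ge0 ?andbT; last first.
    by move=> y; rewrite divr_ge0.
  have [D dD] := dominated_affine x (eps0 m) df.
  have -> : 0 = rint (fun y => f (eps m *: y + x)).
    have := rint_affine x (eps0 m) df; rewrite If => /esym/eqP.
    by rewrite mulf_eq0 gt_eqF ?exprn_gt0 ?normr_gt0//= => /eqP.
  apply: (rint_le (dom m) dD) => y; rewrite addrC ler_pdivrMr// ler_peMr//.
have lim1 : (fun m => rint (fun y => f (x + eps m *: y) / weight y)) @ \oo --> (0 : R).
  rewrite (_ : (fun m => _) = fun=> 0); first exact: cvg_cst.
  by apply/funext => m; exact: z.
have : rint (fun y : 'rV[R]_n => f x / weight y) = 0.
  exact: (cvg_unique (@Rhausdorff R) lim0 lim1).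
move=> /eqP; rewrite rint_weightV.
by rewrite mulf_eq0 expf_eq0 [pi == 0]gt_eqF ?pi_gt0// andbF orbF => /eqP.
Qed.

End PositiveIntegral.

Section Conjugation.
Context {R : realType} {n : nat}.
Implicit Types (f g : 'rV[R]_n -> R[i]^o).

Definition conj_fun f : 'rV[R]_n -> R[i]^o := fun x => conjc (f x).

Lemma normc_conj (z : R[i]) : normc (conjc z) = normc z.
Proof. by case: z => a b; rewrite /normc /= sqrrN. Qed.

Lemma partial_conj j f : partial_derivable j f ->
  partial_derivable j (conj_fun f) /\ partial j (conj_fun f) = conj_fun (partial j f).
Proof.
move=> df; apply: partialP => x; have [fr fi] := is_derive_partial x df.
have eR y : complex.Re (conj_fun f y) = complex.Re (f y) by rewrite /conj_fun; case: (f y).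
have eI y : complex.Im (conj_fun f y) = - complex.Im (f y) by rewrite /conj_fun; case: (f y).
have -> : (fun y => complex.Re (conj_fun f y)) = (fun y => complex.Re (f y)) by apply/funext.
have -> : (fun y => complex.Im (conj_fun f y)) = (fun y => - complex.Im (f y)) by apply/funext.
have -> : complex.Re (conj_fun (partial j f) x) = complex.Re (partial j f x).
  by rewrite /conj_fun; case: (partial j f x).
have -> : complex.Im (conj_fun (partial j f) x) = - complex.Im (partial j f x).
  by rewrite /conj_fun; case: (partial j f x).
split; first exact: fr.
exact: (is_deriveN fi).
Qed.

Lemma continuous_conj f : continuous f -> continuous (conj_fun f).
Proof.
move=> /continuous_complexP[cr ci]; apply/continuous_complexP; split.
  rewrite (_ : (fun y => _) = (fun y => complex.Re (f y)))//.
  by apply/funext => y; rewrite /conj_fun; case: (f y).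
rewrite (_ : (fun y => _) = (fun y => - complex.Im (f y))); first exact: continuous_opp.
by apply/funext => y; rewrite /conj_fun; case: (f y).
Qed.

Lemma smooth_conj f : smooth f -> smooth (conj_fun f).
Proof.
move=> sf k; elim: k f sf => [|k IH] f sf.
  by split; [exact/continuous_conj/smooth_continuous|].
split=> [|j]; first exact/continuous_conj/smooth_continuous.
have [d ->] := partial_conj (smooth_derivable j sf); split; first exact: d.
by apply: IH; exact: smooth_partial.
Qed.

Lemma dlist_conj s f : smooth f -> dlist s (conj_fun f) = conj_fun (dlist s f).
Proof.
elim: s f => //= j s IH f sf; have [_ ->] := partial_conj (smooth_derivable j sf).
by rewrite IH//; exact: smooth_partial.
Qed.

Lemma rapid_conj f : rapid f -> rapid (conj_fun f).
Proof.
move=> [sf bf]; split; first exact: smooth_conj.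
move=> N; have [B HB] := bf N; exists B => s sN x.
by rewrite dlist_conj// /conj_fun normc_conj; exact: HB.
Qed.

Lemma conj_mul_eq0 f : rapid f -> cintegral (fun x => conj_fun f x * f x) = 0 ->
  forall x, f x = 0.
Proof.
move=> rf If.
have [C HC] := tempered_cdominated (rapid_tempered (rapid_conj rf)) rf.
have E x : complex.Re (conj_fun f x * f x) = complex.Re (f x) ^+ 2 + complex.Im (f x) ^+ 2.
  by rewrite /conj_fun; case: (f x) => a b /=; ring.
have [dr _] := cdominatedP HC.
move: If; rewrite cintegralE => -[Ir _] x.
have E0 y : 0 <= complex.Re (conj_fun f y * f y) by rewrite E addr_ge0// sqr_ge0.
have := rint_eq0 dr E0 Ir x; rewrite E => /eqP.
rewrite paddr_eq0 ?sqr_ge0// !sqrf_eq0 => /andP[/eqP r0 /eqP i0].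
exact: eq_ReIm.
Qed.

End Conjugation.

Section Density.
Context {R : realType} {n : nat}.
Implicit Types (phi f : schwartz R n) (u : tdist R n).

Lemma linear_sum (V W : lmodType R[i]) (L : V -> W) (k : nat) (c : 'I_k -> R[i])
    (v : 'I_k -> V) : linear L -> L (\sum_i c i *: v i) = \sum_i c i *: L (v i).
Proof.
move=> lL; have L0 : L 0 = 0 by have := lL (-1) 0 0; rewrite !scaleN1r !addNr.
elim/big_rec2 : _ => // i y w _ <-.
exact: lL.
Qed.

Definition bracket f phi : R[i]^o := cintegral (fun x => f x * phi x).

Lemma bracketE f phi : tdist_of_fun f phi = bracket f phi.
Proof. exact/tdist_of_funE/rapid_tempered/schwartz_rapid. Qed.

Lemma bracketC f phi : bracket f phi = bracket phi f.
Proof. by apply: eq_cintegral => x; rewrite mulrC. Qed.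

Lemma bracket_linr f : linear (bracket f).
Proof.
move=> c p q; rewrite -!bracketE; exact: tdist_linear.
Qed.

Lemma bracket_linl phi : linear (fun f => bracket f phi).
Proof. by move=> c p q; rewrite !(bracketC _ phi) bracket_linr. Qed.

Definition conj_schwartz phi : schwartz R n := to_schwartz (conj_fun phi).

Lemma conj_schwartzE phi : conj_schwartz phi = conj_fun phi :> ('rV[R]_n -> R[i]^o).
Proof. exact/to_schwartzE/rapid_conj/schwartz_rapid. Qed.

Lemma schwartz_sumE k (c : 'I_k -> R[i]) (v : 'I_k -> schwartz R n) x :
  (\sum_i c i *: v i) x = \sum_i c i * v i x.
Proof. exact: (@linear_sum _ (R[i]^o) (fun f => f x)). Qed.

Lemma bracket_conj_eq0 f : bracket (conj_schwartz f) f = 0 -> f = 0.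
Proof.
move=> h; apply: schwartz_eqP => x; apply: (conj_mul_eq0 (schwartz_rapid f)).
by rewrite -{}h; apply: eq_cintegral => y; rewrite conj_schwartzE.
Qed.

(** Linear algebra with the Gram matrix G of l: a vector w in its kernel gives a
    function f = sum_k w_k phi_k with vanishing square integral, so f = 0 and u(f) = 0.
    Hence the row of values of u lies in the row space of G. *)
Lemma tdist_interpolate u (l : seq (schwartz R n)) :
  exists f, forall phi, phi \in l -> tdist_of_fun f phi = u phi.
Proof.
pose p (i : 'I_(size l)) := tnth (in_tuple l) i.
pose G : 'M[R[i]]_(size l) := \matrix_(i, j) bracket (conj_schwartz (p i)) (p j).
pose U : 'rV[R[i]]_(size l) := \row_j u (p j).
have lu := tdist_linear u.
have UG : (U <= G)%MS.
  rewrite submxE; apply/eqP/rowP => j; rewrite !mxE.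
  pose w i := cokermx G i j.
  have Gw i : \sum_k w k *: bracket (conj_schwartz (p i)) (p k) = 0.
    have := mulmx_coker G => /matrixP/(_ i j); rewrite !mxE => {2}<-.
    by apply: eq_bigr => k _; rewrite mxE mulrC.
  have -> : \sum_k U 0 k * cokermx G k j = u (\sum_k w k *: p k).
    by rewrite (linear_sum _ _ lu); apply: eq_bigr => k _; rewrite mxE mulrC.
  have -> : \sum_k w k *: p k = 0.
    apply: bracket_conj_eq0; set f := \sum_k _.
    have -> : conj_schwartz f = \sum_k conjc (w k) *: conj_schwartz (p k).
      apply: schwartz_eqP => x; rewrite conj_schwartzE schwartz_sumE /conj_fun schwartz_sumE.
      rewrite (big_morph (@conjc R) (rmorphD _) (conjc0 R)).
      by apply: eq_bigr => k _; rewrite conj_schwartzE rmorphM.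
    rewrite (linear_sum _ _ (bracket_linl f)) big1// => k _.
    rewrite (linear_sum _ _ (bracket_linr _)) (_ : \sum_i _ = 0) ?scaler0//.
  by have := lu (-1) 0 0; rewrite !scaleN1r !addNr.
have [c cG] := submxP UG.
exists (\sum_i c 0 i *: conj_schwartz (p i)) => phi phil.
have [j ->] : exists j, phi = p j by apply/tnthP.
rewrite bracketE (linear_sum _ _ (bracket_linl _)).
have := congr1 (fun M : 'rV_(size l) => M 0 j) cG; rewrite !mxE => ->.
by apply: eq_bigr => i _; rewrite mxE.
Qed.

(** Generated by the sets of regular distributions that agree with u at the
    members of a finite list. *)
Definition regular_near u : set_system (tdist R n) :=
  filter_from [set: seq (schwartz R n)] (fun l =>
    [set v | (exists f : schwartz R n, v = tdist_of_fun f) /\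
       forall phi, phi \in l -> v phi = u phi]).

Lemma regular_near_filter u : ProperFilter (regular_near u).
Proof.
apply: filter_from_proper; last first.
  move=> l _; have [f fl] := tdist_interpolate u l.
  by exists (tdist_of_fun f); split=> //; exists f.
apply: filter_from_filter; first by exists [::].
move=> l1 l2 _ _; exists (l1 ++ l2) => // v [fv vl]; split; split=> // phi pl.
  by apply: vl; rewrite mem_cat pl.
by apply: vl; rewrite mem_cat pl orbT.
Qed.

Lemma regular_near_cvg u : regular_near u --> u.
Proof.
have FF := regular_near_filter u.
apply: (proj2 (@tdist_cvgP _ _ (regular_near u) u _)) => phi A /= nA.
exists [:: phi] => // v [_ /(_ phi)]; rewrite mem_seq1 eqxx => /(_ isT) /= ->.
exact: nbhs_singleton.
Qed.

(** The Schwartz functions that agree with u on a finite set of test functions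
    form a filter converging to u, on which the two extensions coincide. *)
Lemma OP_extension_unique (b : symbol R n) T T' :
  is_OP_extension b T -> is_OP_extension b T' -> T = T'.
Proof.
move=> [_ cT TE] [_ cT' T'E]; apply/funext => u; apply: tdist_eqP => phi.
have FF := regular_near_filter u.
have lim (S : tdist R n -> tdist R n) : continuous S ->
    (fun v => S v phi) @ regular_near u --> S u phi.
  move=> cS.
  have SF : S @ regular_near u --> S u by exact: cvg_comp (@regular_near_cvg u) (cS u).
  exact: (proj1 (@tdist_cvgP _ _ (S @ regular_near u) (S u) _) SF phi).
have TT' : \forall v \near regular_near u, T v phi = T' v phi.
  by exists [::] => // v [[f ->] _] /=; rewrite TE T'E.
apply: (cvg_unique _ (lim _ cT)) => //.
apply: cvg_trans (lim _ cT'); apply: near_eq_cvg.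
by apply: filterS TT' => v ->.
Qed.

Lemma OP_rapid (b : symbol R n) : symbol_rapid b -> OP b = transpose (pairing b).
Proof.
move=> rb; have eb := pairing_OP_extension rb.
apply: (@OP_extension_unique b) => //.
exact: (@xgetPex _ (fun=> 0) [set T | is_OP_extension b T] (ex_intro _ _ eb)).
Qed.

(** True for every b: if no extension exists the default value is the zero map. *)
Lemma OP_linear (b : symbol R n) : linear (OP b).
Proof.
rewrite /OP; case: xgetP => [T _ [lT _ _]//|_].
by move=> c u v; rewrite scaler0 addr0.
Qed.

End Density.

(** * Averages of translates of a symbol *)

Section Mollification.
Context {R : realType} {n : nat}.
Implicit Types (b : symbol R n) (k : 'rV[R]_n -> R[i]^o).

Definition mollify (eps : R) k b : symbol R n :=
  fun z => cintegral (fun y => b (z + row_mx (- eps *: y) 0) * k y).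

Lemma rsubmx_shift (z : 'rV[R]_(n + n)) (v : 'rV[R]_n) :
  rsubmx (z + row_mx v 0) = rsubmx z.
Proof. by rewrite -[z in LHS]hsubmxK add_row_mx row_mxKr addr0. Qed.

Lemma symbol_rapid_partial b j : symbol_rapid b -> symbol_rapid (partial j b).
Proof.
move=> rb; split; first exact: smooth_partial rb.1.
move=> l; have [B _ HB] := symbol_rapidW l.+1 l rb; exists B.
exact: derivs_bounded_partial.
Qed.

Lemma symbol_rapid_dlist b s : symbol_rapid b -> symbol_rapid (dlist s b).
Proof. by elim: s b => //= j s IH b rb; apply/IH/symbol_rapid_partial. Qed.

Lemma continuous_shift (eps : R) (z : 'rV[R]_(n + n)) :
  continuous (fun y : 'rV[R]_n => z + row_mx (- eps *: y) 0).
Proof.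
have c1 : continuous (fun y : 'rV[R]_n => - eps *: y).
  rewrite (_ : (fun y => _) = fun y => - eps *: y + 0); first exact: continuous_affine.
  by apply/funext => y; rewrite addr0.
apply: continuous_into_row => i; under eq_fun do rewrite mxE.
apply: continuous_add; first exact: continuous_cst.
have cz : continuous (fun _ : 'rV[R]_n => 0 : 'rV[R]_n) by move=> y; exact: cst_continuous.
exact: (continuous_compose (continuous_row_mx c1 cz) (@continuous_coord R _ i)).
Qed.

Lemma partial_shift b j (v : 'rV[R]_(n + n)) : smooth b ->
  partial_derivable j (fun z => b (z + v)) /\
  partial j (fun z => b (z + v)) = (fun z => partial j b (z + v)).
Proof.
move=> sb.
have L_line (z : 'rV[R]_(n + n)) i (h : R) : z + h *: delta_mx 0 i + v =
    z + v + (h * 1) *: delta_mx 0 i by rewrite mulr1 addrAC.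
have [d E] := @partial_comp_line R _ _ (fun z => z + v) id (fun=> 1) L_line b j
  (smooth_derivable j sb).
by split=> //; rewrite E; apply/funext => z; rewrite mul1r.
Qed.

Lemma mollify_cdominated eps k b B M C z : continuous b ->
  (forall z, normc (b z) <= B / weight (rsubmx z) ^+ M) -> cdominated C k ->
  cdominated (B / weight (rsubmx z) ^+ M * C)
    (fun y => b (z + row_mx (- eps *: y) 0) * k y).
Proof.
move=> cb bB [ck kC]; split.
  apply: (continuousM_complex _ ck).
  exact: (continuous_compose (@continuous_shift eps z) cb).
move=> y; rewrite normcM -[X in _ <= X]mulrA; apply: ler_pM; rewrite ?normc_ge0//.
by apply: le_trans (bB _) _; rewrite rsubmx_shift.
Qed.

(** The symbols of order minus infinity are closed under partial derivatives,
    so the parametric integral applies with this family of integrands. *)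
Lemma mollify_partial eps k b : rapid k -> symbol_rapid b ->
  smooth (mollify eps k b) /\
  forall j, partial j (mollify eps k b) = mollify eps k (partial j b).
Proof.
move=> rk rb.
pose I := {b : symbol R n | symbol_rapid b}.
pose g (i : I) (z : 'rV[R]_(n + n)) (y : 'rV[R]_n) : R[i]^o :=
  proj1_sig i (z + row_mx (- eps *: y) 0) * k y.
pose D j (i : I) : I := exist _ (partial j (proj1_sig i)) (symbol_rapid_partial j (proj2_sig i)).
have [C dk] := rapid_cdominated rk.
have bnd (i : I) : exists B, forall z, normc (proj1_sig i z) <= B / weight (rsubmx z) ^+ 0.
  by have [B _ HB] := symbol_rapidW 0 0 (proj2_sig i); exists B => z; exact: (HB [::] isT).
have g1 i j y : partial_derivable j (fun z => g i z y) /\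
    partial j (fun z => g i z y) = (fun z => g (D j i) z y).
  have [d dE] := partial_shift j (row_mx (- eps *: y) 0) (proj2_sig i).1.
  have [d2 d2E] := partial_mul d (smooth_derivable j (smooth_cst (k y))).
  split; first exact: d2.
  by rewrite [LHS]d2E dE partial_cst; apply/funext => z; rewrite mulr0 addr0.
have g2 i z : continuous (g i z).
  have [B HB] := bnd i.
  exact: (mollify_cdominated eps z (smooth_continuous (proj2_sig i).1) HB dk).1.
have g3 i (r : R) : exists C, forall z : 'rV[R]_(n + n), (forall l, `|z 0 l| <= r) ->
    forall y, normc (g i z y) <= C / weight y.
  have [B HB] := bnd i; exists (B * C) => z _ y.
  have [_ /(_ y)] := mollify_cdominated eps z (smooth_continuous (proj2_sig i).1) HB dk.
  by rewrite expr0 divr1.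
split; first exact: (@parametric_smooth _ _ _ _ g D g1 g2 g3 (exist _ b rb)).
by move=> j; have [_] := @parametric_partial _ _ _ _ g D g1 g2 g3 (exist _ b rb) j.
Qed.

Lemma dlist_mollify eps k b s : rapid k -> symbol_rapid b ->
  dlist s (mollify eps k b) = mollify eps k (dlist s b).
Proof.
move=> rk; elim: s b => //= j s IH b rb.
by rewrite (mollify_partial eps rk rb).2 IH//; exact: symbol_rapid_partial.
Qed.

Lemma mollify_rapid eps k b : rapid k -> symbol_rapid b -> symbol_rapid (mollify eps k b).
Proof.
move=> rk rb; split; first exact: (mollify_partial eps rk rb).1.
move=> l; have [B B0 HB] := symbol_rapidW l l rb; have [C dk] := rapid_cdominated rk.
exists (2 * (B * C) * pi ^+ n) => s sl z; rewrite dlist_mollify//.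
have cb := smooth_continuous (symbol_rapid_dlist s rb).1.
have := cintegral_bound (mollify_cdominated eps z cb (HB s sl) dk).
by move=> /le_trans; apply; rewrite le_eqVlt; apply/orP; left; apply/eqP; ring.
Qed.

Lemma sum_abs_le_weight (y : 'rV[R]_n) : \sum_j `|y 0 j| <= n%:R * weight y.
Proof.
apply: (@le_trans _ _ (\sum_(j < n) weight y)).
  apply: ler_sum => j _; apply: le_trans (weight_coord y j).
  rewrite -[X in _ <= _ + X]real_normK ?num_real//; set t := `|_|; nra.
by rewrite sumr_const card_ord mulr_natl.
Qed.

(** Only the x block is displaced, so the eta decay of the derivatives survives
    unchanged in the mean value estimate. *)
Lemma shift_close b M B1 (eps : R) (z : 'rV[R]_(n + n)) (y : 'rV[R]_n) : smooth b ->
  (forall j z, normc (partial j b z) <= B1 / weight (rsubmx z) ^+ M) -> 0 <= B1 ->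
  normc (b (z + row_mx (- eps *: y) 0) - b z) <=
  2 * (B1 / weight (rsubmx z) ^+ M) * (`|eps| * (n%:R * weight y)).
Proof.
move=> sb bB B0.
have := @mvt_row R _ b (B1 / weight (rsubmx z) ^+ M) z (row_mx (- eps *: y) 0).
move=> /(_ (fun j => smooth_derivable j sb)) H.
apply: le_trans (H _) _.
  move=> j w wz; have -> : rsubmx z = rsubmx w; last exact: bB.
  apply/rowP => i; have := wz (rshift n i); rewrite row_mxEr.
  rewrite (_ : (0 : 'rV[R]_n) 0 i = 0); last by rewrite mxE.
  rewrite normr0.
  by rewrite normr_le0 subr_eq0 !mxE => /eqP ->.
apply: ler_wpM2l.
  by rewrite mulr_ge0// divr_ge0// exprn_ge0.
rewrite big_split_ord /= [X in _ + X]big1 ?addr0; last first.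
  by move=> i _; rewrite row_mxEr mxE normr0.
apply: le_trans (ler_wpM2l (normr_ge0 eps) (sum_abs_le_weight y)).
rewrite mulr_sumr; apply: ler_sum => i _.
by rewrite row_mxEl mxE normrM normrN.
Qed.

(** As k has integral 1, the difference is the integral of
    (b(x - eps y, eta) - b(x, eta)) k(y). *)
Lemma mollify_close_at k b M B1 B2 (eps : R) z : rapid k -> cintegral k = 1 ->
  (forall y, normc (k y) <= B2 / weight y ^+ 2) ->
  symbol_rapid b ->
  (forall j z, normc (partial j b z) <= B1 / weight (rsubmx z) ^+ M) -> 0 <= B1 ->
  normc (mollify eps k b z - b z) <=
  `|eps| * (4 * B1 * n%:R * B2 * pi ^+ n) / weight (rsubmx z) ^+ M.
Proof.
move=> rk k1 kB rb bB B0.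
have [C dk] := rapid_cdominated rk.
have [B _ HB] := symbol_rapidW 0 0 rb.
have dm := mollify_cdominated eps z (smooth_continuous rb.1) (HB [::] isT) dk.
have dbz : cdominated (normc (- b z) * C + B / weight (rsubmx z) ^+ 0 * C)
    (fun y => (- b z) * k y + b (z + row_mx (- eps *: y) 0) * k y).
  exact: cdominated_lin.
have E : mollify eps k b z - b z =
    cintegral (fun y => (- b z) * k y + b (z + row_mx (- eps *: y) 0) * k y).
  by rewrite (cintegral_lin _ dk dm) k1 mulr1 addrC.
rewrite E.
have dE : cdominated (2 * (B1 / weight (rsubmx z) ^+ M) * (`|eps| * n%:R) * B2)
    (fun y => (- b z) * k y + b (z + row_mx (- eps *: y) 0) * k y).
  split; first exact: dbz.1.
  move=> y; rewrite -mulrDl addrC normcM.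
  apply: le_trans (ler_pM (normc_ge0 _) (normc_ge0 _) (shift_close eps z y rb.1 bB B0) (kB y)) _.
  have w0 := lt0r_neq0 (weight_gt0 y); rewrite le_eqVlt; apply/orP; left; apply/eqP.
  move: (weight y) (B1 / _) w0 => w X w0; field; exact: w0.
apply: le_trans (cintegral_bound dE) _; rewrite le_eqVlt; apply/orP; left; apply/eqP.
by move: (_ ^+ M)^-1 => W; ring.
Qed.

Lemma mollify_close k b K : rapid k -> cintegral k = 1 -> symbol_rapid b ->
  exists2 C, 0 <= C & forall eps, derivs_bounded K
    (fun z => `|eps| * C / weight (rsubmx z) ^+ K)
    (fun z => mollify eps k b z + (-1) * b z).
Proof.
move=> rk k1 rb; have [B1 B10 HB1] := symbol_rapidW K.+1 K rb.
(* Order 2: one weight absorbs the factor |y| of the mean value estimate, the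
   other makes the integral converge. *)
have [B2 HB2] := rk.2 2%N.
have B20 : 0 <= B2 := sbound_ge0 HB2.
exists (4 * B1 * n%:R * B2 * pi ^+ n).
  by rewrite !mulr_ge0// exprn_ge0// pi_ge0.
move=> eps s sK z.
rewrite dlist_add; [|exact: (mollify_partial eps rk rb).1|exact: smooth_scale rb.1].
rewrite dlist_scale ?dlist_mollify//; last exact: rb.1.
rewrite mulN1r; apply: mollify_close_at => //.
- exact: (HB2 [::] isT).
- exact: symbol_rapid_dlist.
by move=> j w; rewrite -dlist_rcons; apply: HB1; rewrite size_rcons.
Qed.

End Mollification.

(** * Frequency modulation is such an average *)

Section ModulationIdentity.
Context {R : realType} {n : nat}.
Implicit Types (b : symbol R n) (psi k f phi : 'rV[R]_n -> R[i]^o).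

Lemma rapid_inv_fourier f : rapid f -> rapid (inv_fourier f).
Proof. by case: (@rapid_operator_inv_fourier R n) => + _ _; exact. Qed.

Lemma cintegral_inv_fourier psi : rapid psi -> cintegral (inv_fourier psi) = psi 0.
Proof.
move=> rpsi; rewrite inv_fourierE.
have [C HC] := rapid_cdominated (ft_rapid (expr1n _ 2) rpsi).
rewrite (cintegralZ _ HC) (inversion0 rpsi) mulrA -real_complexM mulVf ?mul1r//.
by rewrite expf_neq0// mulf_neq0// gt_eqF// pi_gt0.
Qed.

Lemma cdominated_bounded f C B : continuous f -> (forall x, normc (f x) <= B) ->
  forall phi, cdominated C phi -> cdominated (B * C) (fun x => f x * phi x).
Proof.
move=> cf fB phi [cphi HC]; split; first exact: continuousM_complex cf cphi.
by move=> x; rewrite normcM -[X in _ <= X]mulrA; apply: ler_pM; rewrite ?normc_ge0.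
Qed.

Lemma dotpBr (x y z : 'rV[R]_n) : dotp x (y - z) = dotp x y - dotp x z.
Proof.
rewrite /dotp -sumrB; apply: eq_bigr => i _.
by rewrite !mxE mulrBr.
Qed.

Lemma ft_dilate psi (eps : R) v : 0 < eps -> rapid psi ->
  cintegral (fun xi => expi (1 * dotp xi v) * psi (eps *: xi)) =
  (`|eps^-1| ^+ n)%:C * ft 1 psi (eps^-1 *: v).
Proof.
move=> e0 rpsi; have en0 : eps != 0 by rewrite gt_eqF.
have re := rapid_dilation en0 rpsi.
have [C HC] := rapid_cdominated (rapid_mul (moderate_phase 1 v).1 re).
have Vn0 : eps^-1 != 0 by rewrite invr_neq0.
rewrite (cintegral_affine 0 Vn0 HC); congr (_ * _); apply: eq_cintegral => xi.
rewrite addr0 scalerA divff// scale1r dotpZl [in RHS]dotpC dotpZl [in RHS]dotpC.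
by [].
Qed.

(** A Fourier multiplier is a convolution: exchanging the integrals over xi and
    y turns the inner one into the rescaled inverse transform of psi. *)
Lemma multiplier_kernel psi phi (eps : R) x : 0 < eps -> rapid psi -> rapid phi ->
  fourier (fun xi => psi (eps *: xi) * inv_fourier phi xi) x =
  cintegral (fun y => phi (eps *: y + x) * inv_fourier psi y).
Proof.
move=> e0 rpsi rphi; have en0 : eps != 0 by rewrite gt_eqF.
have re := rapid_dilation en0 rpsi.
have [C1 [c1 H1]] := rapid_cdominated re; have [C2 [c2 H2]] := rapid_cdominated rphi.
pose F (w : 'rV[R]_(n + n)) : R[i]^o := expi (dotp (lsubmx w) (rsubmx w - x)) *
  (psi (eps *: lsubmx w) * phi (rsubmx w)).
have cl := @continuous_lsubmx R 1 n n; have cr := @continuous_rsubmx R 1 n n.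
have dF : cdominated (C1 * C2) F.
  split.
    apply: continuousM_complex.
      apply: continuous_expi; apply: (continuous_dotp2 cl).
      rewrite (_ : (fun w => _) = fun w : 'rV[R]_(n + n) => 1 *: rsubmx w - x).
        exact: (continuous_compose cr (@continuous_affine R n 1 (- x))).
      by apply/funext => w; rewrite scale1r.
    apply: continuousM_complex; last exact: (continuous_compose cr c2).
    exact: (@continuous_compose _ _ _ (fun w : 'rV[R]_(n + n) => lsubmx w) (fun xi => psi (eps *: xi)) cl c1).
  move=> w; rewrite /F normcM (normcM (psi _)) normc_expi mul1r weight_split invfM mulrACA.
  by apply: ler_pM; rewrite ?normc_ge0// H1.
pose c : R[i]^o := ((2 * pi) ^- n)%:C.
have inner_y xi : cintegral (fun y => F (row_mx xi y)) =
    psi (eps *: xi) * (expi (-1 * dotp xi x) * ft 1 phi xi).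
  have rp := rapid_mul (moderate_phase 1 xi).1 rphi.
  have [C HC] := rapid_cdominated rp.
  rewrite mulrA -(cintegralZ _ HC); apply: eq_cintegral => y.
  rewrite /F row_mxKl row_mxKr dotpBr addrC mulN1r expiD mul1r (dotpC y).
  move: (expi _) (expi _) (psi _) (phi _) => p q r s.
  by rewrite mulrACA (mulrC q).
have inner_xi y : cintegral (fun xi => F (row_mx xi y)) =
    phi y * ((`|eps^-1| ^+ n)%:C * ft 1 psi (eps^-1 *: y + - (eps^-1 *: x))).
  have rp := rapid_mul (moderate_phase 1 (y - x)).1 re.
  have [C HC] := rapid_cdominated rp.
  rewrite -scalerBr -(ft_dilate _ e0 rpsi) -(cintegralZ _ HC); apply: eq_cintegral => xi.
  rewrite /F row_mxKl row_mxKr mul1r.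
  move: (expi _) (psi _) (phi _) => p q r.
  by rewrite (mulrC q) (mulrCA p).
have Vn0 : eps^-1 != 0 by rewrite invr_neq0.
have rft := ft_rapid (expr1n _ 2) rpsi.
have rk := rapid_affine (- (eps^-1 *: x)) Vn0 rft.
have [C3 H3] := tempered_cdominated (rapid_tempered rphi) rk.
have rftp := ft_rapid (expr1n _ 2) rphi.
have [C4 H4] := tempered_cdominated (rapid_tempered re)
  (rapid_mul (moderate_phase (-1) x).1 rftp).
have [C5 H5] := tempered_cdominated (rapid_tempered (rapid_affine x en0 rphi)) rft.
transitivity (c * cintegral F).
  rewrite (cintegral_row_mx dF) (eq_cintegral inner_y) -(cintegralZ c H4).
  apply: eq_cintegral => xi; rewrite inv_fourierE mulN1r.
  move: (expi _) (psi _) (ft _ _ _) => p q r.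
  by rewrite -/c (mulrCA c) (mulrCA p) (mulrCA c).
rewrite (cintegral_row_mxC dF) (eq_cintegral inner_xi).
transitivity (c * ((`|eps^-1| ^+ n)%:C * cintegral (fun y =>
    phi y * ft 1 psi (eps^-1 *: y + - (eps^-1 *: x))))).
  apply: (congr1 (fun w => c * w)); rewrite -(cintegralZ _ H3); apply: eq_cintegral => y.
  by rewrite mulrCA.
rewrite (cintegral_affine x en0 H3) [X in c * X]mulrA -real_complexM -exprMn -normrM mulVf//.
rewrite normr1 expr1n mul1r.
transitivity (c * cintegral (fun y => phi (eps *: y + x) * ft 1 psi y)).
  apply: (congr1 (fun w => c * w)); apply: eq_cintegral => y.
  by rewrite scalerDr scalerA mulVf// scale1r addrK.
rewrite -(cintegralZ c H5); apply: eq_cintegral => y.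
by rewrite inv_fourierE mulrCA.
Qed.

(** The translation by eps y moves from the symbol to the test function under
    the integral over x. *)
Lemma modulation_fubini (be phi k : 'rV[R]_n -> R[i]^o) B (eps : R) : `|eps| <= 1 -> continuous be ->
  (forall x, normc (be x) <= B) -> rapid phi -> rapid k ->
  cintegral (fun x => cintegral (fun y => be (x + - eps *: y) * k y) * phi x) =
  cintegral (fun x => be x * cintegral (fun y => phi (eps *: y + x) * k y)).
Proof.
move=> eps1 cb bB rphi rk.
have [C1 d1] := rapid_cdominated rphi; have [c1 H1] := d1.
have [C2 [c2 H2]] := rapid_cdominated rk.
have [B2 HB2] := rk.2 2%N; have B20 : 0 <= B2 := sbound_ge0 HB2.
have B0 : 0 <= B := le_trans (normc_ge0 _) (bB 0).
have C10 := cdominated_ge0 d1.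
have cl := @continuous_lsubmx R 1 n n; have cr := @continuous_rsubmx R 1 n n.
have caff (a : R) : continuous (fun w : 'rV[R]_(n + n) => lsubmx w + a *: rsubmx w).
  apply: continuous_into_row => i; under eq_fun do rewrite !mxE.
  apply: continuous_add; first exact: continuous_coord.
  by apply: continuous_mul; [exact: continuous_cst|exact: continuous_coord].
pose F1 (w : 'rV[R]_(n + n)) : R[i]^o :=
  be (lsubmx w + - eps *: rsubmx w) * (k (rsubmx w) * phi (lsubmx w)).
pose F2 (w : 'rV[R]_(n + n)) : R[i]^o :=
  be (lsubmx w) * (phi (lsubmx w + eps *: rsubmx w) * k (rsubmx w)).
have dF1 : cdominated (B * (C2 * C1)) F1.
  split.
    apply: continuousM_complex; first exact: (continuous_compose (caff (- eps)) cb).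
    by apply: continuousM_complex; [exact: continuous_compose cr c2|exact: continuous_compose cl c1].
  move=> w; rewrite /F1 normcM -[X in _ <= X]mulrA; apply: ler_pM; rewrite ?normc_ge0//.
  rewrite normcM weight_split (mulrC (weight _)) invfM mulrACA.
  by apply: ler_pM; rewrite ?normc_ge0.
have d2 : cdominated (B * (C1 * 3 ^+ n * B2)) F2.
  split.
    apply: continuousM_complex; first exact: (continuous_compose cl cb).
    by apply: continuousM_complex; [exact: continuous_compose (caff eps) c1|exact: continuous_compose cr c2].
  move=> w; rewrite /F2 normcM -[X in _ <= X]mulrA; apply: ler_pM; rewrite ?normc_ge0//.
  rewrite normcM weight_split; set x := lsubmx w; set y := rsubmx w.
  have wxy : weight x <= 3 ^+ n * weight y * weight (x + eps *: y).
    have := @weight_affine R n 1 (eps *: y) (oner_neq0 _) x.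
    rewrite expr1n divr1 scale1r (_ : 1 + 2 = 3 :> R); last by ring.
    move=> /le_trans; apply; rewrite ler_wpM2r// ler_wpM2l ?exprn_ge0//.
    apply: ler_prod => i _; rewrite addr_ge0 ?sqr_ge0//= lerD2l mxE exprMn.
    by rewrite ler_piMl ?sqr_ge0// -real_normK ?num_real// expr_le1.
  have phik := ler_pM (normc_ge0 _) (normc_ge0 _) (H1 (x + eps *: y)) (HB2 [::] isT y).
  apply: le_trans phik _; move: (weight_gt0 x) (weight_gt0 y) (weight_gt0 (x + eps *: y)) wxy.
  move: (weight x) (weight y) (weight (x + eps *: y)) => a b W a0 b0 W0 abW.
  have -> : C1 / W * (B2 / b ^+ 2) = (C1 * B2) * (W * b ^+ 2)^-1.
    by rewrite mulrACA -invfM.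
  have -> : C1 * 3 ^+ n * B2 / (a * b) = (C1 * B2) * (3 ^+ n / (a * b)).
    by rewrite mulrA [C1 * _ * B2]mulrAC.
  rewrite ler_wpM2l ?mulr_ge0// ler_pdivlMr ?mulr_gt0// ler_pdivrMl ?mulr_gt0 ?exprn_gt0//.
  apply: le_trans (ler_wpM2r (ltW b0) abW) _.
  by rewrite le_eqVlt; apply/orP; left; apply/eqP; ring.
have I1 y : cintegral (fun x => F1 (row_mx x y)) = cintegral (fun x => F2 (row_mx x y)).
  have dF2 : cdominated (B * (C1 * 3 ^+ n * B2) / weight y) (fun x => F2 (row_mx x y)).
    split; first exact: (continuous_compose (@continuous_row_mxl R n y) d2.1).
    move=> x; apply: le_trans (d2.2 _) _.
    by rewrite weight_row_mx (mulrC (weight x)) invfM mulrA.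
  rewrite (cintegral_affine (- eps *: y) (oner_neq0 R) dF2) normr1 expr1n mul1r.
  apply: eq_cintegral => x; rewrite /F1 /F2 !row_mxKl !row_mxKr scale1r.
  by rewrite scaleNr subrK (mulrC (k y)).
transitivity (cintegral F1).
  rewrite (cintegral_row_mx dF1); apply: eq_cintegral => x.
  have dx : cdominated (B * C2) (fun y => be (x + - eps *: y) * k y).
    have cbe : continuous (fun y : 'rV[R]_n => be (x + - eps *: y)).
      rewrite (_ : (fun y => _) = fun y => be (- eps *: y + x)).
        exact: (continuous_compose (@continuous_affine R n (- eps) x) cb).
      by apply/funext => y; rewrite addrC.
    exact: (cdominated_bounded cbe (fun y => bB _) (conj c2 H2)).
  rewrite mulrC -(cintegralZ _ dx); apply: eq_cintegral => y.
  by rewrite /F1 row_mxKl row_mxKr mulrC mulrA.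
rewrite (cintegral_row_mxC dF1) (eq_cintegral I1) -(cintegral_row_mxC d2) (cintegral_row_mx d2).
apply: eq_cintegral => x.
have dx : cdominated (C1 * C2) (fun y => phi (eps *: y + x) * k y).
  have ce : continuous (fun y : 'rV[R]_n => phi (eps *: y + x)).
    exact: (continuous_compose (@continuous_affine R n eps x) c1).
  have be1 y : normc (phi (eps *: y + x)) <= C1 by exact: cdominated_le d1.
  exact: (cdominated_bounded ce be1 (conj c2 H2)).
rewrite -(cintegralZ _ dx); apply: eq_cintegral => y.
by rewrite /F2 row_mxKl row_mxKr (addrC x).
Qed.

End ModulationIdentity.

Section Modulation.
Context {R : realType} {n : nat}.
Implicit Types (b c : symbol R n) (psi : testfun R n) (f : 'rV[R]_n -> R[i]^o).

Lemma cutoff0 psi : is_cutoff psi -> psi 0 = 1.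
Proof. exact: nbhs_singleton. Qed.

(** Integrals of f against rescaled translates of a rapidly decreasing kernel of
    integral 1 tend to f(x), and all of them vanish. *)
Lemma bounded_vanish f B : continuous f -> (forall x, normc (f x) <= B) ->
  (forall phi : schwartz R n, cintegral (fun x => f x * phi x) = 0) ->
  forall x, f x = 0.
Proof.
move=> cf fB f0 x; have [psi cpsi] := @cutoff_exists R n.
have rpsi := testfun_rapid psi.
pose k := inv_fourier psi; have rk : rapid k := rapid_inv_fourier rpsi.
have k1 : cintegral k = 1 by rewrite (cintegral_inv_fourier rpsi) cutoff0.
have [C dk] := rapid_cdominated rk.
pose eps (m : nat) : R := 2 ^- m.
have eps0 m : eps m != 0 by rewrite invr_eq0 expf_neq0.
have cfx m : continuous (fun y : 'rV[R]_n => f (x + eps m *: y)).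
  rewrite (_ : (fun y => _) = fun y => f (eps m *: y + x)).
    exact: (continuous_compose (@continuous_affine R n (eps m) x) cf).
  by apply/funext => y; rewrite addrC.
have dom m : cdominated (B * C) (fun y => f (x + eps m *: y) * k y).
  exact: (cdominated_bounded (cfx m) (fun y => fB _) dk).
have cst_f : continuous (fun _ : 'rV[R]_n => f x) by move=> y; exact: cst_continuous.
have lim1 : (fun m => cintegral (fun y => f (x + eps m *: y) * k y)) @ \oo -->
    cintegral (fun y => f x * k y).
  apply: (cintegral_dct dom); first exact: (continuousM_complex cst_f dk.1).
  move=> y; apply: cvgMr_tmp.
  exact: (@cvg_line R n f x y eps cf (@cvg_eps R)).
have z m : cintegral (fun y => f (x + eps m *: y) * k y) = 0.
  have Vn0 : (eps m)^-1 != 0 by rewrite invr_neq0.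
  have rka := rapid_affine (- ((eps m)^-1 *: x)) Vn0 rk.
  have [D [cka Hka]] := rapid_cdominated rka.
  have dh := cdominated_bounded cf fB (conj cka Hka).
  have h0 : cintegral (fun x' => f x' * k ((eps m)^-1 *: x' + - ((eps m)^-1 *: x))) = 0.
    by have := f0 (to_schwartz (fun x' => k ((eps m)^-1 *: x' + - ((eps m)^-1 *: x))));
      rewrite (to_schwartzE rka).
  have h1 := etrans (esym h0) (cintegral_affine x (eps0 m) dh).
  have {h1} h : cintegral (fun y => f (eps m *: y + x) *
      k ((eps m)^-1 *: (eps m *: y + x) + - ((eps m)^-1 *: x))) = 0.
    have a0 : (`|eps m| ^+ n)%:C != 0 :> R[i].
      by rewrite (_ : 0 = (0 : R)%:C)// (inj_eq (@complexI R)) gt_eqF// exprn_gt0// normr_gt0.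
    by apply: (mulfI a0); rewrite mulr0 -[LHS]h1.
  have ek (y : 'rV[R]_n) : (eps m)^-1 *: (eps m *: y + x) + - ((eps m)^-1 *: x) = y.
    by rewrite scalerDr scalerA mulVf// scale1r addrK.
  by rewrite -[RHS]h; apply: eq_cintegral => y; rewrite ek [x + _]addrC.
have lim0 : (fun m => cintegral (fun y => f (x + eps m *: y) * k y)) @ \oo --> (0 : R[i]^o).
  rewrite (_ : (fun m => _) = fun=> 0); first exact: cvg_cst.
  by apply/funext => m; exact: z.
have := cvg_uniqueC lim1 lim0.
by rewrite (cintegralZ _ dk) k1 mulr1.
Qed.

Lemma row_continuous b (eta : 'rV[R]_n) : smooth b -> continuous (fun x => b (row_mx x eta)).
Proof. by move=> sb; exact: (continuous_compose (@continuous_row_mxl R n eta) (smooth_continuous sb)). Qed.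

Lemma S11_row_bounded c eta : S11_infty c ->
  exists B, forall x, normc (c (row_mx x eta)) <= B.
Proof.
move=> /S11_moderate[_ mc]; have [C [M HC]] := mc 0%N.
by exists (C * weight eta ^+ M) => x; have := HC [::] isT (row_mx x eta); rewrite row_mxKr.
Qed.

Lemma bounded_tempered f B : continuous f -> (forall x, normc (f x) <= B) -> tempered f.
Proof. by move=> cf fB; split=> //; exists B, 0%N => x; rewrite expr0 mulr1. Qed.

(** A symbol of S^oo_{1,1} is, for fixed eta, a bounded continuous function of x,
    so it is determined by the distribution that it defines. *)
Lemma is_modulation_unique psi m b c c' :
  is_modulation psi m b c -> is_modulation psi m b c' -> c = c'.
Proof.
move=> [Sc Ec] [Sc' Ec']; apply/funext => z; rewrite -[z]hsubmxK.
move: (lsubmx z) (rsubmx z) => x eta.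
have [B HB] := S11_row_bounded eta Sc; have [B' HB'] := S11_row_bounded eta Sc'.
have cc := @row_continuous _ eta (S11_moderate Sc).1.
have cc' := @row_continuous _ eta (S11_moderate Sc').1.
apply/eqP; rewrite -subr_eq0; apply/eqP.
have cg : continuous (fun x => -1 * c' (row_mx x eta) + c (row_mx x eta)).
  apply: continuousD_complex cc; apply: (continuousM_complex _ cc').
  by move=> y; exact: cst_continuous.
have gB x' : normc (-1 * c' (row_mx x' eta) + c (row_mx x' eta)) <= B' + B.
  by rewrite (le_trans (le_normcD _ _))// lerD// mulN1r normcN.
rewrite addrC -mulN1r.
apply: (bounded_vanish cg gB (fun phi => _) x) => phi.
have tc := bounded_tempered cc HB; have tc' := bounded_tempered cc' HB'.
have rphi := schwartz_rapid phi.
have [D dc] := tempered_cdominated tc rphi; have [D' dc'] := tempered_cdominated tc' rphi.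
transitivity (cintegral (fun x => -1 * (c' (row_mx x eta) * phi x) + c (row_mx x eta) * phi x)).
  by apply: eq_cintegral => y; rewrite mulrDl mulrA.
rewrite (cintegral_lin _ dc' dc) -(tdist_of_funE phi tc) -(tdist_of_funE phi tc').
by rewrite Ec Ec' mulN1r addNr.
Qed.

Lemma mollify_row eps k b x eta : mollify eps k b (row_mx x eta) =
  cintegral (fun y => b (row_mx (x + - eps *: y) eta) * k y).
Proof. by apply: eq_cintegral => y; rewrite add_row_mx addr0. Qed.

Lemma eps_gt0 m : 0 < 2 ^- m :> R.
Proof. by rewrite invr_gt0 exprn_gt0. Qed.

Lemma eps_le1 m : `|2 ^- m : R| <= 1.
Proof. by rewrite ger0_norm ?invr_ge0 ?exprn_ge0// invf_le1 ?exprn_gt0// exprn_ege1// ler1n. Qed.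

Lemma rapid_dilate psi m : rapid (dilate psi m).
Proof. exact: rapid_dilation (lt0r_neq0 (eps_gt0 m)) (testfun_rapid psi). Qed.

Lemma rapid_moderate f : rapid f -> moderate f.
Proof.
move=> [sf bf]; split=> // k; have [B HB] := bf k; have B0 := sbound_ge0 HB; exists B, 0%N.
apply: derivs_bounded_le HB => x; rewrite expr0 mulr1.
by rewrite ler_pdivrMr ?weightX_gt0// ler_peMr ?weightX_ge1.
Qed.

Lemma mollify_modulation psi m b : symbol_rapid b ->
  is_modulation psi m b (mollify (2 ^- m) (inv_fourier psi) b).
Proof.
move=> rb; have rpsi := testfun_rapid psi; have rk := rapid_inv_fourier rpsi.
have rm : symbol_rapid (mollify (2 ^- m) (inv_fourier psi) b) by exact: mollify_rapid.
have Sm := S_minus_infty_S11 (proj2 (S_minus_inftyP _) rm).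
split=> // eta; apply: tdist_eqP => phi; have rphi := schwartz_rapid phi.
have [B HB] := S11_row_bounded eta (S_minus_infty_S11 (proj2 (S_minus_inftyP _) rb)).
have cb := @row_continuous _ eta rb.1.
have [B' HB'] := S11_row_bounded eta Sm.
rewrite (fourier_multiplierE _ _ (rapid_moderate (rapid_dilate psi m))).
have rq : rapid (fourier (fun x => dilate psi m x * inv_fourier phi x)).
  apply: rapid_fourier; apply: rapid_mul; last exact: rapid_inv_fourier.
  exact/rapid_moderate/rapid_dilate.
rewrite (tdist_of_funE _ (bounded_tempered (@row_continuous _ eta rm.1) HB')).
rewrite (tdist_of_funE _ (bounded_tempered cb HB)) (to_schwartzE rq).
under eq_cintegral do rewrite mollify_row.
rewrite (modulation_fubini (eps_le1 m) cb HB rphi rk); apply: eq_cintegral => x.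
by rewrite -(multiplier_kernel x (eps_gt0 m) rpsi rphi).
Qed.

Lemma modulationE psi m b : symbol_rapid b ->
  modulation psi m b = mollify (2 ^- m) (inv_fourier psi) b.
Proof.
move=> rb; have mb := mollify_modulation psi m rb.
apply: (is_modulation_unique _ mb).
exact: (@xgetPex _ (fun=> 0) [set c | is_modulation psi m b c] (ex_intro _ _ mb)).
Qed.

(** Either the modulation is a symbol of S^oo_{1,1}, or it is the default
    value 0, which is moderate as well. *)
Lemma modulation_S11 psi m b : eta_moderate (modulation psi m b).
Proof.
rewrite /modulation; case: xgetP => [c _ [Sc _]|_]; first exact: S11_moderate.
split; first exact: smooth_cst.
move=> k; exists 0, 0%N => s sk z; rewrite mul0r.
by have := dlist_cst_le (0 : R[i]^o) s z; rewrite normc0.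
Qed.

Lemma modulated_symbol_rapid psi m b : symbol_rapid (modulated_symbol psi m b).
Proof.
apply: symbol_rapid_mul; first exact: modulation_S11.
exact/rapid_symbol/rapid_dilate.
Qed.

End Modulation.

(** * Convergence of the modulated symbols and operators *)

Section ModulatedConvergence.
Context {R : realType} {n : nat}.
Implicit Types (b c : symbol R n) (psi : testfun R n) (f : 'rV[R]_n -> R[i]^o).

Lemma dlist_cst0 s (c : R[i]^o) : (0 < size s)%N ->
  dlist s (fun _ : 'rV[R]_n => c) = fun=> 0.
Proof.
case: s => // j s _; rewrite /= partial_cst; elim: s => //= i s IH.
by rewrite partial_cst.
Qed.

Lemma scale_line (a : R) (z : 'rV[R]_n) j h :
  a *: (z + h *: delta_mx 0 j) = a *: z + (h * a) *: delta_mx 0 j.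
Proof. by rewrite scalerDr scalerA [_ * h]mulrC. Qed.

Lemma scale_continuous (a : R) : continuous (fun z : 'rV[R]_n => a *: z).
Proof.
rewrite (_ : (fun z => _) = fun z : 'rV[R]_n => a *: z + 0); first exact: continuous_affine.
by apply/funext => z; rewrite addr0.
Qed.

(** The value psi(2^{-m} x) - psi(0) is estimated by the mean value theorem, at
    the price of one weight; each derivative carries a factor 2^{-m}. *)
Lemma dilate_close psi K : psi 0 = 1 -> exists2 C, 0 <= C & forall m,
  derivs_bounded K (fun x => 2 ^- m * C * weight x)
    (fun x => dilate psi m x + (-1)).
Proof.
move=> psi0; have [spsi bpsi] := testfun_rapid psi.
(* Order at least 1, since the mean value theorem needs the first derivatives. *)
have [B HB] := bpsi (maxn K 1); have B0 := sbound_ge0 HB.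
exists (2 * B * n%:R + B) => [|m]; first by rewrite addr_ge0// !mulr_ge0.
have e0 := @eps_gt0 R m; have e1 := @eps_le1 R m.
have Bb s x : (size s <= maxn K 1)%N -> normc (dlist s psi x) <= B.
  move=> sK; apply: le_trans (HB s sK x) _.
  by rewrite ler_pdivrMr ?weightX_gt0// ler_peMr// weightX_ge1.
have sd : smooth (dilate psi m) := (rapid_dilate psi m).1.
case=> [|j s] sK x /=.
  rewrite -psi0 -[dilate psi m x]/(psi (2 ^- m *: x)) -mulN1r mulN1r.
  have := @mvt_row R n psi B 0 (2 ^- m *: x) (fun j => smooth_derivable j spsi).
  rewrite add0r => H; apply: le_trans (H _) _.
    by move=> j y _; apply: (Bb [:: j]); rewrite leq_maxr.
  apply: (@le_trans _ _ (2 * B * (2 ^- m * (n%:R * weight x)))).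
    rewrite ler_wpM2l ?mulr_ge0//.
    apply: le_trans (ler_wpM2l (ltW e0) (sum_abs_le_weight x)).
    rewrite mulr_sumr; apply: ler_sum => i _.
    by rewrite mxE normrM (ger0_norm (ltW e0)).
  rewrite -subr_ge0 (_ : _ - _ = 2 ^- m * B * weight x); last by ring.
  by rewrite !mulr_ge0// ltW.
have -> : dlist s (partial j (fun x0 => dilate psi m x0 + (-1))) =
    dlist (j :: s) (fun x0 => dilate psi m x0 + (-1)) by [].
rewrite dlist_add//; last exact: smooth_cst.
rewrite [in X in normc X]dlist_cst0// addr0.
rewrite (dlist_comp_line (scale_line _) (@scale_continuous _) (j :: s) spsi) normcM normc_real map_id big_cons normrM.
have P1 : `|\prod_(i <- s) (2 ^- m : R)| <= 1.
  elim: (s) => [|i t IH]; first by rewrite big_nil normr1.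
  by rewrite big_cons normrM mulr_ile1.
have Bj := Bb (j :: s) (2 ^- m *: x) (leq_trans sK (leq_maxl _ _)).
apply: (@le_trans _ _ (2 ^- m * 1 * B)).
  apply: ler_pM => //; rewrite ?normc_ge0 ?mulr_ge0//.
  by rewrite (ger0_norm (ltW e0)) ler_wpM2l// ltW.
rewrite mulr1 -mulrA ler_wpM2l ?(ltW e0)// mulrDl -[X in X <= _]add0r lerD//.
  by rewrite !mulr_ge0.
by rewrite ler_peMr.
Qed.

(** The difference splits as (b^m - b) psi_m + b (psi_m - 1). *)
Lemma modulated_close psi b K : is_cutoff psi -> symbol_rapid b ->
  exists2 C, 0 <= C & forall m, derivs_bounded K
    (fun z => (2 ^- m * C) / weight (rsubmx z) ^+ K)
    (fun z => -1 * b z + modulated_symbol psi m b z).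
Proof.
move=> cpsi rb; have psi0 := cutoff0 cpsi; have rpsi := testfun_rapid psi.
pose k := inv_fourier psi; have rk : rapid k := rapid_inv_fourier rpsi.
have k1 : cintegral k = 1 by rewrite (cintegral_inv_fourier rpsi).
have [C1 C10 H1] := mollify_close K rk k1 rb.
have [C2 C20 H2] := dilate_close K psi0.
(* One more order of decay, to absorb the growth of psi_m - 1. *)
have [B1 B10 HB1] := symbol_rapidW K K.+1 rb.
have [B2 HB2] := rpsi.2 K; have B20 := sbound_ge0 HB2.
exists (2 ^+ K * (C1 * B2) + 2 ^+ K * (B1 * C2)) => [|m].
  by rewrite addr_ge0// mulr_ge0 ?exprn_ge0// mulr_ge0.
have e0 := @eps_gt0 R m; have e1 := @eps_le1 R m.
have sd := (rapid_dilate psi m).1.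
have dd : derivs_bounded K (fun=> B2) (dilate psi m).
  have HB : derivs_bounded K (fun=> B2) psi.
    apply: derivs_bounded_le HB2 => x.
    by rewrite ler_pdivrMr ?weightX_gt0// ler_peMr// weightX_ge1.
  exact: (derivs_bounded_comp_line (scale_line _) (@scale_continuous _) rpsi.1 (fun _ => e1) HB).
have dd' := derivs_bounded_rsubmx sd dd.
have s1 : smooth (fun x => dilate psi m x + (-1)) by apply: smooth_add => //; exact: smooth_cst.
have d1 := derivs_bounded_rsubmx s1 (H2 m).
have sm := (mollify_rapid (2 ^- m) rk rb).1.
have smb : smooth (fun z => mollify (2 ^- m) k b z + -1 * b z).
  by apply: smooth_add => //; exact: smooth_scale rb.1.
have A1 := derivs_bounded_mul smb (smooth_rsubmx sd) (H1 (2 ^- m)) dd'.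
have A2 := derivs_bounded_mul rb.1 (smooth_rsubmx s1) HB1 d1.
have A := derivs_bounded_add (smooth_mul smb (smooth_rsubmx sd))
  (smooth_mul rb.1 (smooth_rsubmx s1)) A1 A2.
have E : (fun z => -1 * b z + modulated_symbol psi m b z) = (fun z =>
    (mollify (2 ^- m) k b z + -1 * b z) * dilate psi m (rsubmx z) +
    b z * (dilate psi m (rsubmx z) + -1)).
  apply/funext => z; rewrite /modulated_symbol (modulationE _ _ rb) -/k.
  move: (b z) (mollify _ _ _ z) (dilate _ _ _) => p q r.
  by rewrite mulrDl mulrDr mulN1r mulNr mulrN1 addrA subrK addrC.
rewrite E; apply: derivs_bounded_le A => z /=.
rewrite (ger0_norm (ltW e0)) exprS.
have w0 := lt0r_neq0 (weightX_gt0 K (rsubmx z)); have w1 := lt0r_neq0 (weight_gt0 (rsubmx z)).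
move: (2 ^- m) (2 ^+ K) (weight (rsubmx z)) (weight (rsubmx z) ^+ K) w0 w1 => e E' w W w0 w1.
by rewrite le_eqVlt; apply/orP; left; apply/eqP; field; rewrite w0 w1.
Qed.

Lemma modulated_cvg psi b (u : tdist R n) : is_cutoff psi -> symbol_rapid b ->
  (fun m => tdist_distr (OP (modulated_symbol psi m b) u)) @ \oo --> tdist_distr (OP b u).
Proof.
move=> cpsi rb; apply/distr_seq_cvgP => phi.
have rphi := testfun_rapid phi; set phi' := to_schwartz phi.
have rphi' := schwartz_rapid phi'.
have lu := tdist_linear u.
have [N [C [C0 uC]]] := tdist_sbound u.
have [K [C1 [C10 pC]]] := @pairing_sbound R n N.
have [C2 C20 mC] := modulated_close K cpsi rb.
have [D HD] := rphi'.2 K; have D0 := sbound_ge0 HD.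
apply/cvg_normcP => e e0.
pose A := C * (C1 * (C2 * D)).
have A0 : 0 <= A by rewrite !mulr_ge0.
have : \forall m \near \oo, (2 ^- m : R) < e / (A + 1).
  have eA : 0 < e / (A + 1) by rewrite divr_gt0// ltr_wpDl.
  exact: (@cvgr_lt R _ _ _ _ 0 (@cvg_eps R) _ eA).
apply: filterS => m me.
have rm := modulated_symbol_rapid psi m b.
pose dif := fun z => -1 * b z + modulated_symbol psi m b z.
have rdif : symbol_rapid dif.
  split; first by apply: smooth_add rm.1; exact: smooth_scale rb.1.
  move=> k; have [C' _ HC'] := modulated_close k cpsi rb.
  by exists (2 ^- m * C'); exact: HC'.
have ob := pairing_operator rb; have om := pairing_operator rm; have od := pairing_operator rdif.
have Eb c : symbol_rapid c ->
    tdist_distr (OP c u) phi = u (to_schwartz (pairing c phi')).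
  by move=> rc; rewrite (tdist_distrE (OP c u)) (OP_rapid rc) (transposeE _ _ (pairing_operator rc)).
have Ed := congr2 (fun p q : R[i]^o => normc (p - q)) (Eb _ rb) (Eb _ rm).
apply: (@eq_ind_r _ _ (fun t => t < e) _ _ Ed) => {Ed}; rewrite /= normcB.
have [rPb _ _] := ob; have [rPm _ _] := om; have [rPd _ _] := od.
have -> : u (to_schwartz (pairing (modulated_symbol psi m b) phi')) -
    u (to_schwartz (pairing b phi')) = u (to_schwartz (pairing dif phi')).
  rewrite (pairing_linl (-1) rb rm rphi') to_schwartz_lin ?lu; last 2 first.
  - exact: rPb.
  - exact: rPm.
  by rewrite scaleN1r addrC.
have S : sbound N (C1 * (2 ^- m * C2 * D)) (to_schwartz (pairing dif phi')).
  by rewrite to_schwartzE; [exact: pC (mC m) _ _|exact: rPd].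
apply: le_lt_trans (uC _ _ S) _.
have -> : C * (C1 * (2 ^- m * C2 * D)) = 2 ^- m * A.
  by rewrite /A; move: (2 ^- m) => t; ring.
apply: (@le_lt_trans _ _ (2 ^- m * (A + 1))).
  by rewrite ler_wpM2l ?(ltW (@eps_gt0 R m))// lerDl.
by rewrite -ltr_pdivlMr// ltr_wpDl.
Qed.

End ModulatedConvergence.

(** * The operators a(x,D) *)

Section Operators.
Context {R : realType} {n : nat}.
Implicit Types (a b : symbol R n) (u : tdist R n).

Lemma vfm_limit_unique a u v w : vfm_limit a u v -> vfm_limit a u w -> v = w.
Proof.
move=> av aw; have [psi cpsi] := @cutoff_exists R n.
exact: distr_cvg_unique (av psi cpsi) (aw psi cpsi).
Qed.

Lemma vfm_operatorE a u v : vfm_limit a u v -> vfm_operator a u = v.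
Proof.
move=> av; apply: (@vfm_limit_unique a u) (av).
exact: (@xgetPex _ 0 [set v | vfm_limit a u v] (ex_intro _ v av)).
Qed.

Lemma vfm_limit_lin a (c : R[i]) u u' v v' : vfm_limit a u v -> vfm_limit a u' v' ->
  vfm_limit a (c *: u + u') (c *: v + v').
Proof.
move=> av av' psi cpsi; apply/distr_seq_cvgP => phi.
have /distr_seq_cvgP/(_ phi) l := av psi cpsi.
have /distr_seq_cvgP/(_ phi) l' := av' psi cpsi.
rewrite distr_linE.
rewrite (_ : (fun m => _) = fun m => c * tdist_distr (OP (modulated_symbol psi m a) u) phi +
    tdist_distr (OP (modulated_symbol psi m a) u') phi).
  apply: (@cvgD _ (R[i]^o)) l'.
  exact: (@cvgMl_tmp R[i]).
by apply/funext => m; rewrite OP_linear tdist_distr_linear.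
Qed.

Lemma vfm_limit0 a : vfm_limit a 0 0.
Proof.
move=> psi cpsi; rewrite (_ : (fun m => _) = fun=> 0); first exact: cvg_cst.
apply/funext => m.
have OP0 := OP_linear (modulated_symbol psi m a) (-1) 0 0.
have t0 := @tdist_distr_linear R n (-1) 0 0.
move: OP0 t0; rewrite !scaleN1r !addNr => -> .
by [].
Qed.

Lemma vfm_linear a : linear_operator (vfm_operator a).
Proof.
split; first by exists 0; exact: vfm_limit0.
move=> c u u' [v av] [v' av']; have av2 := @vfm_limit_lin a c _ _ _ _ av av'; split.
  by exists (c *: v + v').
by rewrite (vfm_operatorE av2) (vfm_operatorE av) (vfm_operatorE av').
Qed.

Lemma vfm_compatible : OP_compatible (@vfm_operator R n).
Proof.
move=> b /S_minus_inftyP rb.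
have lim u : vfm_limit b u (tdist_distr (OP b u)).
  by move=> psi cpsi; exact: modulated_cvg.
split; last by move=> u; exact: vfm_operatorE.
by apply/seteqP; split => // u _; exists (tdist_distr (OP b u)).
Qed.

Lemma modulated_symbol_compatible (OPt : symbol R n -> operator R n) psi m a u :
  OP_compatible OPt ->
  OPt (modulated_symbol psi m a) u = tdist_distr (OP (modulated_symbol psi m a) u).
Proof.
move=> cOPt; apply: (proj2 (cOPt _ _)).
exact/S_minus_inftyP/modulated_symbol_rapid.
Qed.

Lemma eq_cvg_distr (v_ w_ : nat -> distr R n) (v w : distr R n) : v_ =1 w_ -> v = w ->
  w_ @ \oo --> w -> v_ @ \oo --> v.
Proof. by move=> /funext -> ->. Qed.

Lemma vfm_operator_stable : vfm_stable (@vfm_operator R n).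
Proof.
move=> b _ u [v bv] psi cpsi; apply: eq_cvg_distr (vfm_operatorE bv) (bv psi cpsi) => m.
exact: modulated_symbol_compatible vfm_compatible.
Qed.

End Operators.

Theorem theorem5p9 (R : realType) (n : nat) (hn : (0 < n)%N) :
  admissible_assignment (@vfm_operator R n) /\
  (forall OPt : symbol R n -> operator R n, admissible_assignment OPt ->
   forall a : symbol R n, S11_infty a -> operator_sub (OPt a) (vfm_operator a)).
Proof.
split.
  split; [by move=> a _; exact: vfm_linear|exact: vfm_compatible|exact: vfm_operator_stable].
move=> OPt [_ cOPt sOPt] a Sa.
have lim u : op_dom (OPt a) u -> vfm_limit a u (OPt a u).
  move=> du psi cpsi; apply: eq_cvg_distr (erefl _) (sOPt a Sa u du psi cpsi) => m.
  exact/esym/modulated_symbol_compatible.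
split=> u du; first by exists (OPt a u); exact: lim.
exact: esym (vfm_operatorE (lim u du)).
Qed.
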